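(* Let $(q,T)\in\mathrm{Crit}(\mathcal{S}_k)$ be a critical point of the free time action functional $\mathcal{S}_k$ which admits a non-degenerate orbit cylinder. Let $i(q,T)$ be the Morse index of $(q,T)$ as a critical point of $\mathcal{S}_k$, let $i_T(q)$ be the Morse index of $q$ as a critical point of the fixed period action functional $\mathcal{S}_k^T$, and let $\chi(q,T)\in\{-1,1\}$ be the correction term. Then $$i(q,T)=i_T(q)+\frac12-\frac12\chi(q,T).$$
   Context: Setting. $(M,g)$ is a closed connected orientable Riemannian manifold, $\pi:T^*M\to M$ its cotangent bundle, $\omega_0=d\lambda_0=dp\wedge dq$ the canonical symplectic form, $\sigma\in\Omega^2(M)$ a closed $2$-form whose lift $\widetilde\sigma$ to the universal cover $\widetilde M$ is exact and has a primitive $\theta\in\Omega^1(\widetilde M)$ with $\sup_{q\in\widetilde M}|\theta_q|<\infty$ (norm induced by the lift of $g$). Put $\omega=\omega_0+\pi^*\sigma$. $H\in C^\infty(T^*M,\mathbb{R})$ is a Tonelli Hamiltonian: it is fibrewise strictly convex (fibrewise Hessian positive definite) and $\lim_{|p|\to\infty}H(q,p)/|p|=\infty$ uniformly in $q$. $X_H$ is defined by $\omega(\cdot,X_H)=dH$. $L\in C^\infty(TM,\mathbb{R})$ is the Fenchel dual Lagrangian $L(q,v)=\max_{p\in T_q^*M}\{p(v)-H(q,p)\}$. $k$ is a regular value of $H$ and $\Sigma=H^{-1}(k)$. Functionals. $S^1=\mathbb{R}/\mathbb{Z}$; $\Lambda M$ is the Hilbert manifold of $W^{1,2}$-loops $S^1\to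 M$. For each free homotopy class $\alpha$ fix a reference loop $q_\alpha$ in $\alpha$. For $q\in\Lambda M$ in class $\alpha$ let $\bar q:S^1\times[0,1]\to M$ be any continuous $W^{1,2}$ map with $\bar q(t,0)=q(t)$, $\bar q(t,1)=q_\alpha(t)$; under the assumptions on $\sigma$, $\int_{S^1\times[0,1]}\bar q^*\sigma$ does not depend on the choice of $\bar q$. The free time action functional is $$\mathcal{S}_k:\Lambda M\times\mathbb{R}^+\to\mathbb{R},\qquad \mathcal{S}_k(q,T)=T\int_{S^1}\Big(L\big(q,\tfrac{\dot q}{T}\big)+k\Big)dt+\int_{S^1\times[0,1]}\bar q^*\sigma,$$ and the fixed period action functional is $\mathcal{S}_k^T(q)=\mathcal{S}_k(q,T)$. $(q,T)$ is a critical point of $\mathcal{S}_k$ iff $\gamma(t)=q(t/T)$ is the projection to $M$ of a closed orbit of $X_H$ contained in $\Sigma$; in that case $q$ is a critical point of $\mathcal{S}_k^T$. Morse indices. $i(q,T)$ is the maximal dimension of a subspace of $W^{1,2}(S^1,q^*TM)\times\mathbb{R}$ on which the second variation $d^2_{(q,T)}\mathcal{S}_k$ is negative definite; $i_T(q)$ is the maximal dimension of a subspace of $W^{1,2}(S^1,q^*TM)$ on which $d^2_q\mathcal{S}_k^T$ is negative definite. Both are finite. Orbit cylinders. $(q,T)\in\mathrm{Crit}(\mathcal{S}_k)$ admits an orbit cylinder if there are $\varepsilon>0$ and a family $\{(q_{k+s},T(k+s))\}_{s\in(-\varepsilon,\varepsilon)}$, smooth in $s$, with $(q_{k+s},T(k+s))\in\mathrm{Crit}(\mathcal{S}_{k+s})$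 and $(q_k,T(k))=(q,T)$. It is non-degenerate if $T'(k)\neq0$, and then the correction term is $\chi(q,T)=\mathrm{sign}(-T'(k))\in\{-1,1\}$ (computed with any non-degenerate orbit cylinder about $(q,T)$). *)

(* Defs.v *)
From HB Require Import structures.
From mathcomp Require Import all_boot all_order all_algebra.
From mathcomp Require Import all_classical all_reals all_analysis.

Set Implicit Arguments.
Unset Strict Implicit.
Unset Printing Implicit Defensive.

Import Order.TTheory GRing.Theory Num.Theory.
Import numFieldNormedType.Exports.

Local Open Scope classical_set_scope.
Local Open Scope ring_scope.

(* * Smooth maps between finite dimensional normed spaces *)

(* Used for U open and V finite dimensional: a map all of whose directional
   derivatives are C^r is C^(r+1), so this is the usual class C^r. *)
Fixpoint Cr (R : realType) (V W : normedModType R) (r : nat) (U : set V)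
    (f : V -> W) : Prop :=
  match r with
  | 0%N => forall x, U x -> {for x, continuous f}
  | r'.+1 => (forall x, U x -> differentiable f x) /\
             (forall v, Cr r' U (fun x => 'D_v f x))
  end.

Definition smooth_on (R : realType) (V W : normedModType R) (U : set V)
    (f : V -> W) : Prop :=
  forall r, Cr r U f.

(* * Smooth manifolds without boundary *)

Record manifold (R : realType) (n : nat) := Manifold {
  carrier :> topologicalType;
  chart : Type;
  dom : chart -> set carrier;
  coord : chart -> carrier -> 'rV[R]_n;
  param : chart -> 'rV[R]_n -> carrier;
  carrier_hausdorff : hausdorff_space carrier;
  carrier_second_countable : @second_countable carrier;
  dom_cover : forall x, exists c, dom c x;
  dom_open : forall c, open (dom c);
  im_open : forall c, open (coord c @` dom c);
  coord_continuous : forall c, {within dom c, continuous (coord c)};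
  param_continuous : forall c,
    {within coord c @` dom c, continuous (param c)};
  coordK : forall c x, dom c x -> param c (coord c x) = x;
  transition_smooth : forall c d,
    smooth_on (coord c @` (dom c `&` dom d)) (coord d \o param c)
}.

Arguments chart {R n}.
Arguments dom {R n m} : rename.
Arguments coord {R n m} : rename.
Arguments param {R n m} : rename.

Section Geometry.
Context {R : realType} {n : nat}.
Implicit Types M N : manifold R n.

Definition im M (c : chart M) : set 'rV[R]_n := coord c @` dom c.

Definition dot (p v : 'rV[R]_n) : R := \sum_(i < n) p 0 i * v 0 i.

(* A tangent vector at x is the family of its components in all the charts
   around x (and 0 in the other charts); covectors are encoded likewise.  The
   representation of a (co)vector is unique, but only the families singled out
   by [is_tangent] (resp. of the form [covec c y p]) are (co)vectors. *)
Definition tvec M : Type := chart M -> 'rV[R]_n.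

(* The derivative of the M-valued map f at a in the direction v. *)
Definition tderiv (V : normedModType R) M (f : V -> M) (a v : V) : tvec M :=
  fun d => if `[< dom d (f a) >] then 'D_v (coord d \o f) a else 0.

(* The vector at param c y with components v in the chart c. *)
Definition vec M (c : chart M) (y v : 'rV[R]_n) : tvec M :=
  tderiv (param c) y v.

Definition is_tangent M (x : M) (w : tvec M) : Prop :=
  exists c v, dom c x /\ w = vec c (coord c x) v.

(* The covector at param c y with components p in the chart c: the
   differential of the function dot p \o coord c. *)
Definition covec M (c : chart M) (y p : 'rV[R]_n) : tvec M :=
  fun d => if `[< dom d (param c y) >] then
    \row_j 'D_(delta_mx 0 j) (fun y' => dot p (coord c (param d y')))
             (coord d (param c y))
  else 0.

Definition smooth_to (V : normedModType R) M (U : set V) (f : V -> M) : Prop :=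
  (forall a, U a -> {for a, continuous f}) /\
  forall d : chart M, smooth_on (U `&` f @^-1` dom d) (coord d \o f).

Definition smooth_map N M (f : N -> M) : Prop :=
  forall c : chart N, smooth_to (im c) (f \o param c).

Definition one_form M := M -> tvec M -> R.
Definition two_tensor M := M -> tvec M -> tvec M -> R.

Definition one_form_in M (theta : one_form M) (c : chart M)
    (v y : 'rV[R]_n) : R :=
  theta (param c y) (vec c y v).

Definition two_tensor_in M (b : two_tensor M) (c : chart M)
    (v w y : 'rV[R]_n) : R :=
  b (param c y) (vec c y v) (vec c y w).

Definition is_one_form M (theta : one_form M) : Prop :=
  forall c : chart M,
  (forall y, im c y -> forall a v w, one_form_in theta c (a *: v + w) y =
     a * one_form_in theta c v y + one_form_in theta c w y) /\
  (forall v, smooth_on (im c) (one_form_in theta c v)).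

Definition is_two_tensor M (b : two_tensor M) : Prop :=
  forall c : chart M,
  (forall y, im c y -> forall a u v w, two_tensor_in b c (a *: u + v) w y =
     a * two_tensor_in b c u w y + two_tensor_in b c v w y) /\
  (forall y, im c y -> forall a u v w, two_tensor_in b c w (a *: u + v) y =
     a * two_tensor_in b c w u y + two_tensor_in b c w v y) /\
  (forall v w, smooth_on (im c) (two_tensor_in b c v w)).

Definition riemannian_metric M (g : two_tensor M) : Prop :=
  is_two_tensor g /\
  forall (c : chart M) y, im c y ->
    (forall v w, two_tensor_in g c v w y = two_tensor_in g c w v y) /\
    (forall v, v != 0 -> 0 < two_tensor_in g c v v y).

Definition is_two_form M (sigma : two_tensor M) : Prop :=
  is_two_tensor sigma /\
  forall (c : chart M) y, im c y -> forall v, two_tensor_in sigma c v v y = 0.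

Definition closed_two_form M (sigma : two_tensor M) : Prop :=
  is_two_form sigma /\
  forall (c : chart M) y, im c y -> forall u v w,
    'D_u (two_tensor_in sigma c v w) y + 'D_v (two_tensor_in sigma c w u) y +
    'D_w (two_tensor_in sigma c u v) y = 0.

(* Existence of a nowhere vanishing n-form, given by its coefficient in each
   chart. *)
Definition orientable M : Prop :=
  exists vol : chart M -> 'rV[R]_n -> R,
    (forall c, smooth_on (im c) (vol c)) /\
    (forall c y, im c y -> vol c y != 0) /\
    (forall c d y, im c y -> dom d (param c y) ->
       vol c y = vol d (coord d (param c y)) *
                 \det (jacobian (coord d \o param c) y)).

Definition closed_manifold M : Prop := compact [set: M].

(* ** Universal cover *)

Definition smooth_covering N M (pr : N -> M) : Prop :=
  smooth_map pr /\ (forall x, exists z, pr z = x) /\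
  forall x : M, exists U : set M, open U /\ U x /\
    exists (I : Type) (sheet : I -> set N) (sec : I -> M -> N),
      pr @^-1` U = \bigcup_i sheet i /\ trivIset setT sheet /\
      forall i, open (sheet i) /\
        (forall z, sheet i z -> sec i (pr z) = z) /\
        (forall y, U y -> sheet i (sec i y) /\ pr (sec i y) = y) /\
        (forall c : chart M,
           smooth_to (coord c @` (dom c `&` U)) (sec i \o param c)).

Definition strip : set (R * R) := [set z | 0 <= z.2 <= 1].

Definition simply_connected N : Prop :=
  (exists x : N, True) /\ connected [set: N] /\
  forall gam : R -> N, continuous gam -> (forall t, gam (t + 1) = gam t) ->
    exists (h : R * R -> N) (x : N), {within strip, continuous h} /\
      (forall t s, 0 <= s <= 1 -> h (t + 1, s) = h (t, s)) /\
      (forall t, h (t, 0) = gam t) /\ (forall t, h (t, 1) = x).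

Definition universal_cover N M (pr : N -> M) : Prop :=
  smooth_covering pr /\ simply_connected N.

(* d theta = pr^* sigma *)
Definition primitive_of_lift N M (pr : N -> M) (sigma : two_tensor M)
    (theta : one_form N) : Prop :=
  forall (c : chart N) y, im c y -> forall v w,
    'D_v (one_form_in theta c w) y - 'D_w (one_form_in theta c v) y =
    sigma (pr (param c y)) (tderiv (pr \o param c) y v)
                           (tderiv (pr \o param c) y w).

(* The operator norm of theta with respect to pr^* g is bounded. *)
Definition bounded_one_form N M (pr : N -> M) (g : two_tensor M)
    (theta : one_form N) : Prop :=
  exists C : R, forall (c : chart N) y, im c y -> forall v,
    `|one_form_in theta c v y| <=
    C * Num.sqrt (g (pr (param c y)) (tderiv (pr \o param c) y v)
                                     (tderiv (pr \o param c) y v)).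

(* ** Tonelli Hamiltonians *)

(* Functions on T^*M and on TM are given by their values on pairs (x, p),
   resp. (x, v); only covectors, resp. tangent vectors, at x matter. *)
Definition cotangent_fun M := M -> tvec M -> R.
Definition tangent_fun M := M -> tvec M -> R.

Definition cotangent_in M (H : cotangent_fun M) (c : chart M)
    (z : 'rV[R]_n * 'rV[R]_n) : R :=
  H (param c z.1) (covec c z.1 z.2).

Definition tangent_in M (L : tangent_fun M) (c : chart M)
    (z : 'rV[R]_n * 'rV[R]_n) : R :=
  L (param c z.1) (vec c z.1 z.2).

Definition conorm M (g : two_tensor M) (c : chart M) (y p : 'rV[R]_n) : R :=
  sup [set dot p v | v in [set v | two_tensor_in g c v v y <= 1]].

Definition tonelli M (g : two_tensor M) (H : cotangent_fun M) : Prop :=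
  (forall c : chart M, smooth_on (im c `*` setT) (cotangent_in H c)) /\
  (forall (c : chart M) y, im c y -> forall p w, w != 0 ->
     0 < 'D_w (fun p' => 'D_w (fun p'' => cotangent_in H c (y, p'')) p') p) /\
  (forall K : R, exists B : R, forall (c : chart M) y, im c y ->
     forall p, B < conorm g c y p ->
       K < cotangent_in H c (y, p) / conorm g c y p).

Definition regular_value M (H : cotangent_fun M) (k : R) : Prop :=
  forall (c : chart M) z, im c z.1 -> cotangent_in H c z = k ->
    exists w, 'D_w (cotangent_in H c) z != 0.

Definition fenchel_dual M (H : cotangent_fun M) (L : tangent_fun M) : Prop :=
  (forall c : chart M, smooth_on (im c `*` setT) (tangent_in L c)) /\
  forall (c : chart M) y v, im c y ->
    (forall p, dot p v - cotangent_in H c (y, p) <= tangent_in L c (y, v)) /\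
    (exists p, tangent_in L c (y, v) = dot p v - cotangent_in H c (y, p)).

End Geometry.

Section FreeTimeAction.
Context {R : realType} {n : nat}.
Variable M : manifold R n.
Local Notation mu := (@lebesgue_measure R).

(* ** Sobolev loops, cylinders and vector fields *)

(* Absolute continuity, in the form of the fundamental theorem of calculus for
   the pointwise derivative. *)
Definition ac_on (a b : R) (f : R -> R) : Prop :=
  mu.-integrable `[a, b] (EFin \o derive1 f) /\
  forall x, a <= x <= b -> f x = f a + \int[mu]_(t in `[a, x]) derive1 f t.

Definition W12_on (a b : R) (f : R -> 'rV[R]_n) : Prop :=
  forall i, ac_on a b (fun t => f t 0 i) /\
    mu.-integrable `[a, b]
      (EFin \o (fun t => derive1 (fun t' => f t' 0 i) t ^+ 2)).

(* Continuous W^{1,2} maps on a rectangle, through the absolute continuity on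
   almost every line (Beppo Levi, Nikodym). *)
Definition W12_on_rect (a b a' b' : R) (f : R * R -> 'rV[R]_n) : Prop :=
  forall i, let fi z := f z 0 i in
    {ae mu, forall s, a' <= s <= b' -> ac_on a b (fun t => fi (t, s))} /\
    {ae mu, forall t, a <= t <= b -> ac_on a' b' (fun s => fi (t, s))} /\
    (mu \x mu)%E.-integrable (`[a, b] `*` `[a', b'])
      (EFin \o (fun z => ('D_(1, 0) fi z) ^+ 2)) /\
    (mu \x mu)%E.-integrable (`[a, b] `*` `[a', b'])
      (EFin \o (fun z => ('D_(0, 1) fi z) ^+ 2)).

Definition loop := R -> M.

Definition W12_loop (q : loop) : Prop :=
  continuous q /\ (forall t, q (t + 1) = q t) /\
  forall (c : chart M) a b, a <= b ->
    (forall t, a <= t <= b -> dom c (q t)) -> W12_on a b (coord c \o q).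

Definition smooth_loop (q : loop) : Prop :=
  smooth_to setT q /\ (forall t, q (t + 1) = q t).

Definition W12_cylinder (q q' : loop) (h : R * R -> M) : Prop :=
  {within strip, continuous h} /\
  (forall t s, 0 <= s <= 1 -> h (t + 1, s) = h (t, s)) /\
  (forall t, h (t, 0) = q t) /\ (forall t, h (t, 1) = q' t) /\
  forall (c : chart M) a b a' b', a <= b -> 0 <= a' -> a' <= b' -> b' <= 1 ->
    (forall t s, a <= t <= b -> a' <= s <= b' -> dom c (h (t, s))) ->
    W12_on_rect a b a' b' (coord c \o h).

(* For W^{1,2} loops this is the same as being freely homotopic. *)
Definition same_class (q q' : loop) : Prop := exists h, W12_cylinder q q' h.

(* [ref q] is the reference loop of the free homotopy class of q. *)
Definition reference_loops (ref : loop -> loop) : Prop :=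
  (forall q, W12_loop q -> W12_loop (ref q) /\ same_class q (ref q)) /\
  (forall q q', W12_loop q -> W12_loop q' -> same_class q q' ->
     ref q = ref q').

Definition cylinder_integral (sigma : two_tensor M) (h : R * R -> M) : R :=
  \int[(mu \x mu)%E]_(z in `[0, 1] `*` `[0, 1])
     sigma (h z) (tderiv h z (1, 0)) (tderiv h z (0, 1)).

(* A is the function q |-> \int qbar^* sigma, which does not depend on qbar
   because the lift of sigma has a bounded primitive. *)
Definition flux_functional (sigma : two_tensor M) (ref : loop -> loop)
    (A : loop -> R) : Prop :=
  forall q qbar, W12_loop q -> W12_cylinder q (ref q) qbar ->
    A q = cylinder_integral sigma qbar.

Definition velocity (q : loop) (t : R) : tvec M := tderiv q t 1.

Definition field := R -> tvec M.

Definition W12_field (q : loop) (xi : field) : Prop :=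
  (forall t, is_tangent (q t) (xi t)) /\ (forall t, xi (t + 1) = xi t) /\
  forall (c : chart M) a b, a <= b ->
    (forall t, a <= t <= b -> dom c (q t)) ->
    W12_on a b (fun t => xi t c).

(* Convergence in W^{1,2}(S^1, q^*TM). *)
Definition W12_cvg (q : loop) (xi_ : nat -> field) (xi : field) : Prop :=
  forall (c : chart M) a b, a <= b ->
    (forall t, a <= t <= b -> dom c (q t)) -> forall i : 'I_n,
    let e m t := xi_ m t c 0 i - xi t c 0 i in
    (fun m => \int[mu]_(t in `[a, b]) (e m t) ^+ 2) @ \oo --> (0 : R) /\
    (fun m => \int[mu]_(t in `[a, b]) derive1 (e m) t ^+ 2) @ \oo --> (0 : R).

(* ** The action functionals and their first and second variations *)

Variables (L : tangent_fun M) (A : loop -> R).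

Definition free_action (k : R) (q : loop) (T : R) : R :=
  T * (\int[mu]_(t in `[0, 1]) (L (q t) (T^-1 *: velocity q t) + k)) + A q.

Definition fixed_action (k T : R) (q : loop) : R := free_action k q T.

Definition variation (q : loop) (eps : R) (u : R * R -> M) : Prop :=
  0 < eps /\ smooth_to [set z | `|z.1| < eps] u /\
  (forall r t, `|r| < eps -> u (r, t + 1) = u (r, t)) /\
  (forall t, u (0, t) = q t).

Definition variation_field (u : R * R -> M) : field :=
  fun t => tderiv u (0, t) (1, 0).

(* Critical points are smooth, being reparametrized projections of orbits. *)
Definition critical (k : R) (q : loop) (T : R) : Prop :=
  smooth_loop q /\ 0 < T /\
  forall eps u b, variation q eps u ->
    is_derive (0 : R) (1 : R)
      (fun r : R => free_action k (fun t => u (r, t)) (T + r * b)) 0.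

Definition second_derivative_at0 (f : R -> R) (d : R) : Prop :=
  (\forall r \near (0 : R), derivable f r 1) /\
  is_derive (0 : R) (1 : R) (derive1 f) d.

Definition symmetric_bilinear_on (X : lmodType R) (E : set X)
    (B : X -> X -> R) : Prop :=
  (forall x y, E x -> E y -> B x y = B y x) /\
  (forall a x y z, E x -> E y -> E z -> B (a *: x + y) z = a * B x z + B y z).

(* The Hessian of the free time action at a critical point (q, T), as a
   continuous symmetric bilinear form on W^{1,2}(S^1, q^*TM) x R.  It is
   determined by its values on smooth variations. *)
Definition free_second_variation (k : R) (q : loop) (T : R)
    (B : field * R -> field * R -> R) : Prop :=
  symmetric_bilinear_on [set x | W12_field q x.1] B /\
  (forall (x_ : nat -> field * R) (x : field * R),
     (forall m, W12_field q (x_ m).1) -> W12_field q x.1 ->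
     W12_cvg q (fun m => (x_ m).1) x.1 -> (fun m => (x_ m).2) @ \oo --> x.2 ->
     (fun m => B (x_ m) (x_ m)) @ \oo --> B x x) /\
  (forall eps u b, variation q eps u ->
     second_derivative_at0
       (fun r => free_action k (fun t => u (r, t)) (T + r * b))
       (B (variation_field u, b) (variation_field u, b))).

Definition fixed_second_variation (k T : R) (q : loop)
    (B : field -> field -> R) : Prop :=
  symmetric_bilinear_on [set xi | W12_field q xi] B /\
  (forall (xi_ : nat -> field) (xi : field),
     (forall m, W12_field q (xi_ m)) -> W12_field q xi -> W12_cvg q xi_ xi ->
     (fun m => B (xi_ m) (xi_ m)) @ \oo --> B xi xi) /\
  (forall eps u, variation q eps u ->
     second_derivative_at0 (fun r => fixed_action k T (fun t => u (r, t)))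
       (B (variation_field u) (variation_field u))).

(* ** Morse indices *)

(* B is negative definite on the span of e_0, ..., e_(d-1); in particular the
   e_i are linearly independent and the span has dimension d. *)
Definition negative_subspace (X : lmodType R) (E : set X) (B : X -> X -> R)
    (d : nat) : Prop :=
  exists e : 'I_d -> X, (forall i, E (e i)) /\
    forall a : 'I_d -> R, (exists i, a i != 0) ->
      B (\sum_(i < d) a i *: e i) (\sum_(i < d) a i *: e i) < 0.

Definition negative_index (X : lmodType R) (E : set X) (B : X -> X -> R)
    (d : nat) : Prop :=
  negative_subspace E B d /\ forall d', negative_subspace E B d' -> (d' <= d)%N.

Definition free_morse_index (k : R) (q : loop) (T : R) (i : nat) : Prop :=
  exists B, free_second_variation k q T B /\
    negative_index [set x : field * R | W12_field q x.1] B i.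

Definition fixed_morse_index (k T : R) (q : loop) (i : nat) : Prop :=
  exists B, fixed_second_variation k T q B /\
    negative_index [set xi : field | W12_field q xi] B i.

(* ** Orbit cylinders *)

(* The family is parametrized by the energy e in ]k - eps, k + eps[. *)
Definition orbit_cylinder (k : R) (q : loop) (T : R) (eps : R)
    (qs : R -> loop) (Ts : R -> R) : Prop :=
  0 < eps /\
  smooth_to [set z : R * R | `|z.1 - k| < eps] (fun z => qs z.1 z.2) /\
  smooth_on [set e : R | `|e - k| < eps] Ts /\
  (forall e, `|e - k| < eps -> critical e (qs e) (Ts e)) /\
  qs k = q /\ Ts k = T.

Definition nondegenerate_orbit_cylinder (k : R) (q : loop) (T : R) (eps : R)
    (qs : R -> loop) (Ts : R -> R) : Prop :=
  orbit_cylinder k q T eps qs Ts /\ derive1 Ts k != 0.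

Definition correction_term (k : R) (Ts : R -> R) : R := Num.sg (- derive1 Ts k).

End FreeTimeAction.

(* Main.v *)
(* Let [z] be the variation field of the orbit cylinder and [e = (z, T'(k))].
   Since energy enters the action only through the summand [s T], differentiating
   [d S_{k+s} (q_{k+s}, T(k+s)) = 0] in [s] gives [B (e, (xi, b)) = - b] for the
   Hessian [B] of [S_k].  So [e] is [B]-orthogonal to the fields with [b = 0], on
   which [B] is the Hessian of [S_k^T], it is transversal to them as [T'(k) != 0],
   and [B (e, e) = - T'(k)]: the index increases by one exactly when [T'(k) > 0].

   The Hessians are only known through second derivatives along smooth variations.
   Both identities are therefore proved for smooth fields supported in the domain of
   one chart, which can be added to the variation field of any family by moving the
   loops within that chart, and follow in general because finite sums of such fields
   are dense in W^{1,2}.  The mixed derivatives exist by differentiation under the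
   integral sign; for the flux term, the cylinder ending at the reference loop is
   chosen as a smooth contraction of the family followed by a fixed cylinder. *)

Require Import Defs.
From HB Require Import structures.
From mathcomp Require Import all_boot all_order all_algebra.
From mathcomp Require Import all_classical all_reals all_analysis.
From mathcomp Require Import ring lra zify measurable_realfun.
Import Defs.

Set Implicit Arguments.
Unset Strict Implicit.
Unset Printing Implicit Defensive.

Import Order.TTheory GRing.Theory Num.Theory.
Import numFieldNormedType.Exports.

Local Open Scope classical_set_scope.
Local Open Scope ring_scope.

(** The two facts to be compared are of different kinds: the Hessian is known along families with
    affine period [T + r * b], whereas the period of the orbit cylinder is an arbitrary smooth
    function. The period shift is therefore a parameter of its own. With [p] = (energy shift, period
    shift) and [r] the size of a displacement, the action has one pair of mixed coefficients [l1],
    [l2]. Criticality at period shift [Ts (k + s) - T] gives [- b = l1 + T' * l2]; the linear shift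
    [x * T'] with [r = x], polarized, identifies the same number with the Hessian. Only the
    existence of the coefficients is used.

    The delicate summand is the flux: the integrand of an arbitrary W^{1,2} cylinder is not known to
    be measurable. Additivity of the integral is therefore proved for suprema over simple functions,
    and the fixed half of the cylinder enters through two constants only. The analysis on rectangles
    shows that a smooth half and a W^{1,2} half glue to an admissible cylinder. *)

#[local] Instance ae_lebesgue_filter (R : realType) : Filter (nbhs (almost_everywhere (@lebesgue_measure R))).
Proof. exact: (ae_filter_ringOfSetsType (@lebesgue_measure R)). Qed.

(** * Calculus of C^r maps *)

Section SmoothCalculus.
Context {R : realType}.

Lemma near_eq_differentiable (V W : normedModType R) (f g : V -> W) (x : V) :
  (\forall y \near x, f y = g y) -> differentiable f x -> differentiable g x.
Proof.
move=> fg df.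
have [dfc dfE] := (diff_locallyP _ _).1 df.
have fgx : f x = g x by exact: (nbhs_singleton fg).
have gE : g \o shift x = cst (g x) + 'd f x +o_ 0 id.
  apply/eqaddoP => e e0; have /eqaddoP/(_ e e0) H := dfE.
  have fg0 : \forall y \near (0 : V), f (y + x) = g (y + x).
    by move: fg; rewrite (near_shift 0); apply: filterS => y /=; rewrite subr0.
  near=> y.
  have -> : (g \o shift x - (cst (g x) + 'd f x)) y
          = (f \o shift x - (cst (f x) + 'd f x)) y.
    rewrite !fctE /= fgx; congr (_ - _); apply/esym.
    by near: y.
  by near: y.
by apply/diff_locallyP; rewrite (diff_unique dfc gE); split.
Unshelve. all: by end_near. Qed.

(** Scalar multiplication under a name that can carry the bilinear structure, from which
    differentiability of products [a y *: f y] follows. *)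
Definition scale_bilin (V : normedModType R) : R -> V -> V := fun a v => a *: v.

Lemma scale_is_bilinear (V : normedModType R) :
  bilinear_for
    (GRing.Scale.Law.clone _ _ *:%R _) (GRing.Scale.Law.clone _ _ *:%R _)
    (@scale_bilin V).
Proof.
split=> [u'|u] a x y /=; rewrite /scale_bilin.
- by rewrite scalerDl scalerA.
- by rewrite scalerDr !scalerA mulrC.
Qed.

HB.instance Definition _ (V : normedModType R) :=
  bilinear_isBilinear.Build R R V V _ _ (@scale_bilin V) (@scale_is_bilinear V).

Lemma scale_bilin_continuous (V : normedModType R) :
  continuous (fun p : R * V => scale_bilin p.1 p.2).
Proof. by move=> p; exact: scale_continuous. Qed.

Lemma differentiable_scale (V W : normedModType R) (a : V -> R) (f : V -> W) x :
  differentiable a x -> differentiable f x ->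
  differentiable (fun y => a y *: f y) x.
Proof.
move=> da df; have dp := differentiable_pair da df.
apply: (@differentiable_comp _ _ _ _ (fun y => (a y, f y))
  (fun p => scale_bilin p.1 p.2) x dp).
exact: (differentiable_bilin (a x, f x) (@scale_bilin_continuous W)).
Qed.

Lemma derive_scale (V W : normedModType R) (a : V -> R) (f : V -> W) x v :
  differentiable a x -> differentiable f x ->
  'D_v (fun y => a y *: f y) x = a x *: 'D_v f x + 'D_v a x *: f x.
Proof.
move=> da df; have dp := differentiable_pair da df.
have db := differentiable_bilin (a x, f x) (@scale_bilin_continuous W).
rewrite (deriveE _ (differentiable_scale da df)).
have /(congr1 (fun h => h v)) /= := diff_comp dp db.
rewrite (diff_bilin (a x, f x) (@scale_bilin_continuous W)) /= diff_pair//.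
by rewrite !deriveE.
Qed.

(** Finite dimension in the form that the chain rule needs. [Cr] speaks of derivatives in fixed
    directions, while the derivative of a composite has the moving direction ['D_v g x], which
    [Cr_comp] expands in the fixed [e i] with the smooth coefficients [l i ('D_v g x)]. *)
Definition finite_basis (W : normedModType R) : Prop :=
  exists (m : nat) (e : 'I_m -> W) (l : 'I_m -> {linear W -> R}),
    (forall i, continuous (l i)) /\ forall w, w = \sum_i l i w *: e i.

Lemma derive_comp_lin (V W Z : normedModType R) (g : V -> W) (f : W -> Z) x v :
  differentiable g x -> differentiable f (g x) ->
  'D_v (f \o g) x = 'D_('D_v g x) f (g x).
Proof.
move=> dg df; rewrite deriveE; last exact: differentiable_comp.
by rewrite diff_comp// !deriveE.
Qed.

Lemma derive_dirD (V W : normedModType R) (f : V -> W) x u v :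
  differentiable f x -> 'D_(u + v) f x = 'D_u f x + 'D_v f x.
Proof. by move=> df; rewrite !deriveE// linearD. Qed.

Lemma derive_dirZ (V W : normedModType R) (f : V -> W) x a v :
  differentiable f x -> 'D_(a *: v) f x = a *: 'D_v f x.
Proof. by move=> df; rewrite !deriveE// linearZ. Qed.

Lemma derive_dir_sum (V W : normedModType R) (f : V -> W) x m (a : 'I_m -> R)
    (e : 'I_m -> V) :
  differentiable f x ->
  'D_(\sum_i a i *: e i) f x = \sum_i a i *: 'D_(e i) f x.
Proof.
move=> df; rewrite deriveE// linear_sum; apply: eq_bigr => i _.
by rewrite linearZ deriveE.
Qed.

Lemma nbhs_open (T : topologicalType) (U : set T) x : open U -> U x -> nbhs x U.
Proof. by move=> oU Ux; apply: open_nbhs_nbhs; split. Qed.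

Lemma Cr_eq r (V W : normedModType R) (U : set V) (f g : V -> W) :
  open U -> (forall x, U x -> f x = g x) -> Cr r U f -> Cr r U g.
Proof.
move=> oU; have nU x : U x -> nbhs x U by exact: nbhs_open.
elim: r f g => [|r IH] f g fg /=.
  move=> cf x Ux; rewrite /prop_for /continuous_at -fg//.
  apply: cvg_trans (cf x Ux).
  by apply: near_eq_cvg; near=> y; apply: fg; near: y; exact: nU.
have fgn x : U x -> \forall y \near x, f y = g y.
  by move=> Ux; near=> y; apply: fg; near: y; exact: nU.
move=> [df cf]; split=> [x Ux|v].
  by apply: near_eq_differentiable (fgn x Ux) (df x Ux).
by apply: (IH _ _ _ (cf v)) => x Ux; exact: (near_eq_derive v (fgn x Ux)).
Unshelve. all: by end_near. Qed.

Lemma Cr_sub r (V W : normedModType R) (U U' : set V) (f : V -> W) :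
  U' `<=` U -> Cr r U f -> Cr r U' f.
Proof.
move=> UU; elim: r f => [|r IH] f /=; first by move=> cf x /UU; exact: cf.
by move=> [df cf]; split=> [x /UU|v]; [exact: df|apply: IH].
Qed.

Lemma Cr_loc r (V W : normedModType R) (U : set V) (f : V -> W) :
  (forall x, U x -> exists2 N, N x & Cr r N f) -> Cr r U f.
Proof.
elim: r f => [|r IH] f /= H; first by move=> x /H[N Nx]; exact.
split=> [x /H[N Nx [df _]]|v]; first exact: df.
by apply: IH => x /H[N Nx [_ cf]]; exists N.
Qed.

Lemma CrW r (V W : normedModType R) (U : set V) (f : V -> W) :
  Cr r.+1 U f -> Cr r U f.
Proof.
elim: r f => [|r IH] f.
  by move=> [df _] x Ux; apply: differentiable_continuous; exact: df.
by move=> [df cf]; split=> // v; apply: IH.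
Qed.

Lemma Cr_continuous r (V W : normedModType R) (U : set V) (f : V -> W) :
  Cr r U f -> forall x, U x -> {for x, continuous f}.
Proof. by elim: r f => [//|r IH] f /CrW; exact: IH. Qed.

Lemma Cr_cst r (V W : normedModType R) (U : set V) (a : W) : Cr r U (fun=> a).
Proof.
elim: r a => [|r IH] a /=; first by move=> x _; exact: cvg_cst.
split=> [x _|v]; first exact: differentiable_cst.
have -> : (fun x : V => 'D_v (fun=> a) x) = (fun=> 0).
  by apply/funext => x; exact: derive_cst.
exact: IH.
Qed.

Lemma Cr_lin r (V W : normedModType R) (U : set V) (f : {linear V -> W}) :
  continuous f -> Cr r U f.
Proof.
move=> cf; case: r => [|r] /=; first by move=> x _; exact: cf.
split=> [x _|v]; first exact: linear_differentiable.
have -> : (fun x : V => 'D_v f x) = (fun=> f v).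
  by apply/funext => x; rewrite deriveE ?diff_lin//; exact: linear_differentiable.
exact: Cr_cst.
Qed.

Lemma CrD r (V W : normedModType R) (U : set V) (f g : V -> W) : open U ->
  Cr r U f -> Cr r U g -> Cr r U (fun x => f x + g x).
Proof.
move=> oU; elim: r f g => [|r IH] f g /=.
  by move=> cf cg x Ux; apply: cvgD; [exact: cf|exact: cg].
move=> [df cf] [dg cg]; split=> [x Ux|v].
  by apply: differentiableD; [exact: df|exact: dg].
apply: Cr_eq (IH _ _ (cf v) (cg v)) => // x Ux.
by rewrite -deriveD//; apply: diff_derivable; [exact: df|exact: dg].
Qed.

Lemma CrZ r (V W : normedModType R) (U : set V) (a : V -> R) (f : V -> W) :
  open U -> Cr r U a -> Cr r U f -> Cr r U (fun x => a x *: f x).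
Proof.
move=> oU; elim: r a f => [|r IH] a f.
  by move=> ca cf x Ux; apply: cvgZ; [exact: ca|exact: cf].
move=> ca cf; have [da da'] := ca; have [df df'] := cf; split=> [x Ux|v].
  by apply: differentiable_scale; [exact: da|exact: df].
have c1 := IH _ _ (CrW ca) (df' v); have c2 := IH _ _ (da' v) (CrW cf).
apply: Cr_eq (CrD oU c1 c2) => // x Ux.
by rewrite derive_scale//; [exact: da|exact: df].
Qed.

Lemma Cr_sum r (V W : normedModType R) (U : set V) (I : Type) (s : seq I)
    (f : I -> V -> W) : open U ->
  (forall i, Cr r U (f i)) -> Cr r U (fun x => \sum_(i <- s) f i x).
Proof.
move=> oU cf; elim: s => [|i s IH].
  have -> : (fun x => \sum_(i <- [::]) f i x) = (fun=> 0).
    by apply/funext => x; rewrite big_nil.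
  exact: Cr_cst.
have -> : (fun x => \sum_(j <- i :: s) f j x)
        = (fun x => f i x + \sum_(j <- s) f j x).
  by apply/funext => x; rewrite big_cons.
exact: CrD.
Qed.

Lemma Cr_lin_comp r (V W Z : normedModType R) (U : set V) (g : V -> W)
    (f : {linear W -> Z}) : open U -> continuous f ->
  Cr r U g -> Cr r U (f \o g).
Proof.
move=> oU cf; have df y : differentiable f y by exact: linear_differentiable.
elim: r g => [|r IH] g.
  by move=> cg x Ux; apply: continuous_comp; [exact: cg|exact: cf].
move=> [dg dg']; split=> [x Ux|v].
  by apply: differentiable_comp => //; exact: dg.
apply: Cr_eq (IH _ (dg' v)) => // x Ux.
rewrite derive_comp_lin//; last exact: dg.
by rewrite deriveE// diff_lin.
Qed.

Lemma Cr_comp r (V W Z : normedModType R) (U : set V) (U' : set W) (g : V -> W)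
    (f : W -> Z) : finite_basis W -> open U ->
  (forall x, U x -> U' (g x)) ->
  Cr r U g -> Cr r U' f -> Cr r U (f \o g).
Proof.
move=> [m [e [l [lc lE]]]] oU UU'.
elim: r g f UU' => [|r IH] g f UU'.
  by move=> cg cf x Ux; apply: continuous_comp; [exact: cg|apply: cf; exact: UU'].
move=> cg cf; have [dg dg'] := cg; have [df df'] := cf; split=> [x Ux|v].
  by apply: differentiable_comp; [exact: dg|apply: df; exact: UU'].
have c1 : Cr r U (fun x => \sum_i l i ('D_v g x) *: 'D_(e i) f (g x)).
  apply: Cr_sum => // i; apply: CrZ => //.
    exact: (Cr_lin_comp oU (lc i) (dg' v)).
  by apply: (IH _ ('D_(e i) f) UU'); [exact: CrW|exact: df'].
apply: Cr_eq c1 => // x Ux.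
rewrite derive_comp_lin; [|exact: dg|by apply: df; exact: UU'].
by rewrite [in RHS](lE ('D_v g x)) derive_dir_sum//; apply: df; exact: UU'.
Qed.

End SmoothCalculus.

(** * Coordinates, elementary functions and flat bumps *)

Section SmoothFunctions.
Context {R : realType}.

Lemma finite_basis_R : finite_basis (R : normedModType R).
Proof.
exists 1%N, (fun=> 1), (fun=> idfun); split; first by move=> i x; exact.
by move=> w; rewrite big_ord1 /= /GRing.scale /= mulr1.
Qed.

Lemma finite_basis_prod (V W : normedModType R) :
  finite_basis V -> finite_basis W ->
  finite_basis ((V * W)%type : normedModType R).
Proof.
move=> [m [e [l [lc lE]]]] [m' [e' [l' [lc' lE']]]].
have lin1 i : linear (fun p : V * W => l i p.1).
  by move=> a x y; rewrite /= linearP.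
have lin2 i : linear (fun p : V * W => l' i p.2).
  by move=> a x y; rewrite /= linearP.
pose L1 i : {linear (V * W)%type -> R} :=
  HB.pack (fun p : V * W => l i p.1) (GRing.isLinear.Build _ _ _ _ _ (lin1 i)).
pose L2 i : {linear (V * W)%type -> R} :=
  HB.pack (fun p : V * W => l' i p.2) (GRing.isLinear.Build _ _ _ _ _ (lin2 i)).
exists (m + m')%N, (fun i => match fintype.split i with inl j => (e j, 0) | inr j => (0, e' j) end),
  (fun i => match fintype.split i with inl j => L1 j | inr j => L2 j end); split.
  move=> i; case: (fintype.split i) => j x.
    by apply: (@continuous_comp _ _ _ fst (l j)); [exact: cvg_fst|exact: lc].
  by apply: (@continuous_comp _ _ _ snd (l' j)); [exact: cvg_snd|exact: lc'].
move=> [v w]; rewrite big_split_ord /=.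
under eq_bigr do rewrite (unsplitK (inl _)) /=.
under [X in _ = _ + X]eq_bigr do rewrite (unsplitK (inr _)) /=.
have p1 (k : nat) (F : 'I_k -> V * W) : (\sum_i F i) = (\sum_i (F i).1, \sum_i (F i).2).
  rewrite [LHS]surjective_pairing; congr pair.
    by apply: (big_morph (fun p : V * W => p.1)).
  by apply: (big_morph (fun p : V * W => p.2)).
rewrite !p1 /= [in LHS](lE v) [in LHS](lE' w).
rewrite [X in (_, X) + _]big1 ?[X in _ + (X, _)]big1; last 2 first.
- by move=> i _; rewrite scaler0.
- by move=> i _; rewrite scaler0.
by congr pair; rewrite ?addr0 ?add0r.
Qed.

Lemma finite_basis_rV n : finite_basis ('rV[R]_n : normedModType R).
Proof.
have lin j : linear (fun v : 'rV[R]_n => v 0 j).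
  by move=> a x y; rewrite /= !mxE.
pose L j : {linear 'rV[R]_n -> R} :=
  HB.pack (fun v : 'rV[R]_n => v 0 j) (GRing.isLinear.Build _ _ _ _ _ (lin j)).
exists n, (fun j => delta_mx 0 j), L; split; last by move=> w; exact: row_sum_delta.
by move=> j; exact: matrix_normedtype.coord_continuous.
Qed.

Lemma Cr_linP r (V W : normedModType R) (U : set V) (f : V -> W) :
  linear f -> continuous f -> Cr r U f.
Proof.
move=> lf cf.
pose F : {linear V -> W} := HB.pack f (GRing.isLinear.Build _ _ _ _ _ lf).
exact: (@Cr_lin _ r V W U F).
Qed.

Lemma Cr_lin_compP r (V W Z : normedModType R) (U : set V) (g : V -> W)
    (f : W -> Z) : open U -> linear f -> continuous f ->
  Cr r U g -> Cr r U (fun x => f (g x)).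
Proof.
move=> oU lf cf.
pose F : {linear W -> Z} := HB.pack f (GRing.isLinear.Build _ _ _ _ _ lf).
exact: (@Cr_lin_comp _ r V W Z U g F).
Qed.

Lemma Cr_id r (V : normedModType R) (U : set V) : Cr r U (fun x => x).
Proof. by apply: Cr_linP => // x; exact: cvg_id. Qed.

Lemma Cr_fst r (V W Z : normedModType R) (U : set V) (g : V -> W * Z) :
  open U -> Cr r U g -> Cr r U (fun x => (g x).1).
Proof.
by move=> oU; apply: (Cr_lin_compP oU (f := fst)) => // x; exact: cvg_fst.
Qed.

Lemma Cr_snd r (V W Z : normedModType R) (U : set V) (g : V -> W * Z) :
  open U -> Cr r U g -> Cr r U (fun x => (g x).2).
Proof.
by move=> oU; apply: (Cr_lin_compP oU (f := snd)) => // x; exact: cvg_snd.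
Qed.

Lemma Cr_pair r (V W Z : normedModType R) (U : set V) (f : V -> W) (g : V -> Z) :
  open U -> Cr r U f -> Cr r U g -> Cr r U (fun x => (f x, g x)).
Proof.
move=> oU cf cg.
have -> : (fun x => (f x, g x)) = (fun x => (f x, 0) + (0, g x)).
  by apply/funext => x; congr pair; rewrite ?addr0 ?add0r.
apply: CrD => //.
  apply: (Cr_lin_compP oU (f := fun w => (w, 0 : Z))) cf.
    by move=> a x y; rewrite [RHS]surjective_pairing /= scaler0 addr0.
  by move=> x; apply: cvg_pair; [exact: cvg_id|exact: cvg_cst].
apply: (Cr_lin_compP oU (f := fun w => (0 : W, w))) cg.
  by move=> a x y; rewrite [RHS]surjective_pairing /= scaler0 addr0.
by move=> x; apply: cvg_pair; [exact: cvg_cst|exact: cvg_id].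
Qed.

Lemma Cr_coord r n (V : normedModType R) (U : set V) (f : V -> 'rV[R]_n) j :
  open U -> Cr r U f -> Cr r U (fun x => f x 0 j).
Proof.
move=> oU; apply: (Cr_lin_compP oU (f := fun w : 'rV[R]_n => w 0 j)).
  by move=> a x y; rewrite !mxE.
exact: matrix_normedtype.coord_continuous.
Qed.

Lemma Cr_row r n (V : normedModType R) (U : set V) (f : V -> 'rV[R]_n) :
  open U -> (forall j, Cr r U (fun x => f x 0 j)) -> Cr r U f.
Proof.
move=> oU cf.
have -> : f = (fun x => \sum_j f x 0 j *: delta_mx 0 j).
  by apply/funext => x; exact: row_sum_delta.
by apply: Cr_sum => // j; apply: CrZ => //; exact: Cr_cst.
Qed.

Lemma CrN r (V W : normedModType R) (U : set V) (f : V -> W) : open U ->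
  Cr r U f -> Cr r U (fun x => - f x).
Proof.
move=> oU cf; have -> : (fun x => - f x) = (fun x => (-1 : R) *: f x).
  by apply/funext => x; rewrite scaleN1r.
by apply: CrZ => //; exact: Cr_cst.
Qed.

Lemma CrB r (V W : normedModType R) (U : set V) (f g : V -> W) : open U ->
  Cr r U f -> Cr r U g -> Cr r U (fun x => f x - g x).
Proof. by move=> oU cf cg; apply: CrD => //; exact: CrN. Qed.

Lemma CrM r (V : normedModType R) (U : set V) (f g : V -> R) : open U ->
  Cr r U f -> Cr r U g -> Cr r U (fun x => f x * g x).
Proof. exact: CrZ. Qed.

Lemma Cr_inv r (V : normedModType R) (U : set V) (f : V -> R) : open U ->
  (forall x, U x -> f x != 0) -> Cr r U f -> Cr r U (fun x => (f x)^-1).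
Proof.
move=> oU f0; elim: r => [|r IH].
  by move=> cf x Ux; apply: cvgV; [exact: f0|exact: cf].
move=> cf; have [df df'] := cf; split=> [x Ux|v].
  by apply: differentiableV; [exact: df|exact: f0].
have ci := IH (CrW cf).
apply: Cr_eq (CrN oU (CrM oU (CrM oU ci ci) (df' v))) => // x Ux.
rewrite deriveV; [|exact: f0|by apply: diff_derivable; exact: df].
by rewrite /GRing.scale /= expr2 invfM mulNr.
Qed.

Lemma derive_real (W : normedModType R) (f : R -> W) x v :
  differentiable f x -> 'D_v f x = v *: 'D_1 f x.
Proof. by move=> df; rewrite -derive_dirZ// /GRing.scale /= mulr1. Qed.

Lemma Cr_derive1 r (f f' : R -> R) : (forall x, is_derive (x : R) (1 : R) f (f' x)) ->
  Cr r setT f' -> Cr r.+1 setT f.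
Proof.
move=> ff' cf'; have df x : differentiable f x.
  by apply/derivable1_diffP; exact: ex_derive.
split=> [x _|v]; first exact: df.
have -> : (fun x => 'D_v f x) = (fun x => v *: f' x).
  by apply/funext => x; rewrite derive_real// derive_val.
by apply: (@CrZ _ _ _ _ _ (fun=> v)) => //; [exact: openT|exact: Cr_cst].
Qed.

Lemma is_derive_Cr0 (f f' : R -> R) : (forall x, is_derive (x : R) (1 : R) f (f' x)) ->
  Cr 0 setT f.
Proof.
move=> ff' x _; apply: differentiable_continuous.
by apply/derivable1_diffP; exact: ex_derive.
Qed.

Lemma smooth_horner (p : {poly R}) : smooth_on setT (horner p).
Proof.
move=> r; elim: r p => [|r IH] p; first exact: is_derive_Cr0.
by apply: (Cr_derive1 (f' := horner p^`())) => // x; rewrite derivE; exact: is_derive_poly.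
Qed.

Lemma smooth_sin_cos : smooth_on setT (@sin R) /\ smooth_on setT (@cos R).
Proof.
suff H r : Cr r setT (@sin R) /\ Cr r setT (@cos R).
  by split=> r; have [] := H r.
elim: r => [|r [IHs IHc]]; first by split; apply: is_derive_Cr0.
split; first exact: (Cr_derive1 (f' := cos)).
apply: (Cr_derive1 (f' := fun x => - sin x)) => //.
by apply: CrN => //; exact: openT.
Qed.

(** The powers of [x] make the family closed under differentiation: the derivative of each member is
    a combination of two later ones, so smoothness of all members is a single induction. *)
Definition flat_bump (m : nat) (x : R) : R :=
  if 0 < x then x ^- m * expR (- x^-1) else 0.

(** The inequality [1 + y <= expR y] at [y = ((m + 1) x)^-1], raised to the power [m + 1]. The
    remaining factor [x] gives continuity at 0. *)
Lemma flat_bump_le m x : 0 < x -> 0 <= flat_bump m x <= (m.+1%:R) ^+ m.+1 * x.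
Proof.
move=> x0; rewrite /flat_bump x0.
rewrite mulr_ge0 ?expR_ge0 ?invr_ge0 ?exprn_ge0 ?(ltW x0)//=.
have H : (m.+1%:R * x) ^- m.+1 <= expR x^-1.
  have -> : x^-1 = m.+1%:R * (m.+1%:R * x)^-1 by rewrite invfM mulrA divff ?mul1r.
  rewrite expRM_natl -exprVn ler_pXn2r// ?nnegrE ?expR_ge0//.
    by apply: le_trans (expR_ge1Dx _); rewrite lerDr.
  by rewrite invr_ge0 mulr_ge0// ltW.
have mx0 : 0 < (m.+1%:R * x) ^+ m.+1 by rewrite exprn_gt0// mulr_gt0.
have H2 : (expR x^-1)^-1 <= (m.+1%:R * x) ^+ m.+1.
  by rewrite -[leRHS]invrK lef_pV2 ?posrE ?expR_gt0 ?invr_gt0.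
rewrite expRN mulrC ler_pdivrMr ?exprn_gt0//; apply: (le_trans H2).
by rewrite exprMn [x ^+ m.+1]exprS mulrA.
Qed.

Lemma is_derive_flat_bump m x :
  is_derive (x : R) (1 : R) (flat_bump m) (flat_bump m.+2 x - m%:R * flat_bump m.+1 x).
Proof.
have [x0|x0|x0] := ltgtP x 0.
- apply: (@near_eq_is_derive _ _ _ (fun=> 0)).
  + near=> y; rewrite /flat_bump ltNge ltW//=.
    by near: y; exact: lt_nbhsl.
  + rewrite /flat_bump ltNge (ltW x0)/= mulr0 subr0; exact: is_derive_cst.
- apply: (@near_eq_is_derive _ R R (fun y : R => (y ^+ m)^-1 * expR (- y^-1))).
  + near=> y; rewrite /flat_bump ifT//.
    by near: y; exact: lt_nbhsr.
  + rewrite /flat_bump x0.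
    have dV : is_derive (x : R) (1 : R) (fun y : R => y^-1) (- x ^- 2).
      have dd : derivable (fun y : R => y^-1) x 1.
        by apply: derivableV; rewrite ?gt_eqF//; exact: derivable_id.
      have x_neq0 : x != 0 by rewrite gt_eqF.
      apply: DeriveDef; first exact: dd.
      rewrite (@deriveV R R (fun y => y) x 1 x_neq0 (@derivable_id _ _ _ _)).
      by rewrite derive_id /GRing.scale /= mulr1.
    have dE : is_derive (x : R) (1 : R) (fun y : R => expR (- y^-1))
        (expR (- x^-1) * x ^- 2).
      rewrite -[x ^- 2]opprK.
      exact: (@is_derive1_comp _ expR (fun y => - y^-1)).
    have -> : (fun y : R => (y ^+ m)^-1 * expR (- y^-1))
        = (fun y : R => y^-1) ^+ m * (fun y : R => expR (- y^-1)).
      by apply/funext => y; rewrite fctE exprfctE exprVn.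
    apply: is_derive_eq; rewrite exprfctE /GRing.scale /=.
    rewrite -!exprVn mulrN mulrA; case: m => [|m] /=.
      by ring.
    by rewrite !exprS; ring.
- rewrite x0 /flat_bump ltxx mulr0 subr0.
  (* At 0 the difference quotient of member [m] is exactly member [m + 1], which tends to 0 by
     [flat_bump_le]. *)
  apply/is_derive1_caratheodory; exists (flat_bump m.+1); split.
  + move=> z; rewrite /flat_bump ltxx !subr0; case: ltP => [z0|]; last by rewrite mul0r.
    have zn : z != 0 by rewrite gt_eqF.
    by rewrite mulrAC exprSr invfM -[_ * _ * z]mulrA mulVf// mulr1.
  + rewrite /prop_for /continuous_at [X in _ --> X](_ : _ = 0); last by rewrite /flat_bump ltxx.
    apply/cvgr0Pnorm_le => e e0.
    have C0 : 0 < (m.+2%:R : R) ^+ m.+2 by rewrite exprn_gt0.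
    near=> z; have [z0|z0] := ltP 0 z; last first.
      by rewrite /flat_bump ltNge z0 /= normr0 ltW.
    have /andP[b0 b1] := flat_bump_le m.+1 z0.
    rewrite ger0_norm//; apply: (le_trans b1); rewrite mulrC -ler_pdivlMr//.
    by apply: ltW; near: z; apply: lt_nbhsl; rewrite divr_gt0.
  + by rewrite /flat_bump ltxx.
Unshelve. all: by end_near. Qed.

Lemma smooth_flat_bump m : smooth_on setT (flat_bump m).
Proof.
move=> r; elim: r m => [|r IH] m; first exact: is_derive_Cr0 (is_derive_flat_bump m).
apply: (Cr_derive1 (is_derive_flat_bump m)).
apply: CrB => //; first exact: openT.
by apply: CrM => //; [exact: openT|exact: Cr_cst].
Qed.

End SmoothFunctions.

(** * Smooth maps into manifolds *)

Section ManifoldCalculus.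
Context {R : realType} {n : nat}.
Implicit Types M : manifold R n.

Lemma coord_cont M (c : chart M) x : dom c x -> {for x, continuous (coord c)}.
Proof.
move=> cx; have := @Defs.coord_continuous _ _ M c.
by rewrite (continuous_open_subspace _ (@dom_open _ _ M c)); apply; rewrite inE.
Qed.

Lemma param_cont M (c : chart M) y : im c y -> {for y, continuous (param c)}.
Proof.
move=> cy; have := @param_continuous _ _ M c.
by rewrite (continuous_open_subspace _ (@im_open _ _ M c)); apply; rewrite inE.
Qed.

Lemma im_coord M (c : chart M) x : dom c x -> im c (coord c x).
Proof. by exists x. Qed.

Lemma dom_param M (c : chart M) y : im c y -> dom c (param c y).
Proof. by case=> x cx <-; rewrite coordK. Qed.

Lemma paramK M (c : chart M) y : im c y -> coord c (param c y) = y.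
Proof. by case=> x cx <-; rewrite coordK. Qed.

Lemma near_dom M (c : chart M) x : dom c x -> \forall y \near x, dom c y.
Proof. by move=> cx; apply: nbhs_open => //; exact: dom_open. Qed.

Lemma near_im M (c : chart M) y : im c y -> \forall z \near y, im c z.
Proof. by move=> cx; apply: nbhs_open => //; exact: im_open. Qed.

Lemma overlap_im M (c d : chart M) y :
  (coord c @` (dom c `&` dom d)) y <-> im c y /\ dom d (param c y).
Proof.
split=> [[x [cx dx] <-]|[cy dy]]; first by rewrite (coordK cx); split=> //; exact: im_coord.
by exists (param c y); [split=> //; exact: dom_param|exact: paramK].
Qed.

Lemma transition_differentiable M (c d : chart M) y : im c y ->
  dom d (param c y) -> differentiable (coord d \o param c) y.
Proof.
by move=> cy dy; have [+ _] := transition_smooth c d 1%N; apply; exact/overlap_im.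
Qed.

Section SmoothTo.
Context {V : normedModType R}.

Lemma open_preim M (U : set V) (f : V -> M) (d : chart M) : open U ->
  (forall a, U a -> {for a, continuous f}) -> open (U `&` f @^-1` dom d).
Proof.
move=> oU cf; rewrite openE => a [Ua da]; rewrite /interior.
near=> b; split; near: b; first exact: nbhs_open.
by have /= := cf a Ua; apply; exact: near_dom.
Unshelve. all: by end_near. Qed.

Lemma smooth_to_sub M (U U' : set V) (f : V -> M) : U' `<=` U ->
  smooth_to U f -> smooth_to U' f.
Proof.
move=> UU [cf sf]; split=> [a /UU|d r]; first exact: cf.
by apply: Cr_sub (sf d r) => x [/UU Ux dx].
Qed.

Lemma smooth_to_local M (U : set V) (f : V -> M) :
  (forall a, U a -> exists (N : set V) (g : V -> M),
    [/\ open N, N a, smooth_to N g & forall x, N x -> f x = g x]) ->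
  smooth_to U f.
Proof.
move=> H; split=> [a /H[N [g [oN Na [cg _] fg]]]|d r].
  rewrite /prop_for /continuous_at fg//; apply: cvg_trans (cg a Na).
  by apply: near_eq_cvg; near=> y; apply/esym/fg; near: y; exact: nbhs_open.
apply: Cr_loc => a [/H[N [g [oN Na [cg sg] fg]]] da].
exists (N `&` g @^-1` dom d); first by split=> //; rewrite /= -fg.
apply: Cr_eq (sg d r); first exact: open_preim.
by move=> x [Nx _] /=; rewrite fg.
Unshelve. all: by end_near. Qed.

(** By the chain rule for the transition maps, the component in one chart determines the whole
    family. *)
Lemma tderiv_chart M (f : V -> M) (c : chart M) a v :
  {for a, continuous f} -> dom c (f a) -> differentiable (coord c \o f) a ->
  tderiv f a v = vec c (coord c (f a)) ('D_v (coord c \o f) a).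
Proof.
move=> cf ca df; apply/funext => d; rewrite /vec /tderiv (coordK ca).
case: asboolP => // da.
have E : 'D_v (coord d \o f) a = 'D_v ((coord d \o param c) \o (coord c \o f)) a.
  apply: near_eq_derive; near=> x => /=; rewrite coordK//.
  by near: x; have /= := cf; apply; exact: near_dom.
rewrite E derive_comp_lin//; apply: transition_differentiable; first exact: im_coord.
by rewrite /= coordK.
Unshelve. all: by end_near. Qed.

Lemma smooth_to_differentiable M (U : set V) (f : V -> M) (c : chart M) a :
  smooth_to U f -> U a -> dom c (f a) -> differentiable (coord c \o f) a.
Proof. by move=> [_ sf] Ua ca; have [+ _] := sf c 1%N; apply. Qed.

Lemma smooth_to_tderiv M (U : set V) (f : V -> M) (c : chart M) a v :
  smooth_to U f -> U a -> dom c (f a) ->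
  tderiv f a v = vec c (coord c (f a)) ('D_v (coord c \o f) a).
Proof.
move=> sf Ua ca; apply: tderiv_chart => //; first exact: sf.1.
exact: smooth_to_differentiable sf Ua ca.
Qed.

End SmoothTo.

Lemma smooth_to_comp (V W : normedModType R) M (U : set V) (U' : set W)
    (g : V -> W) (f : W -> M) : finite_basis W -> open U ->
  (forall x, U x -> U' (g x)) -> smooth_on U g -> smooth_to U' f ->
  smooth_to U (f \o g).
Proof.
move=> bW oU UU' sg [cf sf].
have cfg a : U a -> {for a, continuous (f \o g)}.
  move=> Ua; apply: continuous_comp; last exact/cf/UU'.
  exact: (Cr_continuous (sg 0%N)).
split=> // d r; apply: Cr_comp (sf d r) => //; first exact: open_preim.
- by move=> x [Ux dx]; split => //; exact: UU'.
- by apply: Cr_sub (sg r) => x [].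
Qed.

Lemma smooth_to_param M (c : chart M) : smooth_to (im c) (param c).
Proof.
split=> [y|d r]; first exact: param_cont.
by apply: Cr_sub (transition_smooth c d r) => y [cy dy]; exact/overlap_im.
Qed.

Lemma vec_trans M (c d : chart M) y v : dom d (param c y) ->
  vec c y v d = 'D_v (coord d \o param c) y.
Proof. by move=> dy; rewrite /vec /tderiv asboolT. Qed.

Lemma vec_linear M (c : chart M) y a u v : im c y ->
  vec c y (a *: u + v) = a *: vec c y u + vec c y v.
Proof.
move=> cy; apply/funext => d; rewrite /vec /tderiv !fctE /=.
case: asboolP => [dy|]; last by rewrite scaler0 addr0.
have df := transition_differentiable cy dy.
by rewrite derive_dirD// derive_dirZ.
Qed.

Lemma vec0 M (c : chart M) y : im c y -> vec c y 0 = 0.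
Proof.
move=> cy; have := vec_linear (-1) 0 0 cy.
by rewrite scaleN1r oppr0 addr0 scaleN1r addNr.
Qed.

Lemma vecZ M (c : chart M) y a v : im c y -> vec c y (a *: v) = a *: vec c y v.
Proof.
by move=> cy; have := vec_linear a v 0 cy; rewrite (vec0 cy) [a *: v + 0]addr0 [_ *: vec _ _ _ + 0]addr0.
Qed.

Lemma vecD M (c : chart M) y u v : im c y ->
  vec c y (u + v) = vec c y u + vec c y v.
Proof. by move=> cy; have := vec_linear 1 u v cy; rewrite !scale1r. Qed.

Lemma is_tangentP M (c : chart M) x (w : tvec M) : dom c x ->
  is_tangent x w -> w = vec c (coord c x) (w c).
Proof.
move=> cx [c' [v [c'x ->]]].
have c'y := im_coord c'x.
rewrite [LHS](_ : _ = vec c (coord c x) ('D_v (coord c \o param c') (coord c' x))).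
  by rewrite vec_trans// coordK.
rewrite /vec [LHS](@tderiv_chart _ _ _ c).
- by rewrite coordK.
- exact: param_cont.
- by rewrite coordK.
- by apply: transition_differentiable => //; rewrite coordK.
Qed.

Lemma is_tangent_vec M (c : chart M) x v : dom c x ->
  is_tangent x (vec c (coord c x) v).
Proof. by move=> cx; exists c, v. Qed.

Lemma is_tangent_linear M x a (u w : tvec M) :
  is_tangent x u -> is_tangent x w -> is_tangent x (a *: u + w).
Proof.
move=> tu [c [v [cx ->]]]; rewrite (is_tangentP cx tu) -vec_linear; last exact: im_coord.
exact: is_tangent_vec.
Qed.

Lemma smooth_on_diff (V W : normedModType R) (U : set V) (f : V -> W) v :
  smooth_on U f -> smooth_on U (fun x => 'D_v f x).
Proof. by move=> sf r; have [_] := sf r.+1; exact. Qed.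

(** The factor [a] is the reciprocal of the period, which in the action varies together with the
    loop. *)
Lemma smooth_tangent_fun (V : normedModType R) M (L : tangent_fun M)
    (U : set V) (f : V -> M) (a : V -> R) v :
  (forall c : chart M, smooth_on (im c `*` setT) (tangent_in L c)) ->
  open U -> smooth_to U f -> smooth_on U a ->
  smooth_on U (fun x => L (f x) (a x *: tderiv f x v)).
Proof.
move=> sL oU sf sa r; apply: Cr_loc => x0 Ux0.
have [c cx0] := dom_cover (f x0).
pose N := U `&` f @^-1` dom c.
have oN : open N by apply: open_preim => //; exact: sf.1.
exists N => //.
pose G x := (coord c (f x), a x *: 'D_v (coord c \o f) x).
have cG : Cr r N G.
  apply: Cr_pair => //; first exact: (sf.2 c).
  apply: CrZ => //; first by apply: Cr_sub (sa r) => x [].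
  exact: (smooth_on_diff _ (sf.2 c)).
have bE : finite_basis (('rV[R]_n * 'rV[R]_n)%type : normedModType R).
  by apply: finite_basis_prod; exact: finite_basis_rV.
have GU x : N x -> (im c `*` setT) (G x).
  by move=> [Ux cx]; split=> //; exact: im_coord.
apply: Cr_eq (Cr_comp bE oN GU cG (sL c r)) => // x [Ux cx].
rewrite /= /tangent_in /= coordK// (smooth_to_tderiv v sf Ux cx).
by rewrite vecZ//; exact: im_coord.
Qed.

Lemma scalar_fun_sum (V : lmodType R) (F : V -> R) m (a : 'I_m -> R) (e : 'I_m -> V) :
  (forall k u v, F (k *: u + v) = k * F u + F v) ->
  F (\sum_i a i *: e i) = \sum_i a i * F (e i).
Proof.
move=> lF.
have F0 : F 0 = 0.
  by have := lF 1 0 0; rewrite scaler0 addr0 mul1r => /eqP; rewrite -subr_eq subrr eq_sym => /eqP.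
have FD u v : F (u + v) = F u + F v by rewrite -[u]scale1r lF scale1r mul1r.
have FZ k u : F (k *: u) = k * F u by rewrite -[k *: u]addr0 lF F0 addr0.
rewrite (big_morph F FD F0); apply: eq_bigr => i _; exact: FZ.
Qed.

(** Smoothness of a tensor is given for constant arguments in a chart only, so the two derivatives
    are expanded in the coordinate basis. *)
Lemma smooth_two_tensor (V : normedModType R) M (b : two_tensor M)
    (U : set V) (f : V -> M) u v :
  is_two_tensor b -> open U -> smooth_to U f ->
  smooth_on U (fun x => b (f x) (tderiv f x u) (tderiv f x v)).
Proof.
move=> tb oU sf r; apply: Cr_loc => x0 Ux0.
have [c cx0] := dom_cover (f x0).
have [bl [br bs]] := tb c.
pose N := U `&` f @^-1` dom c.
have oN : open N by apply: open_preim => //; exact: sf.1.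
exists N => //.
pose D w i x := ('D_w (coord c \o f) x) 0 i.
have cD w i : Cr r N (D w i).
  by apply: Cr_coord => //; exact: (smooth_on_diff _ (sf.2 c)).
pose e i : 'rV[R]_n := delta_mx 0 i.
have cb i j : Cr r N (two_tensor_in b c (e i) (e j) \o (coord c \o f)).
  apply: Cr_comp (bs (e i) (e j) r) => //; [exact: finite_basis_rV| |exact: (sf.2 c)].
  by move=> x [Ux cx]; exact: im_coord.
have cS : Cr r N (fun x => \sum_i \sum_j D u i x * (D v j x *
    two_tensor_in b c (e i) (e j) (coord c (f x)))).
  apply: Cr_sum => // i; apply: Cr_sum => // j.
  by apply: CrM => //; apply: CrM => //; exact: cb.
apply: Cr_eq cS => // x [Ux cx].
have cy := im_coord cx.
rewrite !(smooth_to_tderiv _ sf Ux cx) -[f x in RHS](coordK cx).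
rewrite [RHS](_ : _ = two_tensor_in b c ('D_u (coord c \o f) x)
  ('D_v (coord c \o f) x) (coord c (f x))); last by rewrite /two_tensor_in coordK.
rewrite [in RHS](row_sum_delta ('D_u _ x)) [in RHS](row_sum_delta ('D_v _ x)).
rewrite (scalar_fun_sum (F := fun w => two_tensor_in b c w _ _)); last first.
  by move=> k w w'; exact: bl.
apply: eq_bigr => i _; rewrite -mulr_sumr; congr (_ * _).
rewrite (scalar_fun_sum (F := fun w => two_tensor_in b c _ w _)) => [|k w w'].
  by apply: eq_bigr => j _.
exact: br.
Qed.

End ManifoldCalculus.

(** * Families of loops and fields supported in a chart *)

Section Variations.
Context {R : realType} {n : nat} {M : manifold R n}.

Lemma periodic_int (T : Type) (f : R -> T) : (forall t, f (t + 1) = f t) ->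
  forall t (m : int), f (t + m%:~R) = f t.
Proof.
move=> pf t; have pn k s : f (s + k%:R) = f s.
  elim: k s => [|k IH] s; first by rewrite addr0.
  by rewrite -addn1 natrD addrA pf IH.
case=> k; first exact: pn.
by rewrite NegzE mulrNz -[in RHS](subrK k.+1%:R t) pn.
Qed.

Lemma tderiv_near (V : normedModType R) (f g : V -> M) a v :
  (\forall x \near a, f x = g x) -> tderiv f a v = tderiv g a v.
Proof.
move=> fg; apply/funext => d; rewrite /tderiv (nbhs_singleton fg).
case: asboolP => // _; apply: near_eq_derive.
by near=> x; rewrite /=; congr coord; near: x.
Unshelve. all: by end_near. Qed.

(** The difference quotients agree term by term, so the identity also covers points where the
    derivatives are default values, as may happen for W^{1,2} cylinders. *)
Lemma derive_affine (V W Z : normedModType R) (f : W -> Z) (A : V -> W) x v w :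
  (forall h : R, A (h *: v + x) = h *: w + A x) ->
  'D_v (f \o A) x = 'D_w f (A x).
Proof.
move=> hA; rewrite /derive.
suff -> : (fun h : R => h^-1 *: ((f \o A \o shift x) (h *: v) - (f \o A) x)) =
    (fun h => h^-1 *: ((f \o shift (A x)) (h *: w) - f (A x))) by [].
by apply/funext => h; rewrite /= hA.
Qed.

Lemma tderiv_affine (V W : normedModType R) (f : W -> M) (A : V -> W) x v w :
  (forall h : R, A (h *: v + x) = h *: w + A x) ->
  tderiv (f \o A) x v = tderiv f (A x) w.
Proof.
move=> hA; apply/funext => d; rewrite /tderiv.
case: asboolP => [_|//]; exact: (@derive_affine _ _ _ (coord d \o f) A x v w hA).
Qed.

Definition cyl_set (V : normedModType R) (eps : R) : set (V * R) :=
  [set z | `|z.1| < eps].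

Lemma open_cyl_set (V : normedModType R) eps : open (@cyl_set V eps).
Proof.
have -> : @cyl_set V eps = (fun z : V * R => `|z.1|) @^-1` [set x | x < eps] by [].
apply: open_comp; last exact: open_lt.
move=> z _; apply: (@continuous_comp _ _ _ fst (fun x : V => `|x|)).
  exact: cvg_fst.
exact: norm_continuous.
Qed.

(* The test on [eta t] discards the junk value of [coord c] outside of [dom c]. *)
Definition piece (q : loop M) (c : chart M) (eta : R -> 'rV[R]_n) : field M :=
  fun t => if eta t == 0 then 0 else vec c (coord c (q t)) (eta t).

(** [K] is a closed periodic set that contains the support and over which [q] stays in the chart;
    modulo 1 it is compact, so small displacements stay in the chart uniformly. *)
Definition supported (q : loop M) (c : chart M) (eta : R -> 'rV[R]_n) : Prop :=
  [/\ smooth_on setT eta, forall t, eta (t + 1) = eta t &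
    exists K : set R, [/\ closed K, forall t (m : int), K t -> K (t + m%:~R),
      forall t, K t -> dom c (q t) & forall t, ~ K t -> eta t = 0]].

(** A variation with an arbitrary parameter space: [V = R] gives back [variation], and [V = R * R]
    combines the motion along the orbit cylinder with a displacement. *)
Definition smooth_family (V : normedModType R) (eps : R) (q : loop M)
    (u : V * R -> M) : Prop :=
  [/\ 0 < eps, smooth_to (cyl_set eps) u,
    forall v t, `|v| < eps -> u (v, t + 1) = u (v, t) &
    forall t, u (0, t) = q t].

(** A tube argument: at [v = 0] the displaced point is [coord c (q t)], which lies in the open image
    of the chart, and compactness of [K] within one period makes the admissible radius uniform in
    [t]. *)
Lemma supported_near (V : normedModType R) (kap : {linear V -> R})
  eps q (u : V * R -> M) (c : chart M) (eta : R -> 'rV[R]_n) (K : set R) :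
  continuous kap -> smooth_family eps q u ->
  smooth_on setT eta -> (forall t, eta (t + 1) = eta t) ->
  closed K -> (forall t (m : int), K t -> K (t + m%:~R)) ->
  (forall t, K t -> dom c (q t)) ->
  exists2 e, 0 < e & forall v t, `|v| < e -> K t ->
    dom c (u (v, t)) /\ im c (coord c (u (v, t)) + kap v *: eta t).
Proof.
move=> ckap [e0 su pu uq] seta peta cK pK Kc.
pose P v t := dom c (u (v, t)) /\ im c (coord c (u (v, t)) + kap v *: eta t).
have compK : compact (K `&` `[0, 1]%classic).
  by rewrite setIC; apply: compact_closedI => //; exact: segment_compact.
have /compact_near_coveringP ncov := compK.
have H : \forall v \near (0 : V), K `&` `[0, 1]%classic `<=` P v.
  apply: (ncov _ (nbhs (0 : V)) P) => t [Kt _].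
  have cut : dom c (u (0, t)) by rewrite uq; exact: Kc.
  have cu : {for (0, t), continuous u}.
    by apply: su.1; rewrite /cyl_set /= normr0.
  have near_u : \forall z \near ((0 : V), t), dom c (u z).
    by have /= := cu; apply; exact: near_dom.
  have cG : {for (0, t), continuous
      (fun z : V * R => coord c (u z) + kap z.1 *: eta z.2)}.
    apply: cvgD.
      by apply: (@continuous_comp _ _ _ u (coord c)) => //; exact: coord_cont.
    apply: cvgZ.
      by apply: (@continuous_comp _ _ _ fst kap); [exact: cvg_fst|exact: ckap].
    apply: (@continuous_comp _ _ _ snd eta); first exact: cvg_snd.
    exact: (Cr_continuous (seta 0%N)).
  have near_G : \forall z \near ((0 : V), t), im c (coord c (u z) + kap z.1 *: eta z.2).
    have /= := cG; apply; apply: near_im.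
    by rewrite linear0 scale0r addr0; exact: im_coord.
  have [[A B] [/= nA nB] AB] : \forall z \near ((0 : V), t), dom c (u z) /\
      im c (coord c (u z) + kap z.1 *: eta z.2) by near=> z; split; near: z.
  exists (B, A); first by split.
  by move=> [t' v] [/= Bt Av]; exact: (AB (v, t')).
have [e1 e10 He1] := nbhs_norm0P.1 H.
exists (Num.min eps e1); first by rewrite lt_min e0.
move=> v t; rewrite lt_min => /andP[ve ve1] Kt.
(* The representative of [t] in the unit interval, where compactness was used; periodicity carries
   the conclusion back to [t]. *)
pose s := t + (- Num.floor t)%:~R.
have us : u (v, s) = u (v, t).
  by apply: (periodic_int (f := fun t => u (v, t))) => t'; exact: pu.
have es : eta s = eta t by exact: periodic_int.
have : P v s.
  apply: (He1 v) => //; split; first exact: pK.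
  rewrite /= in_itv /= /s mulrNz subr_ge0 Num.Theory.floor_le_tmp /=.
  by rewrite lerBlDr addrC -intrD1 ltW// Num.Theory.floorD1_gt.
by rewrite /P us es.
Unshelve. all: by end_near. Qed.

(* The loops of [u] are displaced by [kap v *: eta] in the chart [c]. *)
Lemma family_add_piece (V : normedModType R) (kap : {linear V -> R})
    eps q (u : V * R -> M) c eta :
  finite_basis V -> continuous kap ->
  smooth_family eps q u -> supported q c eta ->
  exists (eps' : R) (u' : V * R -> M),
    [/\ eps' <= eps, smooth_family eps' q u',
      forall v t, `|v| < eps' -> kap v = 0 -> u' (v, t) = u (v, t) &
      forall t v, tderiv u' (0, t) (v, 0) =
        tderiv u (0, t) (v, 0) + kap v *: piece q c eta t].
Proof.
move=> bV ckap fu [seta peta [K [cK pK Kc K0]]].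
have [e1 e10 He1] := supported_near ckap fu seta peta cK pK Kc.
have [e0 su pu uq] := fu.
pose eps' := Num.min eps e1.
pose G (z : V * R) := coord c (u z) + kap z.1 *: eta z.2.
pose u' (z : V * R) := if eta z.2 == 0 then u z else param c (G z).
pose A := cyl_set eps `&` u @^-1` dom c.
have oA : open A by apply: open_preim; [exact: open_cyl_set|exact: su.1].
have sG : smooth_on A G.
  move=> r; apply: CrD => //; first exact: su.2.
  apply: CrZ => //.
    by apply: (Cr_lin_comp (g := fst)) => //; apply: Cr_fst => //; exact: Cr_id.
  apply: (Cr_comp (g := snd) (U' := setT)) (seta r) => //.
    exact: finite_basis_R.
  by apply: Cr_snd => //; exact: Cr_id.
pose N := A `&` G @^-1` im c.
have oN : open N.
  rewrite openE => z [Az Gz]; rewrite /interior; near=> y; split; near: y.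
    exact: nbhs_open.
  by have /= := Cr_continuous (sG 0%N) Az; apply; exact: near_im.
have u'N z : N z -> u' z = param c (G z).
  move=> [[_ cz] Gz]; rewrite /u'; case: eqP => // ez.
  by rewrite /G ez scaler0 addr0 coordK.
have NK v t : `|v| < eps' -> K t -> N (v, t).
  rewrite lt_min => /andP[ve ve1] Kt; have [cu Gu] := He1 v t ve1 Kt.
  by split.
have u'K z : ~ K z.2 -> u' z = u z by move=> Kz; rewrite /u' K0// eqxx.
have nK t : ~ K t -> \forall s \near t, ~ K s.
  by move=> Kt; apply: (nbhs_open (U := ~` K)) => //; exact: closed_openC.
have nKz (z : V * R) : ~ K z.2 -> \forall y \near z, ~ K y.2.
  move=> Kz; have cs : {for z, continuous (snd : V * R -> R)} by exact: cvg_snd.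
  exact: (cs _ (nK _ Kz)).
have e'0 : 0 < eps' by rewrite lt_min e0.
have e'e : eps' <= eps by rewrite ge_min lexx.
have u'k v t : `|v| < eps' -> kap v = 0 -> u' (v, t) = u (v, t).
  move=> ve kv; have [Kt|Kt] := pselect (K t); last exact: u'K.
  have Nvt := NK _ _ ve Kt; rewrite u'N// /G /= kv scale0r addr0 coordK//.
  by case: Nvt => [[_ ?] _].
(* Over [K] the new family is read in the chart on the open set [N]; off [K] the displacement
   vanishes in a neighbourhood and the old family is left unchanged. *)
have su' : smooth_to (cyl_set eps') u'.
  apply: smooth_to_local => -[v0 t0] ve.
  have [Kt|Kt] := pselect (K t0).
    exists N, (param c \o G); split=> //; first exact: NK.
    apply: smooth_to_comp (smooth_to_param c) => //; first exact: finite_basis_rV.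
      by move=> x [].
    by move=> r; apply: Cr_sub (sG r) => x [].
  exists (cyl_set eps' `&` [set z | ~ K z.2]), u; split => //.
  - rewrite openE => z [ze Kz]; rewrite /interior; near=> y; split; near: y.
      by apply: nbhs_open => //; exact: open_cyl_set.
    exact: nKz.
  - apply: smooth_to_sub su => z [ze _]; exact: lt_le_trans ze e'e.
  - by move=> x [_ ?]; exact: u'K.
have u'q t : u' (0, t) = q t by rewrite u'k ?normr0 ?linear0.
exists eps', u'; split => //.
  split=> // v t ve; rewrite /u' /= peta /G /= peta pu//.
  exact: lt_le_trans ve e'e.
move=> t v; have c0 : cyl_set eps' (0 : V, t) by rewrite /cyl_set /= normr0.
have c0' : cyl_set eps (0 : V, t) by rewrite /cyl_set /= normr0.
have [Kt|Kt] := pselect (K t); last first.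
  rewrite /piece K0// eqxx scaler0 addr0; apply: tderiv_near.
  by near=> z; apply: u'K; near: z; exact: nKz.
have N0 : N (0, t) by apply: NK => //; rewrite normr0.
have ct : dom c (q t) by exact: Kc.
have cut : dom c (u (0, t)) by rewrite uq.
have cu't : dom c (u' (0, t)) by rewrite u'q.
rewrite (smooth_to_tderiv _ su' c0 cu't) (smooth_to_tderiv _ su c0' cut) u'q uq.
have -> : 'D_(v, 0) (coord c \o u') (0, t) = 'D_(v, 0) G (0, t).
  apply: near_eq_derive; near=> z.
  have Nz : N z by near: z; exact: nbhs_open.
  by rewrite /= u'N// paramK//; case: Nz.
have dk : differentiable (fun z : V * R => kap z.1) (0, t).
  apply: (@differentiable_comp _ _ _ _ fst kap); last exact: linear_differentiable.
  have [+ _] := @Cr_fst R 1 _ _ _ setT _ openT (@Cr_id R 1 (V * R)%type setT).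
  by apply.
have de : differentiable (fun z : V * R => eta z.2) (0, t).
  apply: (@differentiable_comp _ _ _ _ snd eta).
    have [+ _] := @Cr_snd R 1 _ _ _ setT _ openT (@Cr_id R 1 (V * R)%type setT).
    by apply.
  by have [+ _] := seta 1%N; apply.
have dcu : differentiable (coord c \o u) (0, t).
  exact: smooth_to_differentiable su c0' cut.
have -> : 'D_(v, 0) G (0, t) = 'D_(v, 0) (coord c \o u) (0, t) + kap v *: eta t.
  rewrite /G deriveD; last 2 first.
  - exact: diff_derivable.
  - by apply: diff_derivable; exact: differentiable_scale.
  congr (_ + _); rewrite derive_scale//= linear0 scale0r add0r; congr (_ *: _).
  rewrite (@derive_affine _ _ _ kap fst (0, t) (v, 0) v).
    by rewrite deriveE ?diff_lin//; exact: linear_differentiable.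
  by move=> h /=; rewrite !addr0.
have iq := im_coord ct.
rewrite vecD// vecZ// /piece; case: eqP => // ->.
by rewrite vec0.
Unshelve. all: by end_near. Qed.

Lemma constant_family (V : normedModType R) (q : loop M) : finite_basis V ->
  smooth_loop q -> smooth_family 1 q (fun z : V * R => q z.2).
Proof.
move=> bV [sq pq]; split=> //.
apply: (@smooth_to_comp _ _ _ _ _ _ setT snd q) => //.
- exact: finite_basis_R.
- exact: open_cyl_set.
- by move=> r; apply: Cr_snd; [exact: open_cyl_set|exact: Cr_id].
- by move=> v t _; exact: pq.
Qed.

(** Restricts a family to the one-parameter variations on which [critical] and the second variations
    are formulated. The base point [v0] is arbitrary because criticality is also used at the other
    loops of the orbit cylinder. *)
Lemma line_variation (V : normedModType R) eps q (w : V * R -> M) v0 a :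
  finite_basis V -> smooth_family eps q w -> `|v0| < eps ->
  exists2 eps' : R, `|a| * eps' <= eps - `|v0| &
    variation (fun t => w (v0, t)) eps' (fun z => w (v0 + z.1 *: a, z.2)) /\
    variation_field (fun z => w (v0 + z.1 *: a, z.2)) =
      (fun t => tderiv w (v0, t) (a, 0)).
Proof.
move=> bV [e0 sw pw wq] ve.
have d0 : 0 < eps - `|v0| by rewrite subr_gt0.
have a0 : 0 < `|a| + 1 by rewrite ltr_wpDl.
(* The [+ 1] keeps the radius meaningful for [a = 0]. *)
exists ((eps - `|v0|) / (`|a| + 1)).
  by rewrite mulrCA ler_piMr ?(ltW d0)// ler_pdivrMr// mul1r lerDl.
have lin (r : R) : `|r| < (eps - `|v0|) / (`|a| + 1) -> `|v0 + r *: a| < eps.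
  rewrite ltr_pdivlMr// => H; apply: le_lt_trans (ler_normD _ _) _.
  rewrite -ltrBrDl normrZ; apply: le_lt_trans H.
  by rewrite ler_wpM2l// lerDl.
split.
  split; first by rewrite divr_gt0.
  split.
    pose e' := (eps - `|v0|) / (`|a| + 1).
    have oc : open [set z : R * R | `|z.1| < e'] by exact: (@open_cyl_set R).
    apply: (@smooth_to_comp _ _ _ _ _ _ _ (fun z : R * R => (v0 + z.1 *: a, z.2)) w) sw => //.
    - by apply: finite_basis_prod => //; exact: finite_basis_R.
    - by move=> z ze; apply: lin.
    - move=> r; apply: Cr_pair => //; last by apply: Cr_snd => //; exact: Cr_id.
      apply: CrD => //; first exact: Cr_cst.
      apply: CrZ => //; last exact: Cr_cst.
      by apply: Cr_fst => //; exact: Cr_id.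
  split=> [r t re|t] /=; first by apply: pw; exact: lin.
  by rewrite scale0r addr0.
apply/funext => t; rewrite /variation_field.
rewrite (@tderiv_affine _ _ w (fun z : R * R => (v0 + z.1 *: a, z.2)) (0, t) (1, 0) (a, 0)).
  by rewrite /= scale0r addr0.
move=> h; rewrite /= [RHS]surjective_pairing /= !scale0r !addr0.
by rewrite /GRing.scale /= !mulr0 mulr1 addrC.
Qed.

End Variations.

(** * Absolutely continuous and Sobolev functions on intervals *)

Section Measurability.
Context {R : realType}.
Local Notation mu := (@lebesgue_measure R).

(** The Cauchy criterion with bounds [k.+1%:R^-1] and [m.+1%:R^-1]. Each condition [C k m] runs over
    uncountably many increments but is closed, being an intersection of closed conditions; hence the
    set of convergence is measurable. On it the limit is that of a sequence, and off it the limit is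
    a constant default value. *)
Lemma measurable_punctured_lim (Q : R -> R -> R) : (forall h, continuous (Q h)) ->
  measurable_fun setT (fun x => lim (Q h x @[h --> 0^'])).
Proof.
move=> cQ.
pose C k m := [set x | forall h h', 0 < `|h| < m.+1%:R^-1 ->
  0 < `|h'| < m.+1%:R^-1 -> `|Q h x - Q h' x| <= k.+1%:R^-1].
have clC k m : closed (C k m).
  have -> : C k m = \bigcap_(hh in [set hh | 0 < `|hh.1| < m.+1%:R^-1 /\
      0 < `|hh.2| < m.+1%:R^-1])
      ((fun x => `|Q hh.1 x - Q hh.2 x|) @^-1` [set y | y <= k.+1%:R^-1]).
    apply/seteqP; split => x /= H.
      by move=> [h h'] /= [? ?]; exact: H.
    by move=> h h' ? ?; exact: (H (h, h')).
  apply: closed_bigI => -[h h'] _ /=; apply: closed_comp; last exact: closed_le.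
  move=> x _; apply: (@continuous_comp _ _ _ (fun y => Q h y - Q h' y) (fun y => `|y|)).
    by apply: cvgB; exact: cQ.
  exact: norm_continuous.
pose E := \bigcap_k \bigcup_m C k m.
have mE : measurable E.
  apply: bigcapT_measurable => k; apply: bigcupT_measurable => m.
  exact: closed_measurable.
have EP x : E x <-> cvg (Q h x @[h --> 0^']).
  split=> [Ex|/cvg_ex[l /= /cvgrPdist_le cl] k _]; last first.
    have k0 : (0 : R) < k.+1%:R^-1 / 2 by rewrite divr_gt0 ?invr_gt0.
    have [/= d d0 Hd] := cl _ k0.
    have [m _ /(_ m (leqnn m)) Hm] := near_infty_natSinv_lt (PosNum d0).
    exists m => // h h' /andP[h0 hm] /andP[h'0 h'm].
    have Hl (z : R) : 0 < `|z| -> `|z| < m.+1%:R^-1 -> `|l - Q z x| <= k.+1%:R^-1 / 2.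
      move=> z0 zm; apply: Hd; last by rewrite -normr_gt0.
      by rewrite /= sub0r normrN; exact: lt_trans zm Hm.
    rewrite (splitr k.+1%:R^-1) -[Q h x - _](subrKA l).
    apply: le_trans (ler_normD _ _) _; rewrite lerD//; last exact: Hl.
    by rewrite distrC; exact: Hl.
  apply/cauchy_cvgP/cauchy_exP => e e0.
  have [k _ /(_ k (leqnn k)) Hk] := near_infty_natSinv_lt (PosNum e0).
  have [m _ Cm] := Ex k I.
  exists (Q (m.+1%:R^-1 / 2) x).
  have m0 : (0 : R) < m.+1%:R^-1 by rewrite invr_gt0.
  exists m.+1%:R^-1 => //= h; rewrite /= sub0r normrN => hm h0.
  rewrite /ball /=; apply: le_lt_trans Hk; apply: Cm.
    rewrite ger0_norm ?divr_ge0 ?ltW//= divr_gt0//=.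
    by rewrite ltr_pdivrMr// mulr2n mulrDr mulr1 ltrDl.
  by rewrite normr_gt0 h0.
rewrite -(setvU E) setUC; apply/measurable_funU => //; first exact: measurableC.
split.
  apply: (@measurable_fun_cvg _ _ _ E (fun m => Q m.+1%:R^-1)) => //.
    by move=> m; apply: measurable_funTS; exact: continuous_measurable_fun.
  move=> x /EP cx.
  have cm : (fun m : nat => m.+1%:R^-1 : R) @ \oo --> (0 : R)^'.
    apply: cvg_trans (_ : within (fun x => x != 0) (nbhs (0:R)) `=>` _) => //.
    move=> A [/= e e0 He]; have [m _ Hm] := near_infty_natSinv_lt (PosNum e0).
    exists m => // p mp; apply: He; last by rewrite invr_eq0 pnatr_eq0.
    by rewrite /= sub0r normrN ger0_norm ?invr_ge0//; exact: Hm.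
  exact: (cvg_comp _ _ cm cx).
apply: (eq_measurable_fun (fun=> point)) => [x|]; last exact: measurable_cst.
by rewrite inE => Ex; rewrite dvgP// => /EP.
Qed.

Lemma measurable_derive1 (f : R -> R) :
  continuous f -> measurable_fun setT (derive1 f).
Proof.
move=> cf; apply: measurable_punctured_lim => h x.
apply: cvgM; first exact: cvg_cst.
apply: cvgB; last exact: cf.
apply: (@continuous_comp _ _ _ (fun y => h + y) f); last exact: cf.
by apply: cvgD; [exact: cvg_cst|exact: cvg_id].
Qed.

Lemma clamp_continuous (a b : R) (f : R -> R) : a <= b ->
  {within `[a, b], continuous f} ->
  continuous (fun x => f (Num.max a (Num.min b x))).
Proof.
move=> ab /subspace_continuousP cf x.
pose cl x := Num.max a (Num.min b x).
have clab y : `[a, b]%classic (cl y).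
  by rewrite /= in_itv /= /cl le_max lexx /= ge_max ab ge_min lexx.
have ccl : cl @ x --> cl x.
  apply: (@continuous_max _ _ (fun=> a) (fun y => Num.min b y) x); first exact: cvg_cst.
  by apply: (@continuous_min _ _ (fun=> b) id x); [exact: cvg_cst|exact: cvg_id].
apply: (@cvg_comp _ _ _ cl f _ _ _ _ (cf _ (clab x))).
move=> A HA; have HA' : nbhs (cl x) (fun z => `[a, b]%classic z -> A z) by exact: HA.
change (nbhs x (fun y => A (cl y))).
have H1 : nbhs x (fun y => `[a, b]%classic (cl y) -> A (cl y)) := ccl _ HA'.
by apply: filterS H1 => y H; exact: H (clab y).
Qed.

Lemma measurable_derive1_within (a b : R) (f : R -> R) :
  {within `[a, b], continuous f} -> measurable_fun `[a, b] (derive1 f).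
Proof.
move=> cf; have [ba|ab] := ltP b a.
  by rewrite set_itv_ge -?leNgt//; exact: measurable_fun_set0.
have mg := measurable_derive1 (clamp_continuous ab cf).
(* The end points are discarded: there [derive1 f] depends on values of [f] outside the interval. *)
apply: (@measurable_fun_itv_cc _ a b false true); set g := (X in derive1 X) in mg.
apply: (eq_measurable_fun (derive1 g)) => [x|]; last exact: measurable_funTS.
rewrite inE /= in_itv /= => /andP[ax xb].
rewrite !derive1E; apply: near_eq_derive; near=> y; rewrite /g.
have ay : a < y by near: y; exact: lt_nbhsr.
have yb : y < b by near: y; exact: lt_nbhsl.
by rewrite min_r ?max_r ?ltW.
Unshelve. all: by end_near. Qed.

Lemma ae_integrable d (T : measurableType d) (nu : {measure set T -> \bar R})
    (D : set T) (f g : T -> R) : measurable D -> measurable_fun D f ->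
  {ae nu, forall x, D x -> f x = g x} ->
  nu.-integrable D (EFin \o g) -> nu.-integrable D (EFin \o f).
Proof.
move=> mD mf [N [mN N0 HN]] ig.
have mf' : measurable_fun D (EFin \o f) by apply/measurable_EFinP.
have mg' : measurable_fun D (EFin \o g) by case/integrableP : ig.
apply/(negligible_integrable mN mD mf' N0).
have /(negligible_integrable mN mD mg' N0) := ig.
apply: eq_integrable; first exact: measurableD.
move=> x; rewrite inE => -[Dx Nx] /=; congr EFin.
apply: contrapT => fg; apply: Nx; apply: HN => /= H; apply: fg; exact/esym/H.
Qed.

Lemma ae_eq_Rintegral d (T : measurableType d) (nu : {measure set T -> \bar R})
    (D : set T) (f g : T -> R) : measurable D -> measurable_fun D f ->
  measurable_fun D g -> {ae nu, forall x, D x -> f x = g x} ->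
  \int[nu]_(x in D) f x = \int[nu]_(x in D) g x.
Proof.
move=> mD mf mg fg; rewrite /Rintegral; congr fine.
apply: ae_eq_integral => //; [exact/measurable_EFinP|exact/measurable_EFinP|].
apply: filterS fg => x H Dx; congr EFin; exact: H.
Qed.

(** Absolute continuity with an explicit integrand. Sums, products and gluings produce a formula for
    the integrand; [primitive_ac] afterwards replaces it by the pointwise derivative demanded by
    [ac_on]. *)
Definition primitive_on (a b : R) (f g : R -> R) : Prop :=
  mu.-integrable `[a, b] (EFin \o g) /\
  forall x, a <= x <= b -> f x = f a + \int[mu]_(t in `[a, x]) g t.

Lemma ac_onP a b f : ac_on a b f <-> primitive_on a b f (derive1 f).
Proof. by []. Qed.

Lemma integrable_itvS a b c d (g : R -> R) : a <= c -> d <= b ->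
  mu.-integrable `[a, b] (EFin \o g) -> mu.-integrable `[c, d] (EFin \o g).
Proof.
move=> ac db; apply: integrableS => //.
by move=> x /=; rewrite !in_itv /= => /andP[cx xd]; rewrite (le_trans ac cx) (le_trans xd db).
Qed.

Lemma primitive_continuous a b f g : a <= b -> primitive_on a b f g ->
  {within `[a, b], continuous f}.
Proof.
rewrite le_eqVlt => /predU1P[->|ab] [ig fE].
  by rewrite set_itv1; exact: continuous_subspace1.
have cI := parameterized_integral_continuous (ltW ab) ig.
apply: (@subspace_eq_continuous _ _ _ (fun x => f a + parameterized_integral mu a x g)).
  by move=> x; rewrite inE /= in_itv /= => xab; exact/esym/fE.
move=> x; apply: cvgD; [exact: cvg_cst|exact: cI].
Qed.

(** Lebesgue differentiation for [g] extended by 0 outside the interval. *)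
Lemma primitive_ae a b f g : primitive_on a b f g ->
  {ae mu, forall x, a < x < b -> derivable f x 1 /\ derive1 f x = g x}.
Proof.
move=> [ig fE].
pose h := g \_ `[a, b].
have lh : locally_integrable setT h by exact: integrable_locally.
apply: filterS (lebesgue_differentiation lh) => x lx /andP[ax xb].
have ih : mu.-integrable `[a, b] (EFin \o h).
  by rewrite -restrict_EFin; apply/integrable_restrict => //=; rewrite setIid.
pose F y := \int[mu]_(t in `[a, y]) h t.
have [dF F'] : derivable F x 1 /\ derive1 F x = h x.
  by apply: (@FTC1_lebesgue_pt _ h (BLeft a) x b).
have hx : h x = g x by rewrite /h patchE ifT// inE /= in_itv /= !ltW.
have fF : \forall y \near x, f a + F y = f y.
  near=> y; rewrite [f y]fE; last first.
    by apply/andP; split; apply: ltW; near: y; [exact: lt_nbhsr|exact: lt_nbhsl].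
  congr (_ + _); apply: eq_Rintegral => t; rewrite inE /= in_itv /= => /andP[at_ ty].
  rewrite /h patchE ifT// inE /= in_itv /= at_ (le_trans ty)//.
  by apply: ltW; near: y; exact: lt_nbhsl.
have dc : derivable (fun y => f a + F y) x 1.
  exact: (derivableD (derivable_cst _ _ _) dF).
split; first exact: (near_eq_derivable fF).
rewrite derive1E -(near_eq_derive (1 : R) fF).
have := deriveD (derivable_cst (f a) x 1) dF.
by rewrite derive_cst add0r -(derive1E F) F' hx.
Unshelve. all: by end_near. Qed.

Lemma ae_not1 (a : R) : {ae mu, forall x, x != a}.
Proof.
exists [set a]; split; [exact: measurable_set1|exact: lebesgue_measure_set1|].
by move=> x /= /negP; rewrite negbK => /eqP.
Qed.

Lemma primitive_ae_cc a b f g : primitive_on a b f g ->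
  {ae mu, forall x, `[a, b]%classic x -> derive1 f x = g x}.
Proof.
move=> pf; near=> x; rewrite /= in_itv /= => /andP[ax xb].
have xa : x != a by near: x; exact: ae_not1.
have xb' : x != b by near: x; exact: ae_not1.
have H : a < x < b -> derivable f x 1 /\ derive1 f x = g x.
  by near: x; exact: primitive_ae.
by apply H; rewrite !lt_neqAle ax xb xb' eq_sym xa.
Unshelve. all: by end_near. Qed.

Lemma primitive_ac a b f g : a <= b -> primitive_on a b f g -> ac_on a b f.
Proof.
move=> ab pf; have [ig fE] := pf.
have md := measurable_derive1_within (primitive_continuous ab pf).
have ae := primitive_ae_cc pf.
split; first by apply: ae_integrable ig.
move=> x /andP[ax xb]; rewrite fE ?ax//; congr (_ + _).
have sub : `[a, x] `<=` `[a, b] by apply: subset_itvl; rewrite bnd_simp.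
apply/esym/ae_eq_Rintegral => //.
- exact: measurable_funS md.
- by apply: measurable_funS sub _ => //; case/integrableP : ig => /measurable_EFinP.
- apply: filterS ae => y H /sub; exact: H.
Qed.

Lemma primitive_sqr a b f g : a <= b -> primitive_on a b f g ->
  mu.-integrable `[a, b] (EFin \o (fun t => g t ^+ 2)) ->
  mu.-integrable `[a, b] (EFin \o (fun t => derive1 f t ^+ 2)).
Proof.
move=> ab pf; have md := measurable_derive1_within (primitive_continuous ab pf).
apply: ae_integrable => //; first exact: measurable_funX.
apply: filterS (primitive_ae_cc pf) => x H /H; by rewrite /= => ->.
Qed.

End Measurability.

(** * Calculus of absolutely continuous and W^{1,2} functions on an interval *)

Section Sobolev.
Context {R : realType}.
Local Notation mu := (@lebesgue_measure R).

Section Generic.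
Context d (T : measurableType d) (nu : {measure set T -> \bar R}).
Implicit Types (D : set T) (g h : T -> R).

Lemma measurable_int_fun D g :
  nu.-integrable D (EFin \o g) -> measurable_fun D g.
Proof. by case/integrableP => /measurable_EFinP. Qed.

Lemma integrable_comb D (k : R) g h : measurable D ->
  nu.-integrable D (EFin \o g) -> nu.-integrable D (EFin \o h) ->
  nu.-integrable D (EFin \o (fun t => k * g t + h t)).
Proof.
move=> mD ig ih.
by have := integrableD mD (integrableZl mD k ig) ih; apply: eq_integrable.
Qed.

Lemma integrable_addr D g h : measurable D ->
  nu.-integrable D (EFin \o g) -> nu.-integrable D (EFin \o h) ->
  nu.-integrable D (EFin \o (fun t => g t + h t)).
Proof. by move=> mD ig ih; have := integrableD mD ig ih; apply: eq_integrable. Qed.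

Lemma integrable_subr D g h : measurable D ->
  nu.-integrable D (EFin \o g) -> nu.-integrable D (EFin \o h) ->
  nu.-integrable D (EFin \o (fun t => g t - h t)).
Proof. by move=> mD ig ih; have := integrableB mD ig ih; apply: eq_integrable. Qed.

Lemma integrable_scale D (k : R) g : measurable D ->
  nu.-integrable D (EFin \o g) -> nu.-integrable D (EFin \o (fun t => k * g t)).
Proof. by move=> mD ig; have := integrableZl mD k ig; apply: eq_integrable. Qed.

Lemma le_integrable_real D g h : measurable D -> measurable_fun D g ->
  (forall x, D x -> `|g x| <= h x) ->
  nu.-integrable D (EFin \o h) -> nu.-integrable D (EFin \o g).
Proof.
move=> mD mg gh; apply: le_integrable => //; first exact/measurable_EFinP.
by move=> x Dx /=; rewrite lee_fin (le_trans (gh x Dx))// ler_norm.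
Qed.

Lemma integrable_sqr_comb D (k : R) g h : measurable D ->
  measurable_fun D g -> measurable_fun D h ->
  nu.-integrable D (EFin \o (fun t => g t ^+ 2)) ->
  nu.-integrable D (EFin \o (fun t => h t ^+ 2)) ->
  nu.-integrable D (EFin \o (fun t => (k * g t + h t) ^+ 2)).
Proof.
move=> mD mg mh ig ih.
have i2 := integrable_addr mD (integrable_scale (2 * k ^+ 2) mD ig)
  (integrable_scale 2 mD ih).
apply: le_integrable_real i2 => //.
  apply: measurable_funX; apply: measurable_funD => //.
  by apply: measurable_funM => //; exact: measurable_cst.
move=> x _ /=; rewrite ger0_norm ?sqr_ge0//.
by have := sqr_ge0 (k * g x - h x); nra.
Qed.

Lemma Rintegral_subset (A B : set T) g : measurable A -> measurable B ->
  A `<=` B -> (forall x, B x -> 0 <= g x) -> nu.-integrable B (EFin \o g) ->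
  \int[nu]_(x in A) g x <= \int[nu]_(x in B) g x.
Proof.
move=> mA mB AB g0 iB; apply: fine_le.
- by apply: integrable_fin_num => //; exact: integrableS iB.
- exact: integrable_fin_num.
- by apply: ge0_subset_integral => //; case/integrableP: iB.
Qed.

Lemma integrable_setU (A B : set T) g : measurable A -> measurable B ->
  nu.-integrable A (EFin \o g) -> nu.-integrable B (EFin \o g) ->
  nu.-integrable (A `|` B) (EFin \o g).
Proof.
move=> mA mB iA iB; have mAB : measurable (A `|` B) by exact: measurableU.
have mg : measurable_fun (A `|` B) g.
  by apply/measurable_funU => //; split; exact: measurable_int_fun.
have pA : nu.-integrable setT (EFin \o (g \_ A)).
  by rewrite -restrict_EFin; apply/integrable_restrict => //=; rewrite setTI.
have pB : nu.-integrable setT (EFin \o (g \_ B)).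
  by rewrite -restrict_EFin; apply/integrable_restrict => //=; rewrite setTI.
have := integrable_addr measurableT (integrable_norm pA) (integrable_norm pB).
move/(integrableS measurableT mAB (@subsetT _ _)); apply: le_integrable_real => //.
move=> x; rewrite /= !patchE => -[Ax|Bx].
  by rewrite (mem_set Ax) lerDl.
by rewrite (mem_set Bx) lerDr.
Qed.

End Generic.

Lemma measurable_int_leb (D : set R) (g : R -> R) :
  mu.-integrable D (EFin \o g) -> measurable_fun D g.
Proof. by case/integrableP => /measurable_EFinP. Qed.

Lemma primitive_comb a b k (f g F G : R -> R) : a <= b ->
  primitive_on a b F f -> primitive_on a b G g ->
  primitive_on a b (fun t => k * F t + G t) (fun t => k * f t + g t).
Proof.
move=> ab [if_ FE] [ig GE]; split; first exact: integrable_comb.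
move=> x xab; have /andP[ax xb] := xab; rewrite (FE x)// (GE x)//.
have ifx := integrable_itvS (lexx a) xb if_.
have igx := integrable_itvS (lexx a) xb ig.
rewrite [X in _ = _ + X](_ : _ = k * \int[mu]_(t in `[a, x]) f t
    + \int[mu]_(t in `[a, x]) g t); first by rewrite mulrDr addrACA.
rewrite -RintegralZl// -RintegralD//.
by apply: integrable_scale.
Qed.

Definition w12 (a b : R) (f : R -> R) : Prop := ac_on a b f /\
  mu.-integrable `[a, b] (EFin \o (fun t => derive1 f t ^+ 2)).

Lemma w12_primitive a b (f g : R -> R) : a <= b -> primitive_on a b f g ->
  mu.-integrable `[a, b] (EFin \o (fun t => g t ^+ 2)) -> w12 a b f.
Proof.
by move=> ab pf ig; split; [exact: primitive_ac pf|exact: primitive_sqr pf ig].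
Qed.

Lemma w12_comb a b k (F G : R -> R) : a <= b -> w12 a b F -> w12 a b G ->
  w12 a b (fun t => k * F t + G t).
Proof.
move=> ab [aF sF] [aG sG]; apply: (w12_primitive ab (primitive_comb k ab aF aG)).
by apply: integrable_sqr_comb => //; apply: measurable_int_leb; [case: aF|case: aG].
Qed.

Lemma primitive_eq a b (f f' g : R -> R) : (forall x, a <= x <= b -> f x = f' x) ->
  primitive_on a b f g -> primitive_on a b f' g.
Proof.
move=> ff [ig fE]; split=> // x xab; rewrite -!ff//; first exact: fE.
by case/andP: xab => ax xb; rewrite lexx (le_trans ax xb).
Qed.

Lemma w12_eq a b (f f' : R -> R) : a <= b -> (forall x, a <= x <= b -> f x = f' x) ->
  w12 a b f -> w12 a b f'.
Proof. by move=> ab ff [af sf]; apply: (w12_primitive ab (primitive_eq ff af)). Qed.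

Lemma primitive_glue a m b (f g : R -> R) : a <= m -> m <= b ->
  primitive_on a m f g -> primitive_on m b f g -> primitive_on a b f g.
Proof.
move=> am mb [i1 f1] [i2 f2].
have ig : mu.-integrable `[a, b] (EFin \o g).
  have -> : `[a, b]%classic = `[a, m]%classic `|` `[m, b]%classic :> set R.
    apply/seteqP; split => x /=; rewrite !in_itv /=.
      by move=> /andP[-> ->]; rewrite andbT; case: (leP x m) => [|/ltW ->]; [left|right].
    by move=> [/andP[-> xm]|/andP[mx ->]]; rewrite ?andbT ?(le_trans xm)// (le_trans am).
  exact: integrable_setU.
split=> // x /andP[ax xb]; have [xm|mx] := leP x m; first by apply: f1; rewrite ax.
rewrite f2 ?(ltW mx)// (f1 m) ?am ?lexx//.
have ix := integrable_itvS (lexx a) xb ig.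
have := @Rintegral_itvB _ g (BLeft a) (BRight x) m ix; rewrite !bnd_simp => /(_ am (ltW mx)).
rewrite Rintegral_itv_obnd_cbnd; last first.
  by apply: integrableS ix => //; apply: subset_itvr; rewrite bnd_simp.
by move=> <-; rewrite -addrA [X in _ + X]addrC subrK.
Qed.

Lemma C1_primitive a b (f g : R -> R) : a <= b ->
  {within `[a, b], continuous f} -> {within `[a, b], continuous g} ->
  (forall x, a < x < b -> derivable f x 1 /\ derive1 f x = g x) ->
  primitive_on a b f g.
Proof.
move=> ab cf cg df.
have ig : mu.-integrable `[a, b] (EFin \o g).
  by apply: continuous_compact_integrable => //; exact: segment_compact.
split=> // x /andP[]; rewrite le_eqVlt => /predU1P[<- _|ax xb].
  by rewrite set_itv1 Rintegral_set1 addr0.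
have sub : `[a, x] `<=` `[a, b] by apply: subset_itvl; rewrite bnd_simp.
have cfx := continuous_subspaceW sub cf.
have cgx := continuous_subspaceW sub cg.
have [_ fr fl] := (continuous_within_itvP _ ax).1 cfx.
rewrite /Rintegral (@continuous_FTC2 _ g f _ _ ax cgx).
- by rewrite -EFinB /= addrC subrK.
- split=> // y; rewrite in_itv /= => /andP[ay yx].
  by apply: (df y _).1; rewrite ay (lt_le_trans yx).
- move=> y; rewrite in_itv /= => /andP[ay yx].
  by apply: (df y _).2; rewrite ay (lt_le_trans yx).
Qed.

Lemma Cr1_within a b (O : set R) (f : R -> R) : `[a, b] `<=` O -> Cr 1 O f ->
  {within `[a, b], continuous f} /\ {within `[a, b], continuous (derive1 f)}.
Proof.
move=> abO [df cf]; split; apply: continuous_in_subspaceT => x.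
  by rewrite inE => /abO Ox; apply: differentiable_continuous; exact: df.
rewrite inE => /abO Ox; have := cf 1 x Ox.
by rewrite (_ : (fun x => 'D_1 f x) = derive1 f)//; apply/funext => y; rewrite derive1E.
Qed.

Lemma Cr1_primitive a b (O : set R) (f : R -> R) : a <= b -> `[a, b] `<=` O ->
  Cr 1 O f -> primitive_on a b f (derive1 f).
Proof.
move=> ab abO cf; have [c0 c1] := Cr1_within abO cf.
apply: C1_primitive => // x /andP[ax xb]; split=> //; apply: diff_derivable.
by apply: cf.1; apply: abO; rewrite /= in_itv /= !ltW.
Qed.

Lemma Cr1_w12 a b (O : set R) (f : R -> R) : a <= b -> `[a, b] `<=` O ->
  Cr 1 O f -> w12 a b f.
Proof.
move=> ab abO cf; apply: (w12_primitive ab (Cr1_primitive ab abO cf)).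
have [_ c1] := Cr1_within abO cf.
apply: continuous_compact_integrable; first exact: segment_compact.
by move=> x; apply: cvgM; exact: c1.
Qed.

Lemma within_bounded a b (f : R -> R) : {within `[a, b], continuous f} ->
  exists2 C, 0 < C & forall x, a <= x <= b -> `|f x| <= C.
Proof.
move=> cf; have /compact_bounded [N [_ HN]] :=
  continuous_compact cf (@segment_compact _ a b).
exists (`|N| + 1); first by rewrite ltr_wpDl.
move=> x xab; apply: (HN (`|N| + 1)); first by rewrite (le_lt_trans (ler_norm N))// ltrDl.
by exists x.
Qed.

Lemma integrable_mul_bounded a b (g h : R -> R) :
  mu.-integrable `[a, b] (EFin \o g) -> {within `[a, b], continuous h} ->
  mu.-integrable `[a, b] (EFin \o (fun t => g t * h t)).
Proof.
move=> ig ch; have [C C0 HC] := within_bounded ch.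
have iCg : mu.-integrable `[a, b] (EFin \o (fun t => C * `|g t|)).
  by apply: integrable_scale => //; apply: integrable_norm.
apply: le_integrable_real iCg => //.
  apply: measurable_funM; first exact: measurable_int_leb.
  by apply: subspace_continuous_measurable_fun.
move=> x; rewrite /= in_itv /= => xab.
by rewrite normrM mulrC ler_wpM2r// HC.
Qed.

(** The integrand [g] is approximated in L^1 by a continuous [h], for whose primitive [F] the
    classical product rule and the fundamental theorem hold. Since [f - F] is bounded by the L^1
    norm of [g - h], the defect [X] of the formula is arbitrarily small. *)
Lemma primitive_mul_C1 a b (f g r r' : R -> R) : a <= b ->
  {within `[a, b], continuous r} -> {within `[a, b], continuous r'} ->
  (forall x, a < x < b -> derivable r x 1 /\ derive1 r x = r' x) ->
  primitive_on a b f g ->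
  primitive_on a b (fun t => f t * r t) (fun t => g t * r t + f t * r' t).
Proof.
move=> ab cr cr' dr pf; have [ig fE] := pf.
have cf := primitive_continuous ab pf.
have mab : measurable (`[a, b]%classic : set (measurableTypeR R)) by [].
have i1 := integrable_mul_bounded ig cr.
have if_ : mu.-integrable `[a, b] (EFin \o f).
  by apply: continuous_compact_integrable => //; exact: segment_compact.
have i2 := integrable_mul_bounded if_ cr'.
have i12 : mu.-integrable `[a, b] (EFin \o (fun t => g t * r t + f t * r' t)).
  exact: integrable_addr.
split=> // x xab; have /andP[ax xb] := xab.
have [C C0 HC] := within_bounded cr; have [C' C'0 HC'] := within_bounded cr'.
have fin : (mu `[a, b]%classic < +oo)%E by rewrite lebesgue_measure_itv /= ; case: ifP => // _; rewrite ltry.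
have [h_ [ch ih hg]] := approximation_continuous_integrable mab fin ig.
apply/eqP; rewrite -subr_eq0; apply/eqP.
set X := LHS.
(* The three contributions are the boundary term [(f x - F x) * r x], the integral of [(h - g) * r]
   and the integral of [(F - f) * r']; [C] and [C'] bound [r] and [r']. *)
suff : forall e, 0 < e -> `|X| <= (C + C + (b - a) * C') * e.
  move=> H; apply/eqP; rewrite -normr_le0; apply/ler_addgt0Pr => e e0.
  have K0 : 0 < C + C + (b - a) * C' + 1.
    rewrite ltr_wpDl// addr_ge0 ?addr_ge0 ?(ltW C0)// mulr_ge0 ?(ltW C'0)//.
    by rewrite subr_ge0.
  rewrite add0r; apply: le_trans (H (e / (C + C + (b - a) * C' + 1)) _) _.
    by rewrite divr_gt0.
  rewrite mulrA ler_pdivrMr// mulrC ler_pM2l// lerDl//.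
move=> e e0.
have [m Hm] : exists m, (\int[mu]_(z in `[a, b]) `|(g z - h_ m z)%:E| <= e%:E)%E.
  have /fine_cvgP[[N1 _ H1] /cvgrPdist_le /(_ e e0) [N2 _ H2]] := hg.
  exists (maxn N1 N2); have /= F := H1 _ (leq_maxl N1 N2).
  have /= := H2 _ (leq_maxr N1 N2).
  rewrite sub0r normrN => /(le_trans (ler_norm _)); rewrite -lee_fin.
  by rewrite fineK.
pose h := h_ m; pose J y := \int[mu]_(t in `[a, y]) h t; pose F y := f a + J y.
have ih' : mu.-integrable `[a, b] (EFin \o h) := ih m.
have idiff : mu.-integrable `[a, b] (EFin \o (fun t => g t - h t)).
  exact: integrable_subr.
have Fa : F a = f a by rewrite /F /J set_itv1 Rintegral_set1 addr0.
have pF : primitive_on a b F h by split=> // y _; rewrite Fa.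
have cF := primitive_continuous ab pF.
have chw : {within `[a, b], continuous h} by apply: continuous_subspaceT; exact: ch.
have dF y : a < y < b -> derivable F y 1 /\ derive1 F y = h y.
  move=> /andP[ay yb].
  have [d1 d2] : derivable J y 1 /\ derive1 J y = h y.
    exact: (continuous_FTC1_closed yb ih' ay (ch m y)).
  split; first exact: (derivableD (derivable_cst _ _ _) d1).
  rewrite derive1E; have := deriveD (derivable_cst (f a) y 1) d1.
  by rewrite derive_cst add0r -(derive1E J) d2.
have pFr : primitive_on a b (fun t => F t * r t) (fun t => h t * r t + F t * r' t).
  apply: C1_primitive => //.
  - by move=> y; apply: cvgM; [exact: cF|exact: cr].
  - by move=> y; apply: cvgD; apply: cvgM; [exact: chw|exact: cr|exact: cF|exact: cr'].
  - move=> y yab; have [dF1 dF2] := dF y yab; have [dr1 dr2] := dr y yab.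
    split; first exact: (derivableM dF1 dr1).
    rewrite derive1E; have := deriveM dF1 dr1; rewrite -!derive1E dF2 dr2 => ->.
    by rewrite /GRing.scale /= addrC [r y * _]mulrC.
pose N y := \int[mu]_(t in `[a, y]) `|g t - h t|.
have iN := integrable_norm idiff.
have Ne y : y <= b -> N y <= e.
  move=> yb; have : N b <= e.
    rewrite /N /Rintegral -lee_fin fineK; first exact: Hm.
    exact: (integrable_fin_num mab iN).
  apply: le_trans; apply: Rintegral_subset => //.
  by apply: subset_itvl; rewrite bnd_simp.
have Fd y : a <= y <= b -> `|f y - F y| <= e.
  move=> /andP[ay yb].
  rewrite (fE y) ?ay// /F /J opprD addrACA subrr add0r -RintegralB//; last 2 first.
  - exact: integrable_itvS (lexx a) yb ig.
  - exact: integrable_itvS (lexx a) yb ih'.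
  have idy := integrable_itvS (lexx a) yb idiff.
  apply: le_trans (Ne y yb); exact: le_normr_Rintegral.
have [ik1 /(_ x xab)] := pFr; rewrite Fa => FrE.
have ik1x := integrable_itvS (lexx a) xb ik1.
have ik2x := integrable_itvS (lexx a) xb i12.
set k1 := (fun t => h t * r t + F t * r' t) in ik1x FrE.
set k2 := (fun t => g t * r t + f t * r' t) in ik2x.
have ikx : mu.-integrable `[a, x] (EFin \o (fun t => k1 t - k2 t)) by exact: integrable_subr.
have -> : X = (f x - F x) * r x + \int[mu]_(t in `[a, x]) (k1 t - k2 t).
  by rewrite RintegralB// mulrBl FrE /X -/k2; ring.
rewrite [X in _ <= X](_ : _ = C * e + (C * e + (b - a) * C' * e)); last by ring.
apply: le_trans (ler_normD _ _) _; apply: lerD.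
  by rewrite normrM mulrC ler_pM//; [exact: HC|exact: Fd].
apply: le_trans (le_normr_Rintegral _ ikx) _ => //.
have iNx := integrable_itvS (lexx a) xb iN.
have iC : mu.-integrable `[a, x] (EFin \o (fun t => C * `|g t - h t|)) by exact: integrable_scale.
have finx : (mu `[a, x]%classic < +oo)%E by rewrite lebesgue_measure_itv /=; case: ifP => // _; rewrite ltry.
have ic : mu.-integrable `[a, x] (EFin \o (fun=> e * C')).
  apply: continuous_compact_integrable; first exact: segment_compact.
  by apply: continuous_subspaceT => t; exact: cvg_cst.
apply: (@le_trans _ _ (\int[mu]_(t in `[a, x]) (C * `|g t - h t| + e * C'))).
  apply: le_Rintegral => //; [exact: integrable_norm|exact: integrable_addr|].
  move=> t; rewrite /= in_itv /= => /andP[at_ tx].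
  have tab : a <= t <= b by rewrite at_ (le_trans tx).
  have -> : k1 t - k2 t = (h t - g t) * r t + (F t - f t) * r' t.
    by rewrite /k1 /k2; ring.
  apply: le_trans (ler_normD _ _) _; rewrite !normrM; apply: lerD.
    by rewrite mulrC distrC ler_wpM2r// HC.
  by rewrite distrC ler_pM// ?Fd// HC'.
rewrite RintegralD// RintegralZl// Rintegral_cst//; apply: lerD.
  by rewrite ler_pM2l// Ne.
have -> : fine (mu `[a, x]%classic) = x - a.
  by rewrite lebesgue_measure_itv /= lte_fin; case: ltP => // xa; have -> : x = a; [by apply/eqP; rewrite eq_le xa ax|rewrite subrr].
rewrite [X in _ <= X](_ : _ = e * C' * (b - a)); last by ring.
by rewrite ler_wpM2l ?lerD2r// mulr_ge0 ?(ltW e0)// ltW.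
Qed.

Lemma w12_mul a b (O : set R) (f r : R -> R) : a <= b -> `[a, b] `<=` O ->
  Cr 1 O r -> w12 a b f ->
  primitive_on a b (fun t => f t * r t)
    (fun t => derive1 f t * r t + f t * derive1 r t) /\
  w12 a b (fun t => f t * r t).
Proof.
move=> ab abO cr [af sf]; have [c0 c1] := Cr1_within abO cr.
have cf := primitive_continuous ab af.
have pm : primitive_on a b (fun t => f t * r t)
    (fun t => derive1 f t * r t + f t * derive1 r t).
  apply: primitive_mul_C1 => // x /andP[ax xb]; split=> //.
  by apply: diff_derivable; apply: cr.1; apply: abO; rewrite /= in_itv /= !ltW.
split; first exact: pm.
apply: (w12_primitive ab pm).
have mf' := measurable_int_leb af.1.
have mc (h : R -> R) : {within `[a, b], continuous h} -> measurable_fun `[a, b] h.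
  by move=> ch; exact: subspace_continuous_measurable_fun.
have -> : (fun t => (derive1 f t * r t + f t * derive1 r t) ^+ 2) =
  (fun t => (1 * (derive1 f t * r t) + f t * derive1 r t) ^+ 2).
  by apply/funext => t; rewrite mul1r.
pose G t := derive1 f t * r t; pose H t := f t * derive1 r t.
change (mu.-integrable `[a, b] (EFin \o (fun t => (1 * G t + H t) ^+ 2))).
apply: integrable_sqr_comb => //.
- by apply: measurable_funM => //; exact: mc.
- by apply: measurable_funM => //; exact: mc.
- have -> : (fun t => (derive1 f t * r t) ^+ 2) = (fun t => derive1 f t ^+ 2 * r t ^+ 2).
    by apply/funext => t; rewrite exprMn.
  by apply: integrable_mul_bounded => // x; apply: cvgM; exact: c0.
- apply: continuous_compact_integrable; first exact: segment_compact.
  by move=> x; apply: cvgM; apply: cvgM; [exact: cf|exact: c1|exact: cf|exact: c1].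
Qed.

End Sobolev.

(** * Polynomial approximation in W^{1,2} *)

Section Weierstrass.
Context {R : realType}.

Definition bern (n k : nat) (x : R) : R := x ^+ k * (1 - x) ^+ (n - k) *+ 'C(n, k).

Lemma bern_sum n x : \sum_(k < n.+1) bern n k x = 1.
Proof.
have -> : \sum_(k < n.+1) bern n k x = (1 - x + x) ^+ n.
  by rewrite exprDn; apply: eq_bigr => k _; rewrite /bern mulrC.
by rewrite subrK expr1n.
Qed.

(** The absorption identity for binomial coefficients. The weight [phi] is free so that [phi = 1]
    gives the mean and [phi k = k] the second moment of the binomial distribution. *)
Lemma bern_weight n x (phi : nat -> R) :
  \sum_(k < n.+2) k%:R * phi k * bern n.+1 k x =
  n.+1%:R * x * \sum_(k < n.+1) phi k.+1 * bern n k x.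
Proof.
rewrite big_ord_recl !mul0r add0r mulr_sumr; apply: eq_bigr => k _ /=.
rewrite /bump /= add1n /bern subSS exprS.
rewrite -[_ *+ 'C(n.+1, _)]mulr_natr -[_ *+ 'C(n, _)]mulr_natr.
have := mul_bin_diag n.+1 k => /(congr1 (fun m => m%:R : R)); rewrite /= !natrM => E.
rewrite -[RHS]mulrA [RHS]mulrCA.
transitivity ((k.+1%:R * 'C(n.+1, k.+1)%:R) * (phi k.+1 * x * (x ^+ k * (1 - x) ^+ (n - k)))).
  by ring.
by rewrite -E; ring.
Qed.

Lemma bern_var n x :
  \sum_(k < n.+2) (k%:R - n.+1%:R * x) ^+ 2 * bern n.+1 k x = n.+1%:R * x * (1 - x).
Proof.
have E1 m : \sum_(k < m.+1) k%:R * bern m k x = m%:R * x.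
  case: m => [|m]; first by rewrite big_ord1 !mul0r.
  have := bern_weight m x (fun=> 1).
  under eq_bigr do rewrite mulr1.
  under [X in _ = _ * X]eq_bigr do rewrite mul1r.
  by rewrite bern_sum mulr1.
have E2 : \sum_(k < n.+2) k%:R * k%:R * bern n.+1 k x = n.+1%:R * x * (n%:R * x + 1).
  rewrite bern_weight; congr (_ * _).
  transitivity (\sum_(k < n.+1) (k%:R * bern n k x + bern n k x)).
    by apply: eq_bigr => k _; rewrite -natr1 mulrDl mul1r.
  by rewrite big_split /= E1 bern_sum.
transitivity (\sum_(k < n.+2) (k%:R * k%:R * bern n.+1 k x +
   (- 2 * n.+1%:R * x) * (k%:R * bern n.+1 k x) + (n.+1%:R * x) ^+ 2 * bern n.+1 k x)).
  by apply: eq_bigr => k _; ring.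
rewrite !big_split /= -!mulr_sumr E2 E1 bern_sum -natr1; ring.
Qed.

Lemma bern_ge0 n k x : 0 <= x <= 1 -> 0 <= bern n k x.
Proof.
by move=> /andP[x0 x1]; rewrite /bern mulrn_wge0// mulr_ge0// exprn_ge0// subr_ge0.
Qed.

(** Uniform continuity for close points and boundedness for distant ones, merged into one quadratic
    bound: this form can be summed against the Bernstein weights, whose variance is known. *)
Lemma uniform_modulus (g : R -> R) (e : R) : continuous g -> 0 < e ->
  exists2 C, 0 <= C & forall x y, 0 <= x <= 1 -> 0 <= y <= 1 ->
    `|g x - g y| <= e + C * (x - y) ^+ 2.
Proof.
move=> cg e0.
have cK : compact (`[0, 1]%classic : set R) by exact: segment_compact.
have /compact_near_coveringP ncov := cK.
pose P (d x : R) := forall y, `|x - y| < d -> `|g x - g y| <= e.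
have H : \forall d \near (0 : R)^'+, `[0, 1]%classic `<=` P d.
  apply: (ncov _ (nbhs (0 : R)^'+) P) => x _.
  have e2 : 0 < e / 2 by rewrite divr_gt0.
  have /cvgrPdist_le /(_ _ e2) /nbhs_normP [h /= h0 Hh] := cg x.
  have h2 : 0 < h / 2 by rewrite divr_gt0.
  exists ([set x' | `|x - x'| < h / 2], [set d | d < h / 2]).
    split=> /=; first by apply/nbhs_normP; exists (h / 2).
    by apply: nbhs_right_lt.
  move=> [x' d] /= [xx' dh] y x'y.
  have -> : g x' - g y = (g x' - g x) + (g x - g y) by rewrite subrKA.
  rewrite [e]splitr; apply: le_trans (ler_normD _ _) _; rewrite lerD//.
    rewrite distrC; apply: Hh; rewrite /=; apply: lt_trans xx' _.
    by rewrite ltr_pdivrMr// mulr2n mulrDr mulr1 ltrDl.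
  apply: Hh; rewrite /= -(subrKA x') [h]splitr.
  by apply: le_lt_trans (ler_normD _ _) _; rewrite ltrD// (lt_trans x'y).
have [d [d0 Hd]] : exists d : R, 0 < d /\ `[0, 1]%classic `<=` P d.
  have : \forall d \near (0 : R)^'+, 0 < d /\ `[0, 1]%classic `<=` P d.
    by near=> d; split; near: d => //; exact: nbhs_right_gt.
  exact: filter_ex.
have [N N0 HN] : exists2 N, 0 < N & forall x, 0 <= x <= 1 -> `|g x| <= N.
  by apply: within_bounded; exact: continuous_subspaceT.
exists (2 * N / d ^+ 2); first by rewrite divr_ge0 ?mulr_ge0 ?exprn_ge0 ?ltW.
move=> x y x01 y01; have [xyd|dxy] := ltP `|x - y| d.
  apply: (@le_trans _ _ e); first by apply: Hd => //; rewrite /= in_itv.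
  by rewrite lerDl mulr_ge0 ?sqr_ge0// divr_ge0 ?mulr_ge0 ?exprn_ge0 ?ltW.
apply: (@le_trans _ _ (2 * N)).
  apply: le_trans (ler_normB _ _) _; rewrite mulr2n mulrDl !mul1r.
  by apply: lerD; exact: HN.
rewrite ler_wpDl ?(ltW e0)// mulrAC -mulrA ler_peMr ?mulr_ge0 ?(ltW N0)//.
rewrite ler_pdivlMr ?exprn_gt0// mul1r -[X in _ <= X]real_normK ?num_real//.
by rewrite ler_pXn2r// ?nnegrE ?(ltW d0).
Unshelve. all: by end_near. Qed.

Lemma weierstrass01 (g : R -> R) (e : R) : continuous g -> 0 < e ->
  exists p : {poly R}, forall x, 0 <= x <= 1 -> `|g x - p.[x]| <= e.
Proof.
move=> cg e0; have e2 : 0 < e / 2 by rewrite divr_gt0.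
have [C C0 HC] := uniform_modulus cg e2.
(* The variance contributes [C / n.+1%:R] times [x * (1 - x)], and the latter is at most 1. *)
have [n Hn] : exists n : nat, C / n.+1%:R <= e / 2.
  have C1 : 0 < e / 2 / (C + 1) by rewrite divr_gt0// ltr_wpDl.
  have [n _ /(_ n (leqnn n)) Hn] := near_infty_natSinv_lt (PosNum C1).
  exists n; rewrite mulrC.
  apply: (@le_trans _ _ (n.+1%:R^-1 * (C + 1))); first by rewrite ler_wpM2l ?invr_ge0// lerDl.
  by rewrite -ler_pdivlMr ?ltr_wpDl// ltW.
pose p : {poly R} := \sum_(k < n.+2)
  (g (k%:R / n.+1%:R) *+ 'C(n.+1, k)) *: ('X ^+ k * (1 - 'X) ^+ (n.+1 - k)).
exists p => x x01.
have -> : p.[x] = \sum_(k < n.+2) g (k%:R / n.+1%:R) * bern n.+1 k x.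
  rewrite /p horner_sum; apply: eq_bigr => k _.
  rewrite hornerZ hornerM hornerXn horner_exp.
  rewrite (_ : (1 - 'X : {poly R}).[x] = 1 - x); last by rewrite !hornerE.
  by rewrite /bern [LHS]mulrnAl [RHS]mulrnAr.
rewrite -[g x]mulr1 -[X in g x * X](bern_sum n.+1 x) mulr_sumr -sumrB.
apply: le_trans (ler_norm_sum _ _ _) _.
apply: (@le_trans _ _ (\sum_(k < n.+2) (e / 2 * bern n.+1 k x +
   C / n.+1%:R ^+ 2 * ((k%:R - n.+1%:R * x) ^+ 2 * bern n.+1 k x)))).
  apply: ler_sum => k _; rewrite -mulrBl normrM (ger0_norm (bern_ge0 _ _ x01)).
  rewrite [X in _ <= _ + X]mulrA -mulrDl; apply: ler_wpM2r; first exact: bern_ge0.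
  have k01 : 0 <= (k%:R / n.+1%:R : R) <= 1.
    by rewrite divr_ge0//= ler_pdivrMr// mul1r ler_nat -ltnS.
  apply: le_trans (HC _ _ x01 k01) _; rewrite lerD2l -mulrA ler_wpM2l//.
  have -> : k%:R - n.+1%:R * x = n.+1%:R * (k%:R / n.+1%:R - x).
    by rewrite mulrBr mulrCA divff ?mulr1.
  rewrite exprMn mulKf ?expf_neq0//.
  by rewrite -[X in X <= _]sqrrN opprB.
rewrite big_split /= -!mulr_sumr bern_sum mulr1 bern_var [e in _ <= e]splitr lerD2l.
apply: le_trans Hn; case/andP: x01 => x0 x1.
have -> : C / n.+1%:R ^+ 2 * (n.+1%:R * x * (1 - x)) = C / n.+1%:R * (x * (1 - x)).
  by field.
by rewrite ler_piMr ?divr_ge0// mulr_ile1// ?subr_ge0// gerBl.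
Qed.

Lemma weierstrass (a b : R) (g : R -> R) (e : R) : a <= b -> continuous g -> 0 < e ->
  exists p : {poly R}, forall x, a <= x <= b -> `|g x - p.[x]| <= e.
Proof.
rewrite le_eqVlt => /predU1P[<-|ab] cg e0.
  exists (g a)%:P => x /andP[ax xa]; have -> : x = a by apply/eqP; rewrite eq_le xa ax.
  by rewrite hornerC subrr normr0 ltW.
have ba : 0 < b - a by rewrite subr_gt0.
pose h x := g (a + (b - a) * x).
have ch : continuous h.
  move=> x; apply: (@continuous_comp _ _ _ (fun x => a + (b - a) * x) g); last exact: cg.
  by apply: cvgD; [exact: cvg_cst|apply: cvgM; [exact: cvg_cst|exact: cvg_id]].
have [p Hp] := weierstrass01 ch e0.
exists (p \Po ((b - a)^-1 *: ('X - a%:P))) => x /andP[ax xb].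
rewrite horner_comp !hornerE.
have := Hp ((b - a)^-1 * (x - a)); rewrite /h mulrA divff ?gt_eqF// mul1r.
rewrite [a + _]addrC subrK; apply; rewrite mulr_ge0 ?invr_ge0 ?(ltW ba) ?subr_ge0//=.
by rewrite mulrC ler_pdivrMr// mul1r lerD2r.
Qed.

(** The constant coefficient is a division by zero, hence 0. *)
Definition antideriv (p : {poly R}) : {poly R} :=
  \poly_(i < (size p).+1) (p`_i.-1 / i%:R).

Lemma antiderivK p : (antideriv p)^`() = p.
Proof.
apply/polyP => i; rewrite coef_deriv coef_poly ltnS /=.
case: ltnP => ip; last by rewrite mul0rn nth_default.
by rewrite -[_ *+ i.+1]mulr_natr divfK ?pnatr_eq0.
Qed.

End Weierstrass.

(** * Approximation by polynomials in L^2 and in W^{1,2} *)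

Section Density.
Context {R : realType}.
Local Notation mu := (@lebesgue_measure R).

Definition trunc (N x : R) : R := Num.max (- N) (Num.min N x).

Lemma trunc_id N x : `|x| <= N -> trunc N x = x.
Proof.
by rewrite ler_norml => /andP[Nx xN]; rewrite /trunc min_r// max_r.
Qed.

Lemma trunc_norm N x : 0 <= N -> `|trunc N x| <= N.
Proof.
move=> N0; rewrite ler_norml /trunc le_max lexx/= ge_max ge_min lexx/=.
by rewrite andbT (le_trans _ N0)// oppr_le0.
Qed.

Lemma trunc_lip N x y : 0 <= N -> `|trunc N x - trunc N y| <= `|x - y|.
Proof.
move=> N0; have H1 := ler_norm (x - y); have := ler_norm (y - x).
rewrite distrC => H2; rewrite ler_norml /trunc /Num.max /Num.min.
by have [xN|xN] := ltP N x; have [yN|yN] := ltP N y;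
  do 2 (case: ltP => ?); apply/andP; split; lra.
Qed.

Lemma trunc_sub N x : 0 <= N -> (x - trunc N x) ^+ 2 <= x ^+ 2.
Proof.
move=> N0; rewrite /trunc /Num.max /Num.min.
by have [xN|xN] := ltP N x; case: ltP => ?; nra.
Qed.

Lemma trunc_continuous N : continuous (trunc N).
Proof.
move=> x; apply: (@continuous_max _ _ (fun=> - N) (fun y => Num.min N y) x); first exact: cvg_cst.
by apply: (@continuous_min _ _ (fun=> N) id x); [exact: cvg_cst|exact: cvg_id].
Qed.

Lemma measurable_trunc N (D : set R) g : measurable_fun D g ->
  measurable_fun D (fun x => trunc N (g x)).
Proof.
by move=> mg; apply: measurable_maxr => //; apply: measurable_minr.
Qed.

Lemma continuous_integrable_cc a b (f : R -> R) : {within `[a, b], continuous f} ->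
  mu.-integrable `[a, b] (EFin \o f).
Proof. by apply: continuous_compact_integrable; exact: segment_compact. Qed.

Lemma mu_itv_fin (a b : R) : (mu `[a, b]%classic < +oo)%E.
Proof. by rewrite lebesgue_measure_itv /=; case: ifP => // _; rewrite ltry. Qed.

Lemma mu_itv (a b : R) : a <= b -> fine (mu `[a, b]%classic) = b - a.
Proof.
move=> ab; rewrite lebesgue_measure_itv /= lte_fin; case: ltP => // ba.
by have -> : b = a; [by apply/eqP; rewrite eq_le ab ba|rewrite subrr].
Qed.

Lemma trunc_L2 a b (g : R -> R) e : 0 < e ->
  mu.-integrable `[a, b] (EFin \o g) ->
  mu.-integrable `[a, b] (EFin \o (fun t => g t ^+ 2)) ->
  exists2 N, 0 < N &
    mu.-integrable `[a, b] (EFin \o (fun t => (g t - trunc N (g t)) ^+ 2)) /\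
    \int[mu]_(t in `[a, b]) ((g t - trunc N (g t)) ^+ 2) <= e.
Proof.
move=> e0 ig ig2; have mg := measurable_int_leb ig.
pose F n t := (g t - trunc n.+1%:R (g t)) ^+ 2.
have mF n : measurable_fun `[a, b] (F n).
  by apply: measurable_funX; apply: measurable_funB => //; exact: measurable_trunc.
have iF n : mu.-integrable `[a, b] (EFin \o F n).
  apply: le_integrable_real ig2 => //; first exact: mF.
  move=> t _.
  by rewrite ger0_norm ?sqr_ge0//; exact: trunc_sub.
have mab : measurable (`[a, b]%classic : set (measurableTypeR R)) by [].
have [_ _] : [/\ mu.-integrable `[a, b] (cst 0%E),
    (fun n => \int[mu]_(x in `[a, b]) `|(EFin \o F n) x - cst 0 x|)%E @ \oo --> 0%E
  & (fun n => \int[mu]_(x in `[a, b]) (EFin \o F n) x)%E @ \oo -->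
    (\int[mu]_(x in `[a, b]) cst 0 x)%E].
  apply: (@dominated_convergence _ _ _ mu `[a, b]%classic mab
    (fun n => EFin \o F n) (cst 0%E) (EFin \o (fun t => g t ^+ 2))) => //.
  - by move=> n; apply/measurable_EFinP; exact: mF.
  - apply: aeW => t _; apply: cvg_near_cst; near=> n; rewrite /= /F trunc_id ?subrr ?expr0n//.
    near: n; have [m _ Hm] := nbhs_infty_ger `|g t|.
    by exists m => // p mp; rewrite /= (le_trans (Hm p mp))// ler_nat.
  - apply: aeW => t n _ /=; rewrite lee_fin ger0_norm ?sqr_ge0//; exact: trunc_sub.
rewrite integral0_eq// => /fine_cvgP[_ /cvgrPdist_le /(_ _ e0) [n _ /(_ n (leqnn n))]].
rewrite /= sub0r normrN => Hn; exists n.+1%:R => //; split; first exact: iF.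
exact: le_trans (ler_norm _) Hn.
Unshelve. all: by end_near. Qed.

(** Continuous functions are available as L^1 approximations only. Once both functions are truncated
    at height [N], the square of their difference is at most [2 * N] times its absolute value, so
    closeness in L^1 becomes closeness in L^2; a uniform polynomial approximation of the truncated
    continuous function finishes. *)
Lemma poly_L2 a b (g : R -> R) e : a <= b -> 0 < e ->
  mu.-integrable `[a, b] (EFin \o g) ->
  mu.-integrable `[a, b] (EFin \o (fun t => g t ^+ 2)) ->
  exists p : {poly R},
    mu.-integrable `[a, b] (EFin \o (fun t => (g t - p.[t]) ^+ 2)) /\
    \int[mu]_(t in `[a, b]) ((g t - p.[t]) ^+ 2) <= e.
Proof.
move=> ab e0 ig ig2; have mg := measurable_int_leb ig.
(* Three errors of [e / 9] each; the square of a sum of three terms is at most 3 times the sum of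
   their squares. *)
have e9 : 0 < e / 9 by rewrite divr_gt0.
have [N N0 [i1 I1]] := trunc_L2 e9 ig ig2.
have mab : measurable (`[a, b]%classic : set (measurableTypeR R)) by [].
have mt := measurable_trunc N mg.
have it : mu.-integrable `[a, b] (EFin \o (fun t => trunc N (g t))).
  apply: (@le_integrable_real _ _ _ _ _ _ (fun=> N)) => //.
    by move=> t _; apply: trunc_norm; exact: ltW.
  by apply: continuous_integrable_cc; apply: continuous_subspaceT => t; exact: cvg_cst.
have [h_ [ch ih hg]] := approximation_continuous_integrable mab (mu_itv_fin a b) it.
have d0 : 0 < e / 9 / (2 * N) by rewrite divr_gt0// mulr_gt0.
have [m Hm] : exists m, \int[mu]_(z in `[a, b]) `|trunc N (g z) - h_ m z| <= e / 9 / (2 * N).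
  have /fine_cvgP[_ /cvgrPdist_le /(_ _ d0) [m _ /(_ m (leqnn m))]] := hg.
  by rewrite /= sub0r normrN => /(le_trans (ler_norm _)) H; exists m.
pose h t := trunc N (h_ m t).
have ch' : continuous h.
  by move=> t; apply: (@continuous_comp _ _ _ (h_ m) (trunc N)); [exact: ch|exact: trunc_continuous].
have idh : mu.-integrable `[a, b] (EFin \o (fun z => trunc N (g z) - h_ m z)).
  by apply: integrable_subr => //; exact: ih.
have iN2 := integrable_scale (2 * N) mab (integrable_norm idh).
have mh : measurable_fun `[a, b] h.
  by apply: measurable_funTS; exact: continuous_measurable_fun.
have le2 t : (trunc N (g t) - h t) ^+ 2 <= 2 * N * `|trunc N (g t) - h_ m t|.
  have T1 : `|trunc N (g t) - h t| <= `|trunc N (g t) - h_ m t|.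
    rewrite -{1}[trunc N (g t)](@trunc_id N); last by apply: trunc_norm; exact: ltW.
    by apply: trunc_lip; exact: ltW.
  have T2 : `|trunc N (g t) - h t| <= 2 * N.
    apply: le_trans (ler_normB _ _) _; rewrite mulr2n mulrDl !mul1r.
    by apply: lerD; apply: trunc_norm; exact: ltW.
  by rewrite -real_normK ?num_real// expr2; apply: ler_pM.
have i2 : mu.-integrable `[a, b] (EFin \o (fun t => (trunc N (g t) - h t) ^+ 2)).
  apply: le_integrable_real iN2 => //.
    by apply: measurable_funX; exact: measurable_funB.
  by move=> t _; rewrite ger0_norm ?sqr_ge0//; exact: le2.
have I2 : \int[mu]_(t in `[a, b]) ((trunc N (g t) - h t) ^+ 2) <= e / 9.
  apply: (@le_trans _ _ (\int[mu]_(t in `[a, b]) (2 * N * `|trunc N (g t) - h_ m t|))).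
    by apply: le_Rintegral.
  rewrite RintegralZl//; last exact: integrable_norm idh.
  by rewrite mulrC -ler_pdivlMr ?mulr_gt0.
(* The cap 1 gives [c ^+ 2 <= c]. *)
pose c := Num.min 1 (e / 9 / (b - a + 1)).
have ba1 : 0 < b - a + 1 by rewrite ltr_wpDl// subr_ge0.
have c0 : 0 < c by rewrite lt_min ltr01 /= divr_gt0.
have [p Hp] := weierstrass ab ch' c0.
have ip : mu.-integrable `[a, b] (EFin \o (fun t => (h t - p.[t]) ^+ 2)).
  apply: continuous_integrable_cc; apply: continuous_subspaceT => t.
  by apply: cvgM; apply: cvgB; [exact: ch'|exact: continuous_horner|exact: ch'|exact: continuous_horner].
have I3 : \int[mu]_(t in `[a, b]) ((h t - p.[t]) ^+ 2) <= e / 9.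
  apply: (@le_trans _ _ (\int[mu]_(t in `[a, b]) c)).
    apply: le_Rintegral => //.
      by apply: continuous_integrable_cc; apply: continuous_subspaceT => t; exact: cvg_cst.
    move=> t; rewrite /= in_itv /= => tab.
    rewrite -real_normK ?num_real// expr2.
    apply: (@le_trans _ _ (c * 1)); last by rewrite mulr1.
    apply: ler_pM => //; [exact: Hp|apply: (le_trans (Hp t tab))].
    by rewrite /c ge_min lexx.
  rewrite Rintegral_cst// mu_itv//.
  apply: (@le_trans _ _ (e / 9 / (b - a + 1) * (b - a))).
    by rewrite ler_wpM2r ?subr_ge0// /c ge_min lexx orbT.
  by rewrite mulrAC ler_pdivrMr// ler_wpM2l ?(ltW e9)// lerDl.
exists p.
have i123 := integrable_scale 3 mab (integrable_addr mab i1 (integrable_addr mab i2 ip)).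
have le3 t : (g t - p.[t]) ^+ 2 <= 3 * ((g t - trunc N (g t)) ^+ 2 +
    ((trunc N (g t) - h t) ^+ 2 + (h t - p.[t]) ^+ 2)).
  move: (trunc N (g t)) (h t) p.[t] => x y z.
  have := sqr_ge0 (g t - x - (x - y)); have := sqr_ge0 (g t - x - (y - z)).
  have := sqr_ge0 (x - y - (y - z)); nra.
have i0 : mu.-integrable `[a, b] (EFin \o (fun t => (g t - p.[t]) ^+ 2)).
  apply: le_integrable_real i123 => //.
    apply: measurable_funX; apply: measurable_funB => //.
    by apply: measurable_funTS; apply: continuous_measurable_fun; exact: continuous_horner.
  by move=> t _; rewrite ger0_norm ?sqr_ge0//; exact: le3.
split=> //.
apply: le_trans (le_Rintegral mab i0 i123 _) _; first by move=> t _; exact: le3.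
rewrite RintegralZl//; last by do 2 apply: integrable_addr => //.
rewrite RintegralD//; last exact: integrable_addr.
by rewrite RintegralD//; lra.
Qed.

Lemma poly_w12 a b (f : R -> R) e : a <= b -> 0 < e -> w12 a b f ->
  exists p : {poly R},
   [/\ mu.-integrable `[a, b] (EFin \o (fun t => (f t - p.[t]) ^+ 2)),
    \int[mu]_(t in `[a, b]) ((f t - p.[t]) ^+ 2) <= e,
    mu.-integrable `[a, b] (EFin \o (fun t => (derive1 f t - (p^`()).[t]) ^+ 2)) &
    \int[mu]_(t in `[a, b]) ((derive1 f t - (p^`()).[t]) ^+ 2) <= e].
Proof.
move=> ab e0 [[ig fE] ig2].
set K := b - a + 1; have K0 : 0 < K by rewrite ltr_wpDl// subr_ge0.
(* [l] is the weight in [|y| <= l / 2 + y ^+ 2 / (2 * l)], which does the work of the Cauchy-Schwarz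
   inequality. If the squared L^2 error of the derivative is at most [l ^+ 2], the uniform error of
   the function is at most [l * K = Num.min 1 e / K], and its square integrates to at most [e]. *)
pose l := Num.min 1 e / K ^+ 2.
have l0 : 0 < l by rewrite divr_gt0 ?exprn_gt0// lt_min ltr01.
have E0 : 0 < Num.min e (l ^+ 2) by rewrite lt_min e0 exprn_gt0.
have [p0 [ip Ip]] := poly_L2 ab E0 ig ig2.
(* The derivative is approximated first; the constant makes [p] and [f] agree at [a]. *)
pose p := antideriv p0 + (f a - (antideriv p0).[a])%:P.
have dp : p^`() = p0 by rewrite /p derivD derivC addr0 antiderivK.
have pa : p.[a] = f a by rewrite /p hornerD hornerC addrC subrK.
have mab : measurable (`[a, b]%classic : set (measurableTypeR R)) by [].
have cp (r : {poly R}) : {within `[a, b], continuous (horner r)}.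
  by apply: continuous_subspaceT; exact: continuous_horner.
have pp : primitive_on a b (horner p) (horner p0).
  apply: C1_primitive => // x _; split; first exact: derivable_horner.
  by rewrite -derivE dp.
have [ip0 pE] := pp.
have id : mu.-integrable `[a, b] (EFin \o (fun t => derive1 f t - p0.[t])) by exact: integrable_subr.
have icst (c : R) : mu.-integrable `[a, b] (EFin \o (fun=> c)).
  by apply: continuous_integrable_cc; apply: continuous_subspaceT => t; exact: cvg_cst.
have ib : mu.-integrable `[a, b] (EFin \o (fun t => l / 2 + (2 * l)^-1 * (derive1 f t - p0.[t]) ^+ 2)).
  by apply: integrable_addr => //; exact: integrable_scale.
have B x : a <= x <= b -> `|f x - p.[x]| <= l * K.
  move=> /andP[ax xb]; rewrite fE ?ax// pE ?ax// pa opprD addrACA subrr add0r.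
  have igx := integrable_itvS (lexx a) xb ig.
  have ipx := integrable_itvS (lexx a) xb ip0.
  rewrite -RintegralB//.
  apply: le_trans (le_normr_Rintegral _ (integrable_itvS (lexx a) xb id)) _ => //.
  apply: (@le_trans _ _ (\int[mu]_(t in `[a, b]) `|derive1 f t - p0.[t]|)).
    apply: Rintegral_subset => //; last exact: integrable_norm id.
    by apply: subset_itvl; rewrite bnd_simp.
  apply: (@le_trans _ _ (\int[mu]_(t in `[a, b]) (l / 2 + (2 * l)^-1 * (derive1 f t - p0.[t]) ^+ 2))).
    apply: le_Rintegral => //; first exact: integrable_norm id.
    move=> t _; move: (derive1 f t - p0.[t]) => y.
    rewrite -[y ^+ 2]real_normK ?num_real//.
    rewrite -subr_ge0 [X in 0 <= X](_ : _ = (2 * l)^-1 * (l - `|y|) ^+ 2).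
      by rewrite mulr_ge0 ?sqr_ge0// invr_ge0 mulr_ge0// ltW.
    by field; rewrite gt_eqF.
  rewrite RintegralD//; last exact: integrable_scale.
  rewrite Rintegral_cst// mu_itv// RintegralZl//.
  apply: (@le_trans _ _ (l / 2 * (b - a) + (2 * l)^-1 * l ^+ 2)).
    have l2 : 0 <= (2 * l)^-1 by rewrite invr_ge0 mulr_ge0// ltW.
    rewrite lerD2l ler_wpM2l//.
    by apply: (le_trans Ip); rewrite ge_min lexx orbT.
  have -> : (2 * l)^-1 * l ^+ 2 = l / 2 by field; rewrite gt_eqF.
  have : 0 <= l * (b - a) by rewrite mulr_ge0 ?(ltW l0)// subr_ge0.
  by rewrite /K; nra.
have if2 : mu.-integrable `[a, b] (EFin \o (fun t => (f t - p.[t]) ^+ 2)).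
  apply: continuous_integrable_cc => x.
  have cf : {within `[a, b], continuous f}.
    exact: (primitive_continuous ab (conj ig fE)).
  by apply: cvgM; apply: cvgB; [exact: cf|exact: cp|exact: cf|exact: cp].
exists p; split=> //; rewrite ?dp//; last by apply: (le_trans Ip); rewrite ge_min lexx.
apply: (@le_trans _ _ (\int[mu]_(t in `[a, b]) ((l * K) ^+ 2))).
  apply: le_Rintegral => // t; rewrite /= in_itv /= => /B H.
  by rewrite -real_normK ?num_real// ler_pXn2r// nnegrE mulr_ge0// ltW.
rewrite Rintegral_cst// mu_itv//.
have -> : l * K = Num.min 1 e / K by rewrite /l; field; rewrite gt_eqF.
have m1 : Num.min 1 e <= 1 by rewrite ge_min lexx.
have me : Num.min 1 e <= e by rewrite ge_min lexx orbT.
have m0 : 0 < Num.min 1 e by rewrite lt_min ltr01.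
move: (Num.min 1 e) m1 me m0 => c m1 me m0.
apply: (@le_trans _ _ (c ^+ 2 / K ^+ 2 * K)).
  by rewrite expr_div_n ler_wpM2l ?divr_ge0 ?sqr_ge0// lerDl.
have -> : c ^+ 2 / K ^+ 2 * K = c ^+ 2 / K by field; rewrite gt_eqF.
rewrite ler_pdivrMr//; have K1 : 1 <= K by rewrite lerDr subr_ge0.
by nra.
Qed.

End Density.

(** * Change of variables *)

Section ChangeOfVariables.

Context {R : realType} d (T : measurableType d) (nu : {measure set T -> \bar R}).
Variables (c : R) (phi : T -> T).
Hypotheses (c0 : 0 < c) (mphi : measurable_fun setT phi).
Hypothesis scale_phi : forall X, measurable X -> (nu X = c%:E * nu (phi @^-1` X))%E.

Lemma measurable_preimage_map D : measurable D -> measurable (phi @^-1` D).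
Proof. by move=> mD; rewrite -[_ @^-1` _]setTI; exact: mphi. Qed.

Lemma measurable_fun_comp_map d' (T' : measurableType d') D (f : T -> T') : measurable D ->
  measurable_fun D f -> measurable_fun (phi @^-1` D) (f \o phi).
Proof.
move=> mD mf; apply: (measurable_comp mD _ mf); first by move=> _ [x Dx <-].
exact: measurable_funTS.
Qed.

(** [scale_phi] says that [nu] is [c] times its own image under [phi], which reduces the claim to
    integration against scaled and image measures. *)
Lemma ge0_integral_map D (f : T -> \bar R) : measurable D -> measurable_fun D f ->
  (forall x, D x -> 0 <= f x)%E ->
  (\int[nu]_(x in D) f x = c%:E * \int[nu]_(x in phi @^-1` D) f (phi x))%E.
Proof.
move=> mD mf f0; pose k : {nonneg R} := NngNum (ltW c0).
have mT : measurable_fun setT phi by exact: mphi.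
pose phim : {mfun T >-> T} := mfun_Sub (mem_set mT).
rewrite (eq_measure_integral (mscale k (pushforward nu phim))) => [|X mX _]; last first.
  by rewrite /mscale /pushforward /= scale_phi.
rewrite ge0_integral_mscale// ge0_integral_pushforward// => x.
by rewrite inE => /f0.
Qed.

Lemma integrable_map D (f : T -> R) : measurable D ->
  nu.-integrable D (EFin \o f) ->
  nu.-integrable (phi @^-1` D) (EFin \o (fun x => f (phi x))).
Proof.
move=> mD fi; have mf := measurable_int _ fi.
move/integrableP: fi => [_ fi]; apply/integrableP; split.
  exact: (measurable_fun_comp_map mD mf).
move: fi; rewrite (@ge0_integral_map _ (fun x => `|(EFin \o f) x|%E))//; last first.
  exact: measurableT_comp.
rewrite ltey => /negP h; rewrite ltey; apply/negP => /eqP e; apply: h.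
by move: e => /= ->; rewrite gt0_muley// lte_fin.
Qed.

Lemma Rintegral_map D (f : T -> R) : measurable D ->
  nu.-integrable D (EFin \o f) ->
  \int[nu]_(x in D) f x = c * \int[nu]_(x in phi @^-1` D) f (phi x).
Proof.
move=> mD fi; have mf := measurable_int _ fi.
have fi' := integrable_map mD fi.
rewrite /Rintegral integralE [X in _ = c * fine X]integralE.
rewrite (@ge0_integral_map _ ((EFin \o f)^\+)%E)//; last exact: measurable_funepos.
rewrite (@ge0_integral_map _ ((EFin \o f)^\-)%E)//; last exact: measurable_funeneg.
have hp : (\int[nu]_(x in phi @^-1` D) ((EFin \o (fun x => f (phi x)))^\+ x))%E \is a fin_num.
  by apply: integrable_fin_num; [exact: measurable_preimage_map|apply: integrable_funepos => //; exact: measurable_preimage_map].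
have hn : (\int[nu]_(x in phi @^-1` D) ((EFin \o (fun x => f (phi x)))^\- x))%E \is a fin_num.
  by apply: integrable_fin_num; [exact: measurable_preimage_map|apply: integrable_funeneg => //; exact: measurable_preimage_map].
have key (P N : \bar R) : P \is a fin_num -> N \is a fin_num ->
    fine (c%:E * P - c%:E * N)%E = c * fine (P - N)%E.
  by case: P N => [p||] [q||] //= _ _; rewrite mulrBr.
rewrite -[fun x0 => (f (phi x0))%:E]/((EFin \o f) \o phi).
rewrite -[EFin \o (fun x0 => f (phi x0))]/((EFin \o f) \o phi) in hp hn.
move: (EFin \o f) hp hn => F; rewrite funepos_comp funeneg_comp => hp hn.
exact: key.
Qed.

Lemma ae_map (P : T -> Prop) : {ae nu, forall x, P x} -> {ae nu, forall x, P (phi x)}.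
Proof.
move=> [N [mN N0 PN]]; exists (phi @^-1` N); split.
- exact: measurable_preimage_map.
- apply/eqP; move/eqP: N0; rewrite scale_phi// mule_eq0 => /orP[|//].
  by rewrite eqe gt_eqF.
- by move=> x /= nP; apply: PN.
Qed.

(** The right-hand side of [scale_phi] as a measure, so that the hypothesis can be verified by
    uniqueness of Lebesgue measure for affine maps of the line, and by uniqueness of the product
    measure for stretchings of the plane. *)
Lemma scaled_image_measure (k : R) : 0 < k -> exists m : {measure set T -> \bar R},
  forall X, m X = (k%:E * nu (phi @^-1` X))%E.
Proof.
move=> k0; have mT : measurable_fun setT phi by exact: mphi.
pose phim : {mfun T >-> T} := mfun_Sub (mem_set mT).
unshelve eexists (mscale (NngNum (ltW k0)) (pushforward nu phim)); first exact: mT.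
by [].
Qed.

End ChangeOfVariables.

Section Affine.

Context {R : realType}.
Local Notation mu := (@lebesgue_measure R).
Local Notation RR := (measurableTypeR R).

Lemma measurable_affine (a b : R) : @measurable_fun _ _ RR RR setT (fun t => a * t + b).
Proof.
have h : continuous (fun t : R => a * t + b).
  move=> t; apply: cvgD; last exact: cvg_cst.
  by apply: cvgM; [exact: cvg_cst|exact: cvg_id].
exact: continuous_measurable_fun.
Qed.

Lemma lebesgue_affine (a b : R) (X : set RR) : 0 < a -> measurable X ->
  (mu X = a%:E * mu ((fun t => (a * t + b)%R) @^-1` X))%E.
Proof.
move=> a0 mX; have [m mE] := @scaled_image_measure R _ RR mu (fun t => a * t + b) (measurable_affine a b) _ a0.
rewrite -mE; apply: lebesgue_measure_unique mX => Y [[x y] _ <-] /=; rewrite mE.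
have -> : (fun t => a * t + b) @^-1` `]x, y]%classic = `](x - b) / a, (y - b) / a]%classic.
  apply/seteqP; split => t /=; rewrite !in_itv /= ltr_pdivrMr// ler_pdivlMr// mulrC => /andP[? ?];
  by apply/andP; split; lra.
rewrite lebesgue_measure_itv [X in _ = (_ * X)%E]lebesgue_measure_itv /= !lte_fin.
have -> : ((x - b) / a < (y - b) / a) = (x < y) by rewrite ltr_pM2r ?invr_gt0// ltrD2r.
case: ifP => _; last by rewrite mule0.
by rewrite -!EFinB -EFinM; congr EFin; field; rewrite gt_eqF.
Qed.

End Affine.

(** * Estimates on an interval from one window and its integer translates *)

Section Windows.

Context {R : realType}.
Local Notation mu := (@lebesgue_measure R).
Local Notation RR := (measurableTypeR R).

Lemma ge0_fine_le (x y : \bar R) : (0 <= x)%E -> (x <= y)%E -> (y < +oo)%E -> fine x <= fine y.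
Proof. by case: x y => [x||] [y||]. Qed.

Lemma ge0_integral_window (D : set RR) a b (k : R) (Phi : R -> R) : measurable D ->
  mu.-integrable `[a, b] (EFin \o Phi) -> (forall t, a <= t <= b -> 0 <= Phi t) ->
  let f := (fun t => (Phi (t - k))%:E) \_ `[a + k, b + k] in
  [/\ measurable_fun (D : set RR) f, forall t, (0 <= f t)%E &
    (\int[mu]_(t in D) f t <= (\int[mu]_(t in `[a, b]) Phi t)%:E)%E].
Proof.
move=> mD iP P0 /=.
set W : set RR := `[a + k, b + k]%classic; set f := _ \_ _.
have mab : measurable (`[a, b]%classic : set RR) by exact: measurable_itv.
have mW : measurable W by exact: measurable_itv.
have WE : W = (fun t => 1 * t + - k) @^-1` `[a, b]%classic.
  by apply/seteqP; split => t; rewrite /W /= !in_itv /= mul1r => /andP[? ?]; apply/andP; split; lra.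
have mphi := @measurable_affine R 1 (- k).
have sc (X : set RR) : measurable X -> (mu X = 1%:E * mu ((fun t => (1 * t + - k)%R) @^-1` X))%E.
  exact: lebesgue_affine.
have iW : mu.-integrable W (fun t => (Phi (t - k))%:E).
  have := @integrable_map R _ RR mu 1 _ ltr01 mphi sc _ _ mab iP.
  by rewrite -WE; apply: eq_integrable => // t _ /=; rewrite mul1r.
have f0 t : (0 <= f t)%E.
  rewrite /f /patch; case: ifPn => // /set_mem; rewrite /W /= in_itv /= lee_fin => tW.
  by apply: P0; lra.
have mf (E : set RR) : measurable E -> measurable_fun E f.
  move=> mE; apply/(measurable_restrict _ mW mE).
  by apply: measurable_funS (measurable_int _ iW) => //; exact: subIsetr.
split=> //; first exact: mf.
have : (\int[mu]_(t in D) f t <= \int[mu]_(t in W) f t)%E.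
  rewrite /f -integral_mkcondr [leRHS](_ : _ = \int[mu]_(t in W) (Phi (t - k))%:E)%E.
    apply: ge0_subset_integral => //.
    - exact: measurableI.
    - exact: (measurable_int _ iW).
    - by move=> t Wt; move: (f0 t); rewrite /f /patch mem_set.
  by apply: eq_integral => t tW; rewrite /patch tW.
move=> /le_trans; apply.
rewrite (Rintegral_map ltr01 mphi sc mab iP) mul1r -WE /Rintegral fineK.
  rewrite le_eqVlt; apply/orP; left; apply/eqP; apply: eq_integral => t tW.
  by rewrite /f /patch tW mul1r.
apply: integrable_fin_num => //; move: iW; apply: eq_integrable => // t _ /=.
by rewrite mul1r.
Qed.

(** Fields are approximated on one window [[a, b]], whereas convergence is demanded on every
    interval [[a0, b0]]. Where the error [e] does not vanish, it is controlled at some integer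
    translate lying in the window, and only finitely many translates meet [[a0, b0]]. *)
Lemma window_bound (a0 b0 a b : R) : exists2 K : R, 0 <= K & forall e Phi : R -> R,
  measurable_fun (`[a0, b0]%classic : set RR) e ->
  mu.-integrable `[a, b] (EFin \o Phi) -> (forall t, a <= t <= b -> 0 <= Phi t) ->
  {ae mu, forall t, a0 <= t <= b0 -> e t != 0 ->
     exists2 k : int, a <= t - k%:~R <= b & e t ^+ 2 <= Phi (t - k%:~R)} ->
  \int[mu]_(t in `[a0, b0]) e t ^+ 2 <= K * \int[mu]_(t in `[a, b]) Phi t.
Proof.
(* An integer [k] with [a <= t - k <= b] and [t] in [[a0, b0]] lies between [a0 - b] and [b0 - a];
   [n] bounds the number of these integers. *)
pose m0 := Num.floor (a0 - b).
have [n nE] : exists n : nat, n = `|Num.floor (b0 - a) - m0|%N.+1 by eexists.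
exists n%:R => // e Phi me iP P0 eP.
pose D : set RR := `[a0, b0]%classic.
have mD : measurable D by exact: measurable_itv.
pose f (j : nat) := (fun t => (Phi (t - (m0 + j%:Z)%:~R))%:E) \_ `[a + (m0 + j%:Z)%:~R, b + (m0 + j%:Z)%:~R].
have fP j := @ge0_integral_window D a b (m0 + j%:Z)%:~R Phi mD iP P0.
have mf j : measurable_fun D (f j) by case: (fP j).
have f0 j t : (0 <= f j t)%E by case: (fP j) => _ + _; exact.
have fI j : (\int[mu]_(t in D) f j t <= (\int[mu]_(t in `[a, b]) Phi t)%:E)%E by case: (fP j).
have sumf0 t : (0 <= \sum_(j <- iota 0 n) f j t)%E by apply: sume_ge0.
have le1 : (\int[mu]_(t in D) (e t ^+ 2)%:E <= \int[mu]_(t in D) \sum_(j <- iota 0 n) f j t)%E.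
  apply: ae_ge0_le_integral => //.
  - by move=> t _; rewrite lee_fin sqr_ge0.
  - by apply/measurable_EFinP; exact: measurable_funX.
  - exact: emeasurable_sum.
  - apply: filterS eP => t te; rewrite /D /= in_itv /= => tD; have {}te := te tD.
    have [->|/te [k kab ek]] := eqVneq (e t) 0; first by rewrite expr0n.
    have [j jn kE] : exists2 j : nat, (j < n)%N & k = m0 + j%:Z.
      have k1 : m0 <= k by rewrite -(ler_int R); apply: le_trans (ge_floor _) _; lra.
      have k2 : k <= Num.floor (b0 - a) by rewrite floor_ge_int_tmp; lra.
      exists `|k - m0|%N.
        rewrite nE ltnS -lez_nat; lia.
      lia.
    rewrite (big_rem j)/=; last by rewrite mem_iota.
    apply: le_trans (leeDl _ _); last exact: sume_ge0.
    rewrite /f /patch mem_set; last by rewrite /= in_itv /= -kE; lra.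
    by rewrite lee_fin -kE.
have le2 : (\int[mu]_(t in D) (\sum_(j <- iota 0 n) f j t) <=
    (n%:R * \int[mu]_(t in `[a, b]) Phi t)%:E)%E.
  rewrite ge0_integral_sum//.
  apply: (@le_trans _ _ (\sum_(j <- iota 0 n) (\int[mu]_(t in `[a, b]) Phi t)%:E)%E); first by apply: lee_sum.
  by rewrite sumEFin big_const_seq count_predT size_iota iter_addr_0 mulr_natl.
have le3 := le_trans le1 le2; rewrite [leLHS]/Rintegral.
rewrite -[leRHS]/(fine (n%:R * \int[mu]_(t in `[a, b]) Phi t)%:E).
apply: ge0_fine_le le3 _ => //; last exact: ltry.
by apply: integral_ge0 => t _; rewrite lee_fin sqr_ge0.
Qed.

End Windows.

(** * Density of the fields supported in a chart *)

Section Fields.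

Context {R : realType} {n : nat} {M : manifold R n}.
Local Notation mu := (@lebesgue_measure R).

Lemma variation_continuous (q : loop M) eps u : variation q eps u -> continuous q.
Proof.
move=> [e0 [[su _] [_ u0]]] t.
have -> : q = u \o (fun t => (0 : R, t)) by apply/funext => s /=; rewrite u0.
apply: continuous_comp.
  by apply: (@Cr_continuous _ 0 _ _ setT (fun t => (0 : R, t))) => //;
    apply: Cr_pair; [exact: openT|exact: Cr_cst|exact: Cr_id].
by apply: su; rewrite /= normr0.
Qed.

Lemma variation_field_W12 (q : loop M) eps u : variation q eps u ->
  W12_field q (variation_field u).
Proof.
move=> vu; have cq := variation_continuous vu; case: vu => e0 [su [pu u0]].
pose U := [set z : R * R | `|z.1| < eps].
have U0 t : U (0, t) by rewrite /U /= normr0.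
split=> [t|]; last split=> [t|c a b ab cab].
- have [c dc] := dom_cover (q t).
  exists c, ('D_(1, 0) (coord c \o u) (0, t)); split=> //.
  by rewrite /variation_field (@smooth_to_tderiv _ _ _ _ U _ c)// ?u0.
- rewrite /variation_field -[RHS](@tderiv_near _ _ _ _ (u \o (fun z => (z.1, z.2 + 1)))).
    rewrite (@tderiv_affine _ _ _ _ _ u (fun z : R * R => (z.1, z.2 + 1)) _ _ (1, 0))//= => h.
    by apply: injective_projections => //=; rewrite addrA.
  have : nbhs (0 : R, t) U by apply: nbhs_open (U0 t); exact: open_cyl_set.
  by apply: filterS => -[r s] /= rU; rewrite pu.
- pose O := q @^-1` dom c.
  have oO : open O by apply: open_comp; [move=> ? _; exact: cq|exact: dom_open].
  move=> i; apply: (@Cr1_w12 _ _ _ O) => //.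
  apply: (@Cr_eq _ _ _ _ _ (fun t => 'D_(1, 0) (coord c \o u) (0 : R, t) 0 i)) => //.
    by move=> t Ot; rewrite /variation_field /tderiv asboolT// u0.
  apply: Cr_coord => //.
  apply: (@Cr_comp _ _ _ _ _ _ (U `&` u @^-1` dom c) (fun t : R => (0 : R, t)) (fun z => 'D_(1, 0) (coord c \o u) z)) => //.
  + exact: finite_basis_prod finite_basis_R finite_basis_R.
  + by move=> t Ot; split; rewrite //= u0.
  + by apply: Cr_pair => //; [exact: Cr_cst|exact: Cr_id].
  + exact: (smooth_on_diff _ (su.2 c)).
Qed.

Lemma W12_field_comb (q : loop M) a (x y : field M) :
  W12_field q x -> W12_field q y -> W12_field q (a *: x + y).
Proof.
move=> [tx [px wx]] [ty [py wy]]; split=> [t|]; last split=> [t|c l r lr clr i].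
- exact: is_tangent_linear.
- by rewrite [LHS]/= /GRing.add /GRing.scale /= px py.
- have e t : (a *: x + y) t c 0 i = a * x t c 0 i + y t c 0 i by rewrite !mxE.
  by rewrite (_ : (fun t => _) = (fun t => a * x t c 0 i + y t c 0 i));
    [exact: w12_comb (wx c l r lr clr i) (wy c l r lr clr i)|exact/funext].
Qed.

Lemma W12_field_mul (q : loop M) (w : R -> R) (x : field M) :
  smooth_on setT w -> (forall t, w (t + 1) = w t) ->
  W12_field q x -> W12_field q (fun t => w t *: x t).
Proof.
move=> sw pw [tx [px wx]]; split=> [t|]; last split=> [t|c l r lr clr i].
- have := is_tangent_linear (w t) (tx t) (is_tangent_linear (-1) (tx t) (tx t)).
  by rewrite scaleN1r addNr addr0.
- by rewrite px pw.
- rewrite (_ : (fun t => _) = (fun t => x t c 0 i * w t)); last first.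
    by apply/funext => t; rewrite !mxE mulrC.
  by apply: (@w12_mul _ _ _ setT _ w lr _ (sw 1%N) (wx c l r lr clr i)).2.
Qed.

Lemma family_variation (q : loop M) eps (u : R * R -> M) :
  smooth_family eps q u -> variation q eps u.
Proof. by move=> [e0 su pu u0]; split; [|split; [|split]]. Qed.

(** Two pieces at once because of polarization: the Hessians are known on the diagonal only, at
    variation fields. *)
Lemma two_pieces_variation (q : loop M) c eta c' eta' : smooth_loop q ->
  supported q c eta -> supported q c' eta' ->
  exists eps u, variation q eps u /\
    variation_field u = piece q c eta + piece q c' eta'.
Proof.
move=> sq se se'.
have fq := @constant_family _ _ M R q (finite_basis_R) sq.
pose id0 : {linear R -> R} := idfun.
have cid : continuous id0 by move=> x; exact: cvg_id.
have [eps [u [_ fu _ du]]] := family_add_piece finite_basis_R cid fq se.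
have [eps' [u' [_ fu' _ du']]] := family_add_piece finite_basis_R cid fu se'.
exists eps', u'; split; first exact: family_variation.
apply/funext => t; rewrite /variation_field du' du /= !scale1r.
rewrite (_ : tderiv _ _ _ = 0) ?add0r//.
rewrite -[fun z => q z.2]/(q \o snd) (@tderiv_affine _ _ _ _ _ q snd _ _ 0) => [|h].
  apply/funext => d; rewrite /tderiv; case: ifPn => // /asboolP dq.
  have /(derive_dirZ (0 : R) (0 : R)) := smooth_to_differentiable sq.1 (I : setT t) dq.
  by rewrite !scale0r.
by rewrite /= !scaler0.
Qed.

Lemma half_double (V : lmodType R) (p : V) : - 2^-1 *: (p + p) + (p + p) = p.
Proof.
rewrite -[X in X + X]scale1r -scalerDl scalerA -scalerDl.
by rewrite (_ : _ + _ = 1) ?scale1r//; field.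
Qed.

(** The double of the piece is a variation field; it is halved by a combination of the shape
    [a *: x + y], to which [W12_field_comb] applies. *)
Lemma piece_W12 (q : loop M) c eta : smooth_loop q -> supported q c eta ->
  W12_field q (piece q c eta).
Proof.
move=> sq se; have [eps [u [vu fu]]] := two_pieces_variation sq se se.
have := variation_field_W12 vu; rewrite fu => w.
have := W12_field_comb (- 2^-1) w w.
rewrite (_ : - 2^-1 *: _ + _ = piece q c eta)//.
exact: half_double.
Qed.

Lemma floor_near (t0 t : R) (k : int) : `|t - k%:~R - t0| < 2^-1 ->
  Num.floor (t - t0 + 2^-1) = k.
Proof.
rewrite ltr_norml => /andP[? ?]; apply: floor_def; rewrite intrD.
by apply/andP; split; lra.
Qed.

Lemma cos2piD (t : R) (k : int) : cos (2 * pi * (t + k%:~R)) = cos (2 * pi * t).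
Proof.
have h (s : R) : cos (2 * pi * (s + 1)) = cos (2 * pi * s).
  rewrite mulrDr mulr1 -[2 * pi]mulrC mulr_natr; exact: cosD2pi.
exact: (@periodic_int _ _ (fun s => cos (2 * pi * s)) h).
Qed.

(** The cosine serves as a smooth periodic substitute for the distance to the integers: after moving
    [x] to its nearest integer, it is strictly decreasing on half a period. *)
Lemma cos_window (d x : R) : 0 < d -> d <= 2^-1 ->
  cos (2 * pi * d) <= cos (2 * pi * x) -> exists k : int, `|x - k%:~R| <= d.
Proof.
move=> d0 d1 h; exists (Num.floor (x + 2^-1)); set k := Num.floor _.
have /andP[k1 k2] : k%:~R <= x + 2^-1 < k%:~R + 1.
  by have := floor_itv (x + 2^-1); rewrite intrD.
have ykE : cos (2 * pi * (x - k%:~R)) = cos (2 * pi * x).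
  by rewrite -mulrNz cos2piD.
have y1 : `|x - k%:~R| <= 2^-1 by rewrite ler_norml; lra.
rewrite -ykE -[leRHS]cos_norm normrM gtr0_norm ?mulr_gt0 ?pi_gt0// in h.
rewrite leNgt; apply/negP => dy.
have p0 := pi_gt0 R.
have hx : 2 * pi * d \in `[0, pi] by rewrite in_itv /=; nra.
have hy : 2 * pi * `|x - k%:~R| \in `[0, pi] by rewrite in_itv /=; nra.
have := ltr_cos hx hy; rewrite /= ltNge h /= => e.
have : 2 * pi * d < 2 * pi * `|x - k%:~R| by rewrite ltr_pM2l// mulr_gt0.
by rewrite -e.
Qed.

(** [p] is only meaningful near [t0]; each [t] is moved into the window of length 1 centred there.
    The jumps of the floor function sit at distance 1/2 from the translates of [t0], outside [K],
    where the cutoff [w] vanishes. *)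
Lemma periodize_supported (q : loop M) c (K : set R) (w : R -> R)
    (p : R -> 'rV[R]_n) t0 :
  closed K -> (forall t (m : int), K t -> K (t + m%:~R)) ->
  (forall t, K t -> dom c (q t)) -> (forall t, ~ K t -> w t = 0) ->
  smooth_on setT w -> (forall t, w (t + 1) = w t) ->
  (forall t, K t -> exists k : int, `|t - k%:~R - t0| < 2^-1) ->
  smooth_on setT p ->
  supported q c (fun t => w t *: p (t - (Num.floor (t - t0 + 2^-1))%:~R)).
Proof.
move=> cK pK dK w0 sw pw wK sp; split; last 1 first.
- by exists K; split=> // t /w0 ->; rewrite scale0r.
- move=> r; apply: Cr_loc => t _; have [Kt|nKt] := pselect (K t).
    have [k kt] := wK _ Kt.
    pose N := [set s : R | `|s - k%:~R - t0| < 2^-1].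
    have oN : open N.
      have -> : N = ball (t0 + k%:~R) 2^-1.
        apply/seteqP; split => s; rewrite /N /ball /= (_ : s - k%:~R - t0 = - (t0 + k%:~R - s)) ?normrN//; ring.
      exact: ball_open.
    exists N => //; apply: (@Cr_eq _ _ _ _ _ (fun s => w s *: p (s - k%:~R))) => //.
      by move=> s Ns; rewrite (floor_near Ns).
    apply: CrZ => //; first exact: Cr_sub (sw r).
    apply: (@Cr_comp R r R R 'rV[R]_n N setT (fun s : R => s - k%:~R) p) => //.
    - exact: finite_basis_R.
    - by apply: CrB => //; [exact: Cr_id|exact: Cr_cst].
  exists (~` K) => //; apply: (@Cr_eq _ _ _ _ _ (fun=> 0)) => //.
  - by rewrite openC.
  - by move=> s /w0 ->; rewrite scale0r.
  - exact: Cr_cst.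
- move=> t; rewrite pw; have -> : t + 1 - t0 + 2^-1 = t - t0 + 2^-1 + 1 by ring.
  by rewrite floorDrz ?rpred1// floor1 intrD; congr (_ *: p _); ring.
Qed.

End Fields.

Section Approximation.

Context {R : realType} {n : nat} {M : manifold R n}.
Local Notation mu := (@lebesgue_measure R).
Local Notation RR := (measurableTypeR R).

Lemma sqr_sum_le m (x : 'I_m -> R) : (\sum_i x i) ^+ 2 <= 2 ^+ m * \sum_i x i ^+ 2.
Proof.
elim: m x => [|m IH] x; first by rewrite !big_ord0 expr0n mulr0.
rewrite !big_ord_recr /=; have {IH} := IH (fun i => x (widen_ord (leqnSn m) i)).
set S := \sum_(i < m) _; set Q := \sum_(i < m) _ => h.
have p1 : 1 <= 2 ^+ m :> R by rewrite exprn_ege1// ler1n.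
rewrite [2 ^+ m.+1]exprS; set y := x ord_max.
have Q0 : 0 <= Q by apply: sumr_ge0 => i _; exact: sqr_ge0.
have y0 : 0 <= y ^+ 2 by exact: sqr_ge0.
have : (S + y) ^+ 2 <= 2 * S ^+ 2 + 2 * y ^+ 2.
  by have := sqr_ge0 (S - y); rewrite !expr2; nra.
nra.
Qed.

Lemma Rintegral_sum_le d (T : measurableType d) (nu : {measure set T -> \bar R})
    (D : set T) m (h : 'I_m -> T -> R) e : measurable D ->
  (forall l, nu.-integrable D (EFin \o h l)) ->
  (forall l, \int[nu]_(t in D) h l t <= e) ->
  nu.-integrable D (EFin \o (fun t => \sum_l h l t)) /\
  \int[nu]_(t in D) (\sum_l h l t) <= m%:R * e.
Proof.
move=> mD; elim: m h => [|m IH] h hi he.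
  rewrite (_ : (fun t => _) = cst 0); last by apply/funext => t; rewrite big_ord0.
  by split; [exact: integrable0|rewrite Rintegral_cst// !mul0r].
have [i1 i2] := IH (fun l => h (widen_ord (leqnSn m) l)) (fun l => hi _) (fun l => he _).
rewrite (_ : (fun t => _) = (fun t => \sum_(l < m) h (widen_ord (leqnSn m) l) t + h ord_max t)); last first.
  by apply/funext => t; rewrite big_ord_recr.
split; first exact: integrable_addr.
by rewrite RintegralD// -natr1 mulrDl mul1r lerD.
Qed.

Lemma pieceE (q : loop M) c eta t : dom c (q t) ->
  piece q c eta t = vec c (coord c (q t)) (eta t).
Proof.
by move=> dq; rewrite /piece; case: eqP => // ->; rewrite vec0//; exact: im_coord.
Qed.

Lemma vec_comp_sum (c c' : chart M) x (v : 'rV[R]_n) : dom c x -> dom c' x ->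
  vec c (coord c x) v c' =
  \sum_l v 0 l *: 'D_(delta_mx 0 l) (coord c' \o param c) (coord c x).
Proof.
move=> dx dx'; rewrite vec_trans ?coordK// {1}(row_sum_delta v) derive_dir_sum//.
by apply: transition_differentiable; [exact: im_coord|rewrite coordK].
Qed.

Lemma compact_bound (K : set R) (g : R -> R) : compact K ->
  (forall x, K x -> {for x, continuous g}) ->
  exists2 C, 0 < C & forall x, K x -> `|g x| <= C.
Proof.
move=> cK cg; have cgK : {within K, continuous g}.
  by apply: continuous_in_subspaceT => x; rewrite inE; exact: cg.
have /compact_bounded/pinfty_ex_gt0[C C0 gC] := continuous_compact cgK cK.
by exists C => // x Kx; apply: gC; exists x.
Qed.

Lemma w12_ae_derivable a b (f : R -> R) : w12 a b f ->
  {ae mu, forall x, a < x < b -> derivable f x 1}.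
Proof.
move=> [/ac_onP /primitive_ae h _].
by apply: filterS h => x hx /hx[].
Qed.

Lemma ae_int_translates (P : R -> Prop) : {ae mu, forall x, P x} ->
  {ae mu, forall x, forall k : int, P (x - k%:~R)}.
Proof.
move=> hP; have h (k : int) : {ae mu, forall x, P (x - k%:~R)}.
  have := ae_map ltr01 (@measurable_affine R 1 (- k%:~R)) (fun X mX => @lebesgue_affine R 1 (- k%:~R) X ltr01 mX) hP.
  by apply: filterS => x; rewrite mul1r.
have h1 := ae_foralln (fun m : nat => h m%:Z).
have h2 := ae_foralln (fun m : nat => h (Negz m)).
by apply: filterS2 h1 h2 => x h1x h2x [m|m].
Qed.

Lemma sqr_bound2 (C g g' x x' y y' : R) : `|g| <= C -> `|g'| <= C ->
  (g * (x' - y') + (x - y) * g') ^+ 2 <= 2 * C ^+ 2 * ((y - x) ^+ 2 + (y' - x') ^+ 2).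
Proof.
move=> h h'; have C0 : 0 <= C := le_trans (normr_ge0 g) h.
have s1 : g ^+ 2 <= C ^+ 2 by rewrite -real_normK ?num_real// ler_sqr ?nnegrE.
have s2 : g' ^+ 2 <= C ^+ 2 by rewrite -real_normK ?num_real// ler_sqr ?nnegrE.
set u := x' - y'; set v := x - y.
have -> : y - x = - v by rewrite opprB.
have -> : y' - x' = - u by rewrite opprB.
rewrite !sqrrN.
have := sqr_ge0 (g * u - v * g'); rewrite !expr2 in s1 s2 *.
have u0 : 0 <= u * u by rewrite -expr2 sqr_ge0.
have v0 : 0 <= v * v by rewrite -expr2 sqr_ge0.
have := ler_wpM2l u0 s1; have := ler_wpM2l v0 s2; nra.
Qed.

Lemma sqr_bound1 (C g x x' y y' : R) : `|g| <= C ->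
  (g * (x - y)) ^+ 2 <= 2 * C ^+ 2 * ((y - x) ^+ 2 + (y' - x') ^+ 2).
Proof.
move=> h; have := @sqr_bound2 C g 0 x' x y' y h.
rewrite normr0 => /(_ (le_trans (normr_ge0 g) h)).
by rewrite mulr0 addr0 [X in 2 * _ * X]addrC.
Qed.

Lemma derive1_sum_shift m (G F : 'I_m -> R -> R) (F' : 'I_m -> R) t k :
  (forall l, derivable (G l) t 1) ->
  (forall l, is_derive (t - k : R) (1 : R) (F l) (F' l)) ->
  derive1 (fun s => \sum_l G l s * F l (s - k)) t =
  \sum_l (G l t * F' l + F l (t - k) * derive1 (G l) t).
Proof.
move=> dG dF; rewrite derive1E.
have h l : is_derive (t : R) (1 : R) (G l * (fun s => F l (s - k)))
    (G l t * F' l + F l (t - k) * derive1 (G l) t).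
  have -> : F' l = F' l * 1 by rewrite mulr1.
  apply: is_deriveM; first by rewrite derive1E; exact/derivableP.
  apply: (@is_derive1_comp _ (F l) (fun s => s - k)) => //.
  by have := is_deriveB (is_derive_id (t : R) (1 : R)) (is_derive_cst k t 1); rewrite subr0.
have := @derive_val _ _ _ _ _ _ _ (is_derive_sum h).
rewrite (_ : \sum_(i < m) _ = (fun s => \sum_l G l s * F l (s - k)))//.
by apply/funext => s; rewrite fct_sumE.
Qed.

(** The components of [xi] in [c] are approximated by polynomials on a single window, periodized and
    multiplied by [w]. Convergence has to be shown in every chart [c'], where the error is a linear
    combination of the errors in [c]; its coefficients [G] are smooth on the overlap and bounded,
    with their derivatives, on a compact part of [K]. *)
Lemma approx_pieces (q : loop M) c (K : set R) (w : R -> R) t0 d (xi : field M) :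
  smooth_loop q -> closed K -> (forall t (m : int), K t -> K (t + m%:~R)) ->
  0 < d -> d < 4^-1 -> (forall t, K t -> exists k : int, `|t - t0 - k%:~R| <= d) ->
  (forall t, t0 - 2 * d <= t <= t0 + 2 * d -> dom c (q t)) ->
  smooth_on setT w -> (forall t, w (t + 1) = w t) -> (forall t, ~ K t -> w t = 0) ->
  W12_field q xi ->
  exists eta_ : nat -> R -> 'rV[R]_n, (forall m, supported q c (eta_ m)) /\
    W12_cvg q (fun m => piece q c (eta_ m)) (fun t => w t *: xi t).
Proof.
move=> sq cK pK d0 d1 Kw dc sw pw w0 wxi.
have [txi [pxi hxi]] := wxi.
(* Points of [K] are within [d] of a translate of [t0], so up to an integer they lie in the interior
   of this window, away from its end points, where derivatives are not controlled. *)
set a := t0 - 2 * d in dc; set b := t0 + 2 * d in dc.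
have ab : a <= b by rewrite /a /b; lra.
have cq : continuous q by move=> t; exact: sq.1.1.
have dK t : K t -> dom c (q t).
  move=> /Kw[k tk]; rewrite (_ : t = (t - k%:~R) + k%:~R); last by ring.
  by rewrite (periodic_int sq.2); apply: dc; rewrite /a /b; move: tk; rewrite ler_norml; lra.
pose f l t := xi t c 0 l.
have wf l : w12 a b (f l) := hxi c a b ab dc l.
have /choice[p hp] : forall ml : nat * 'I_n, exists p : {poly R},
   [/\ mu.-integrable `[a, b] (EFin \o (fun t => (f ml.2 t - p.[t]) ^+ 2)),
    \int[mu]_(t in `[a, b]) ((f ml.2 t - p.[t]) ^+ 2) <= ml.1.+1%:R^-1,
    mu.-integrable `[a, b] (EFin \o (fun t => (derive1 (f ml.2) t - (p^`()).[t]) ^+ 2)) &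
    \int[mu]_(t in `[a, b]) ((derive1 (f ml.2) t - (p^`()).[t]) ^+ 2) <= ml.1.+1%:R^-1].
  by move=> [m l]; apply: poly_w12 => //; rewrite invr_gt0 ltr0n.
pose P m t : 'rV[R]_n := \row_l (p (m, l)).[t].
have sP m : smooth_on setT (P m).
  move=> r; apply: Cr_row => [|l]; first exact: openT.
  apply: (@Cr_eq _ _ _ _ _ (fun t => (p (m, l)).[t])); first exact: openT.
    by move=> t _; rewrite mxE.
  exact: smooth_horner.
pose fl t := Num.floor (t - t0 + 2^-1).
exists (fun m t => w t *: P m (t - (fl t)%:~R)).
have Kw' t : K t -> exists k : int, `|t - k%:~R - t0| < 2^-1.
  by move=> /Kw[k tk]; exists k; rewrite addrAC; apply: le_lt_trans tk _; lra.
have sup m := periodize_supported cK pK dK w0 sw pw Kw' (sP m).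
split=> // c' a0 b0 ab0 dc' i e.
pose O := q @^-1` (dom c `&` dom c').
have oO : open O.
  by apply: open_comp; [move=> ? _; exact: cq|apply: openI; exact: dom_open].
(* The coefficients of the change from [c] to [c'] along [q], multiplied by the cutoff. *)
pose G (l : 'I_n) t := w t * ('D_(delta_mx 0 l) (coord c' \o param c) (coord c (q t)) 0 i).
have sG l r : Cr r O (G l).
  apply: CrM => //; first exact: Cr_sub (@subsetT _ _) (sw r).
  apply: Cr_coord => //.
  apply: (@Cr_comp R r R 'rV[R]_n 'rV[R]_n O (coord c @` (dom c `&` dom c')) (coord c \o q)
     (fun y => 'D_(delta_mx 0 l) (coord c' \o param c) y)) => //.
  - exact: finite_basis_rV.
  - by move=> x Ox; exists (q x).
  - by apply: Cr_sub (sq.1.2 c r) => x [].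
  - exact: (smooth_on_diff _ (@transition_smooth _ _ M c c')).
pose K0 := K `&` `[a0, b0].
have cK0 : compact K0.
  by rewrite /K0 setIC; apply: compact_closedI => //; exact: segment_compact.
have K0O : K0 `<=` O.
  by move=> t [Kt]; rewrite /= in_itv /= => tab; split; [exact: dK|exact: dc'].
have [C0 C00 GC] : exists2 C0, 0 < C0 & forall l t, K0 t -> `|G l t| <= C0 /\ `|derive1 (G l) t| <= C0.
  have /choice[C hC] : forall l, exists C, 0 < C /\ forall t, K0 t -> `|G l t| <= C /\ `|derive1 (G l) t| <= C.
    move=> l.
    have [C1 C10 h1] : exists2 C, 0 < C & forall t, K0 t -> `|G l t| <= C.
      by apply: compact_bound => // t /K0O; exact: (Cr_continuous (sG l 0%N)).
    have [C2 C20 h2] : exists2 C, 0 < C & forall t, K0 t -> `|derive1 (G l) t| <= C.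
      apply: compact_bound => // t /K0O Ot.
      have -> : derive1 (G l) = 'D_1 (G l) by apply/funext => s; rewrite derive1E.
      by apply: (@Cr_continuous _ 0 _ _ O) => //; exact: (sG l 1%N).2.
    exists (C1 + C2); split=> [|t Kt]; first exact: addr_gt0.
    by split; [apply: le_trans (h1 _ Kt) _|apply: le_trans (h2 _ Kt) _]; lra.
  exists (1 + \sum_l C l).
    by rewrite ltr_wpDr// sumr_ge0// => l _; rewrite ltW//; case: (hC l).
  move=> l t Kt; have [_ /(_ _ Kt)[h1 h2]] := hC l.
  have Cle : C l <= 1 + \sum_l C l.
    rewrite (bigD1 l)//= addrCA lerDl addr_ge0// sumr_ge0// => l' _.
    by rewrite ltW//; case: (hC l').
  by split; [exact: le_trans h1 Cle|exact: le_trans h2 Cle].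
have eG m t k : O t -> `|t - k%:~R - t0| < 2^-1 ->
  e m t = \sum_l G l t * ((p (m, l)).[t - k%:~R] - f l (t - k%:~R)).
  move=> [dt dt'] tk; rewrite /e pieceE// /fl (floor_near tk).
  rewrite (is_tangentP dt (txi t)) -[w t *: vec _ _ _]vecZ; last exact: im_coord.
  rewrite !vec_comp_sum// !summxE -sumrB; apply: eq_bigr => l _.
  rewrite !mxE /f /G /= -mulrNz (periodic_int pxi) mulrNz; ring.
have e0 m t : ~ K t -> e m t = 0.
  by move=> /w0 wt; rewrite /e /piece wt !scale0r eqxx !mxE subrr.
(* The common majorant, on the window, of the squares of the error and of its derivative: [2 ^+ n]
   comes from squaring a sum of [n] terms, and [2 * C0 ^+ 2] from the product rule. *)
pose Phi m t := 2 ^+ n * (2 * C0 ^+ 2) * \sum_l ((f l t - (p (m, l)).[t]) ^+ 2 + (derive1 (f l) t - ((p (m, l))^`()).[t]) ^+ 2).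
have [iPhi PhiC] : (forall m, mu.-integrable `[a, b] (EFin \o Phi m)) /\
   forall m, \int[mu]_(t in `[a, b]) Phi m t <= 2 ^+ n * (2 * C0 ^+ 2) * (n%:R * 2) * m.+1%:R^-1.
  have mab : measurable (`[a, b]%classic : set RR) by exact: measurable_itv.
  have h m := @Rintegral_sum_le _ RR mu `[a, b]%classic n
    (fun l t => (f l t - (p (m, l)).[t]) ^+ 2 + (derive1 (f l) t - ((p (m, l))^`()).[t]) ^+ 2) (2 * m.+1%:R^-1) mab.
  have {}h m : mu.-integrable `[a, b] (EFin \o (fun t => \sum_l ((f l t - (p (m, l)).[t]) ^+ 2 + (derive1 (f l) t - ((p (m, l))^`()).[t]) ^+ 2))) /\
    \int[mu]_(t in `[a, b]) (\sum_l ((f l t - (p (m, l)).[t]) ^+ 2 + (derive1 (f l) t - ((p (m, l))^`()).[t]) ^+ 2)) <= n%:R * (2 * m.+1%:R^-1).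
    apply: h => l; have [h1 h2 h3 h4] := hp (m, l); first exact: integrable_addr.
    rewrite (RintegralD mab h1 h3).
    apply: le_trans (lerD h2 h4) _.
    by rewrite -mulr2n mulr_natl.
  split=> m; have [h1 h2] := h m; first exact: integrable_scale.
  rewrite /Phi RintegralZl//; apply: (le_trans (ler_wpM2l _ h2)); last by rewrite !mulrA.
  by rewrite mulr_ge0 ?exprn_ge0// mulr_ge0// sqr_ge0.
have Phi0 m t : 0 <= Phi m t.
  rewrite /Phi mulr_ge0//; first by rewrite mulr_ge0 ?exprn_ge0// mulr_ge0// sqr_ge0.
  by apply: sumr_ge0 => l _; rewrite addr_ge0// sqr_ge0.
have we m : w12 a0 b0 (e m).
  have wp := (piece_W12 sq (sup m)).2.2 c' a0 b0 ab0 dc' i.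
  have wx := (W12_field_mul sw pw wxi).2.2 c' a0 b0 ab0 dc' i.
  apply: (w12_eq ab0 _ (w12_comb (-1) ab0 wx wp)) => t _.
  by rewrite /e mulN1r addrC.
have me m : measurable_fun (`[a0, b0]%classic : set RR) (e m).
  have [/ac_onP /primitive_continuous h _] := we m.
  by apply: subspace_continuous_measurable_fun => //; exact: h.
have me' m : measurable_fun (`[a0, b0]%classic : set RR) (derive1 (e m)).
  by have [[h _] _] := we m; exact: measurable_int_fun h.
have [C2 C20 wb] := window_bound a0 b0 a b.
pose C3 := C2 * (2 ^+ n * (2 * C0 ^+ 2) * (n%:R * 2)).
have main (h : nat -> R -> R) : (forall m, measurable_fun (`[a0, b0]%classic : set RR) (h m)) ->
  (forall m, {ae mu, forall t, a0 <= t <= b0 -> h m t != 0 ->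
     exists2 k : int, a <= t - k%:~R <= b & h m t ^+ 2 <= Phi m (t - k%:~R)}) ->
  (fun m => \int[mu]_(t in `[a0, b0]) (h m t) ^+ 2) @ \oo --> (0 : R).
  move=> mh hP.
  have hb m : \int[mu]_(t in `[a0, b0]) (h m t) ^+ 2 <= C3 * m.+1%:R^-1.
    apply: le_trans (wb (h m) (Phi m) (mh m) (iPhi m) (fun t _ => Phi0 m t) (hP m)) _.
    by rewrite /C3 -mulrA ler_wpM2l.
  have : (fun m : nat => C3 * m.+1%:R^-1) @ \oo --> (0 : R).
    rewrite -(mulr0 C3); apply: cvgM; first exact: cvg_cst.
    exact: cvg_harmonic.
  apply: squeeze_cvgr; last exact: cvg_cst.
  apply: nearW => m; rewrite hb andbT.
  by apply: Rintegral_ge0 => t _; exact: sqr_ge0.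
have Kab t : K t -> exists2 k : int, `|t - k%:~R - t0| < 2^-1 & a < t - k%:~R < b.
  by move=> /Kw[k]; rewrite ler_norml => tk; exists k; rewrite ?ltr_norml /a /b; lra.
split; apply: main => // m.
  apply/aeW => t tab ne.
  have Kt : K t by apply: contrapT => /(e0 m t) z; rewrite z eqxx in ne.
  have [k k1 k2] := Kab t Kt; exists k; first by lra.
  have Ot : O t by apply: K0O; split=> //; rewrite /= in_itv.
  rewrite (eG _ _ _ Ot k1); apply: le_trans (sqr_sum_le _) _.
  rewrite /Phi -mulrA ler_wpM2l ?exprn_ge0// mulr_sumr ler_sum// => l _.
  have [G0 _] := GC l t (conj Kt tab).
  exact: sqr_bound1.
(* The product rule for the error at [t] needs [xi] to be differentiable at the translate [t - k].
   The exceptional sets for all integers [k] together are still null. *)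
have aed : {ae mu, forall x, forall l, a < x < b -> derivable (f l) x 1}.
  by apply: filter_forall => l; exact: w12_ae_derivable.
have := ae_int_translates aed; apply: filterS => t dt tab ne.
have Kt : K t.
  apply: contrapT => nKt; case/eqP: ne.
  have -> : 0 = derive1 (fun=> 0 : R) t by rewrite derive1_cst.
  rewrite !derive1E; apply: near_eq_derive.
  have : nbhs t (~` K) by apply: nbhs_open => //; rewrite openC.
  by apply: filterS => s; exact: e0.
have [k k1 k2] := Kab t Kt; exists k; first by lra.
have Ot : O t by apply: K0O; split=> //; rewrite /= in_itv.
have K0t : K0 t by split=> //; rewrite /= in_itv.
have -> : derive1 (e m) t = \sum_l (G l t * (((p (m, l))^`()).[t - k%:~R] - derive1 (f l) (t - k%:~R)) +
    ((p (m, l)).[t - k%:~R] - f l (t - k%:~R)) * derive1 (G l) t).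
  have dG l : derivable (G l) t 1 by apply: diff_derivable; exact: (sG l 1%N).1.
  have dF l : is_derive (t - k%:~R : R) (1 : R) (fun s => (p (m, l)).[s] - f l s)
      (((p (m, l))^`()).[t - k%:~R] - derive1 (f l) (t - k%:~R)).
    apply: is_deriveB; rewrite derive1E; apply/derivableP; exact: dt.
  rewrite -(derive1_sum_shift dG dF) !derive1E; apply: near_eq_derive.
  have nO : nbhs t O by exact: nbhs_open.
  have nk : \forall s \near t, `|s - k%:~R - t0| < 2^-1.
    have : {for t, continuous (fun s : R => `|s - k%:~R - t0|)}.
      apply: continuous_comp (@norm_continuous _ _ _).
      by apply: cvgB; [apply: cvgB; [exact: cvg_id|exact: cvg_cst]|exact: cvg_cst].
    by move=> /(_ _ (lt_nbhsl k1)).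
  by apply: filterS2 nO nk => s Os sk; rewrite (eG _ _ _ Os sk).
apply: le_trans (sqr_sum_le _) _.
rewrite /Phi -mulrA ler_wpM2l ?exprn_ge0// mulr_sumr ler_sum// => l _.
have [G0 G1] := GC l t K0t.
exact: sqr_bound2.
Qed.

End Approximation.

(** * A partition of unity on the circle *)

Section Vanishing.

Context {R : realType} {n : nat} {M : manifold R n}.

Lemma W12_field0 (q : loop M) : (forall t, exists c : chart M, dom c (q t)) -> W12_field q 0.
Proof.
move=> dq; split=> [t|]; last split=> // c a b ab _ i.
  have [c dc] := dq t; exists c, 0; split=> //.
  by rewrite vec0//; exact: im_coord.
rewrite (_ : (fun t => _) = fun=> 0); last by apply/funext => t; rewrite mxE.
by apply: (@Cr1_w12 _ _ _ setT) => //; exact: Cr_cst.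
Qed.

(** For [0 < d < 1/2] this is positive exactly at distance less than [d] from the integer translates
    of [t0]; smoothness and periodicity come from the cosine without any patching. *)
Definition periodic_bump (t0 d t : R) : R := flat_bump 0 (cos (2 * pi * (t - t0)) - cos (2 * pi * d)).

Lemma smooth_periodic_bump t0 d : smooth_on setT (periodic_bump t0 d).
Proof.
move=> r; apply: (@Cr_comp R r R R R setT setT
  (fun t => cos (2 * pi * (t - t0)) - cos (2 * pi * d)) (flat_bump 0)) => //.
- exact: finite_basis_R.
- exact: openT.
- apply: CrB; [exact: openT| |exact: Cr_cst].
  apply: (@Cr_comp R r R R R setT setT (fun t => 2 * pi * (t - t0)) cos) => //.
  + exact: finite_basis_R.
  + exact: openT.
  + apply: CrM; [exact: openT|exact: Cr_cst|].
    by apply: CrB; [exact: openT|exact: Cr_id|exact: Cr_cst].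
  + by have [_ sc] := @smooth_sin_cos R; exact: sc.
- exact: smooth_flat_bump.
Qed.

Lemma periodic_bump_shift t0 d t : periodic_bump t0 d (t + 1) = periodic_bump t0 d t.
Proof.
rewrite /periodic_bump -(cos2piD (t - t0) 1); congr (flat_bump 0 (cos _ - _)).
by rewrite rmorph1; ring.
Qed.

Lemma periodic_bump_ge0 t0 d t : 0 <= periodic_bump t0 d t.
Proof.
rewrite /periodic_bump /flat_bump; case: ifP => // x0.
by rewrite mulr_ge0// ?expR_ge0// invr_ge0 exprn_ge0// ltW.
Qed.

Lemma periodic_bump_off t0 d t : ~ (cos (2 * pi * d) <= cos (2 * pi * (t - t0))) -> periodic_bump t0 d t = 0.
Proof.
move=> /negP; rewrite -ltNge => h; rewrite /periodic_bump /flat_bump ifF//.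
by apply/negbTE; rewrite -leNgt subr_le0 ltW.
Qed.

Lemma periodic_bump_center t0 d : 0 < d -> d < 4^-1 -> 0 < periodic_bump t0 d t0.
Proof.
move=> d0 d1; rewrite /periodic_bump subrr mulr0 cos0 /flat_bump.
have p0 := pi_gt0 R.
have hx : 2 * pi * d \in `[0, pi] by rewrite in_itv /=; nra.
have hy : (0 : R) \in `[0, pi] by rewrite in_itv /= lexx ltW.
have := ltr_cos hy hx; rewrite /= cos0 => e.
have h : cos (2 * pi * d) < 1 by rewrite e mulr_gt0// mulr_gt0.
by rewrite subr_gt0 h expr0 invr1 mul1r expR_gt0.
Qed.

(** A finite partition of unity [w] splits [x] into fields carried by one chart each, and
    [approx_pieces] makes each of these a limit of pieces, on which [l] vanishes. *)
Lemma vanishing_on_pieces (q : loop M) (l : field M -> R) : smooth_loop q ->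
  (forall a x y, W12_field q x -> W12_field q y -> l (a *: x + y) = a * l x + l y) ->
  (forall x_ x, (forall m, W12_field q (x_ m)) -> W12_field q x ->
     W12_cvg q x_ x -> (fun m => l (x_ m)) @ \oo --> l x) ->
  (forall c eta, supported q c eta -> l (piece q c eta) = 0) ->
  forall x, W12_field q x -> l x = 0.
Proof.
move=> sq ll lc lp x wx.
have cq : continuous q by move=> t; exact: sq.1.1.
have /choice[cd hcd] : forall t0 : R, exists cd : chart M * R, [/\ 0 < cd.2, cd.2 < 4^-1 &
    forall t, t0 - 2 * cd.2 <= t <= t0 + 2 * cd.2 -> dom cd.1 (q t)].
  move=> t0; have [c dc] := dom_cover (q t0).
  have : nbhs t0 (q @^-1` dom c) by apply: cq; exact: near_dom.
  move=> /nbhs_ballP[e /= e0 he].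
  (* The window has half-width twice the radius, at most [e / 2], and so stays in the chart; 1/8
     ensures the bound 1/4 on the radius. *)
  exists (c, Num.min (e / 4) 8^-1) => /=; split.
  - by rewrite lt_min divr_gt0//= invr_gt0.
  - by rewrite gt_min; apply/orP; right; lra.
  move=> t tt0; apply: he; rewrite /ball /= ltr_norml.
  have : Num.min (e / 4) 8^-1 <= e / 4 by rewrite ge_min lexx.
  by move: tt0 => /andP[]; move: (Num.min _ _) => z *; apply/andP; split; lra.
pose rho t0 := periodic_bump t0 (cd t0).2.
have crho t0 : continuous (rho t0).
  by move=> t; apply: (Cr_continuous (@smooth_periodic_bump t0 (cd t0).2 0)).
have [s sP] : exists s : seq R, forall t, 0 <= t <= 1 -> exists2 t0, t0 \in s & 0 < rho t0 t.
  have cK := @segment_compact R 0 1; rewrite compact_cover in cK.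
  have [|t /= t01|s _ hs] := cK R setT (fun t0 => [set t | 0 < rho t0 t]).
  - move=> t0 _; apply: (@open_comp _ _ (rho t0) [set y | 0 < y]); last exact: open_gt.
    by move=> t _; exact: crho.
  - by exists t => //=; have [? ? _] := hcd t; exact: periodic_bump_center.
  exists (finmap.enum_fset s) => t t01; have [|t0 /= t0s r0] := hs t; first by rewrite /= in_itv.
  by exists t0.
pose S t := \sum_(t0 <- s) rho t0 t.
have Sper t : S (t + 1) = S t by apply: eq_bigr => t0 _; exact: periodic_bump_shift.
have S0 t : 0 < S t.
  rewrite -(periodic_int Sper t (- Num.floor t)).
  have [|t0 t0s r0] := sP (t + (- Num.floor t)%:~R).
    by have := floor_itv t; rewrite intrD mulrNz /=; lra.
  by rewrite /S (big_rem t0)//= ltr_pwDl// sumr_ge0// => t1 _; exact: periodic_bump_ge0.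
pose w t0 t := rho t0 t / S t.
have sw t0 : smooth_on setT (w t0).
  move=> r; apply: CrM; [exact: openT|exact: smooth_periodic_bump|].
  apply: Cr_inv; [exact: openT|by move=> t _; rewrite gt_eqF|].
  by apply: Cr_sum; [exact: openT|move=> t1; exact: smooth_periodic_bump].
have pw t0 t : w t0 (t + 1) = w t0 t by rewrite /w Sper /rho periodic_bump_shift.
have wsum t : \sum_(t0 <- s) w t0 t = 1.
  by rewrite /w -mulr_suml -/(S t) mulfV// gt_eqF.
have l0 : l 0 = 0.
  have := ll (-1) x x wx wx; rewrite scaleN1r addNr => ->.
  by rewrite mulN1r addNr.
have lw t0 : l (fun t => w t0 t *: x t) = 0.
  have [d0 d1 dc] := hcd t0.
  pose K := [set t : R | cos (2 * pi * (cd t0).2) <= cos (2 * pi * (t - t0))].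
  have cK : closed K.
    apply: (@closed_comp _ _ (fun t : R => cos (2 * pi * (t - t0))) [set y | cos (2 * pi * (cd t0).2) <= y]); last exact: closed_ge.
    move=> t _; apply: continuous_comp; last exact: continuous_cos.
    by apply: cvgM; [exact: cvg_cst|apply: cvgB; [exact: cvg_id|exact: cvg_cst]].
  have pK t (m : int) : K t -> K (t + m%:~R).
    by rewrite /K /= addrAC cos2piD.
  have Kw t : K t -> exists k : int, `|t - t0 - k%:~R| <= (cd t0).2.
    by apply: cos_window => //; lra.
  have w0 t : ~ K t -> w t0 t = 0 by move=> /periodic_bump_off; rewrite /w /rho => ->; rewrite mul0r.
  have [eta_ [se ce]] := approx_pieces sq cK pK d0 d1 Kw dc (sw t0) (pw t0) w0 wx.
  have := lc _ _ (fun m => piece_W12 sq (se m)) (W12_field_mul (sw t0) (pw t0) wx) ce.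
  rewrite (_ : (fun m => _) = fun=> 0); last by apply/funext => m; exact: lp.
  by move=> h; apply: (cvg_unique _ h); [exact: norm_hausdorff|exact: cvg_cst].
have hs (s' : seq R) : W12_field q (\sum_(t0 <- s') (fun t => w t0 t *: x t)) /\
    l (\sum_(t0 <- s') (fun t => w t0 t *: x t)) = 0.
  elim: s' => [|t0 s' [IH1 IH2]]; first by rewrite big_nil; split=> //; apply: W12_field0 => t; exact: dom_cover.
  rewrite big_cons -[X in X + _]scale1r.
  have wt := W12_field_mul (sw t0) (pw t0) wx.
  by split; [exact: W12_field_comb|rewrite ll// lw IH2 mulr0 addr0].
rewrite -[RHS](hs s).2; congr l; apply/funext => t; rewrite fct_sumE -scaler_suml.
by rewrite wsum scale1r.
Qed.

End Vanishing.

(** * Mixed second differences *)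

Section MixedDifferences.

Context {R : realType}.

Lemma mvt_dir (V : normedModType R) (F : V -> R) (x v : V) :
  (forall y, 0 <= y <= 1 -> differentiable F (x + y *: v)) ->
  exists2 c, 0 <= c <= 1 & F (x + v) - F x = 'D_v F (x + c *: v).
Proof.
move=> dF; pose f (y : R) := F (x + y *: v).
have df (y : R) : 0 <= y <= 1 -> is_derive (y : R) (1 : R) f ('D_v F (x + y *: v)).
  move=> y01.
  have e := @derive_affine _ _ _ _ F (fun y : R => x + y *: v) y 1 v.
  have h0 (h : R) : x + (h *: 1 + y) *: v = h *: v + (x + y *: v).
    by rewrite scalerDl addrCA /= -[h *: 1]/(h * 1) mulr1.
  apply: DeriveDef; last by rewrite -(e h0).
  apply: diff_derivable.
  apply: (@differentiable_comp _ _ _ _ (fun y : R => x + y *: v) F); last exact: dF.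
  apply: differentiableD; first exact: differentiable_cst.
  by apply: differentiable_scale; [exact: ((@Cr_id R 1 R setT).1 y I)|exact: differentiable_cst].
have [|| c c01 ce] := @MVT_segment R f (fun y => 'D_v F (x + y *: v)) 0 1 ler01.
- by move=> y; rewrite in_itv /= => /andP[y0 y1]; apply: df; rewrite !ltW.
- apply: derivable_within_continuous => y; rewrite in_itv /= => y01.
  by have := df y y01; case.
exists c; first by move: c01; rewrite in_itv.
by move: ce; rewrite subr0 mulr1 /f scale1r scale0r addr0.
Qed.

Lemma scale_comb_sub (r a b : R) (x y : (R : normedModType R)) (x' y' : R) :
  r * (a *: x + b *: y) - r * (a * x' + b * y') = r * (a * (x - x') + b * (y - y')).
Proof. by rewrite -![_ *: _]/(_ * _) -mulrBr; congr (_ * _); rewrite !mulrBr; ring. Qed.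

Lemma comb_bound (r a b x y e : R) : `|x| <= e -> `|y| <= e ->
  `|r * (a * x + b * y)| <= e * `|r| * (`|a| + `|b|).
Proof.
move=> q1 q2.
rewrite normrM (_ : e * `|r| * (`|a| + `|b|) = `|r| * (`|a| * e + `|b| * e)); last by ring.
rewrite ler_wpM2l//; apply: le_trans (ler_normD _ _) _; rewrite !normrM.
by rewrite lerD// ler_wpM2l.
Qed.

Section Pointwise.

Context (Z : normedModType R) (U : set ((((R * R) * R) * Z)%type : normedModType R))
  (f : ((((R * R) * R) * Z)%type : normedModType R) -> R) (K : set Z).
Hypotheses (oU : open U) (f2 : Cr 2 U f) (cK : compact K).
Hypothesis KU : forall z, K z -> U (((0, 0), 0), z).

Local Notation VV := ((((R * R) * R) * Z)%type : normedModType R).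
Let e1 : VV := (((1, 0), 0), 0).
Let e2 : VV := (((0, 1), 0), 0).
Let e3 : VV := (((0, 0), 1), 0).
Let fr : VV -> R := 'D_e3 f.

(** Two mean value theorems: one in [r] for the increment of [f] under the shift by [p], one in [p]
    for the partial derivative [fr]. The mixed difference thereby becomes a mixed second derivative
    at an intermediate point, and continuity of these derivatives near the compact set [K] makes the
    error uniform in [z]. *)
Lemma mixed_pointwise (e : R) : 0 < e -> exists2 d, 0 < d & forall (p : R * R) (r : R) z,
  `|p| < d -> `|r| < d -> K z -> U ((p, r), z) /\
  `|f ((p, r), z) - f ((p, 0), z) - f (((0, 0), r), z) + f (((0, 0), 0), z) -
   r * (p.1 * 'D_e1 fr (((0, 0), 0), z) + p.2 * 'D_e2 fr (((0, 0), 0), z))|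
   <= e * `|r| * (`|p.1| + `|p.2|).
Proof.
move=> e0.
have fr1 : Cr 1 U fr := f2.2 e3.
pose g1 := 'D_e1 fr; pose g2 := 'D_e2 fr.
have cg1 x : U x -> {for x, continuous g1} := fr1.2 e1 x.
have cg2 x : U x -> {for x, continuous g2} := fr1.2 e2 x.
pose P (x : (R * R) * R) (z : Z) := [/\ U (x, z),
  `|g1 (x, z) - g1 (((0, 0), 0), z)| <= e & `|g2 (x, z) - g2 (((0, 0), 0), z)| <= e].
have nearP : \forall x \near (((0, 0), 0) : (R * R) * R), K `<=` P x.
  have /compact_near_coveringP ncov := cK.
  apply: (ncov _ (nbhs (((0, 0), 0) : (R * R) * R)) P) => z Kz.
  have ct (g : VV -> R) : {for (((0, 0), 0), z), continuous g} ->
     \forall z' \near z & x \near (((0, 0), 0) : (R * R) * R), `|g (x, z') - g (((0, 0), 0), z)| <= e / 2.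
    have e20 : 0 < e / 2 by rewrite divr_gt0.
    move=> /cvgrPdist_le /(_ _ e20); case=> -[A B] [/= nA nB] AB; exists (B, A) => //= -[z' x] /= [Bz' Ax].
    by rewrite distrC; exact: (AB (x, z')).
  have h (g : VV -> R) : {for (((0, 0), 0), z), continuous g} ->
     \forall z' \near z & x \near (((0, 0), 0) : (R * R) * R), `|g (x, z') - g (((0, 0), 0), z')| <= e.
    move=> /ct [[B A] [/= nB nA] AB]; exists (B, A) => //= -[z' x] /= [Bz' Ax].
    have a1 := AB (z', x) (conj Bz' Ax); have a2 := AB (z', ((0, 0), 0)) (conj Bz' (nbhs_singleton nA)).
    rewrite (splitr e) -(subrKA (g (0, 0, 0, z))); apply: le_trans (ler_normD _ _) _.
    by rewrite lerD// distrC.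
  have hU : \forall z' \near z & x \near (((0, 0), 0) : (R * R) * R), U (x, z').
    have : nbhs ((((0, 0), 0), z) : VV) U by apply: nbhs_open => //; exact: KU.
    case=> -[A B] [/= nA nB] AB; exists (B, A) => //= -[z' x] /= [Bz' Ax].
    exact: (AB (x, z')).
  have [[B1 A1] [/= nB1 nA1] AB1] := h _ (cg1 _ (KU Kz)).
  have [[B2 A2] [/= nB2 nA2] AB2] := h _ (cg2 _ (KU Kz)).
  have [[B3 A3] [/= nB3 nA3] AB3] := hU.
  exists (B1 `&` (B2 `&` B3), A1 `&` (A2 `&` A3)).
    by split; apply: filterI => //; exact: filterI.
  move=> [z' x] [/= [b1 [b2 b3]] [a1 [a2 a3]]].
  by split; [exact: (AB3 (z', x))|exact: (AB1 (z', x))|exact: (AB2 (z', x))].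
have [d d0 hd] : exists2 d, 0 < d & forall (p : R * R) (r : R), `|p| < d -> `|r| < d -> K `<=` P (p, r).
  have /nbhs_ballP[d /= d0 hd] := nearP; exists d => // p r pd rd.
  by apply: hd; split; rewrite -ball_normE /ball_ /= sub0r normrN.
exists d => // p r z pd rd Kz; split; first by case: (hd p r pd rd z Kz).
have small a b : 0 <= a <= 1 -> 0 <= b <= 1 -> P (a *: p, b *: r) z.
  move=> a01 b01; apply: hd => //.
    rewrite normrZ; apply: le_lt_trans pd; rewrite ger0_norm; last by lra.
    by rewrite ler_piMl//; lra.
  rewrite normrZ; apply: le_lt_trans rd; rewrite ger0_norm; last by lra.
  by rewrite ler_piMl//; lra.
have dU (x : VV) : U x -> differentiable f x := f2.1 x.
have drU (x : VV) : U x -> differentiable fr x := fr1.1 x.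
pose P0 : VV := ((p, 0), 0).
(* The mixed difference is the increment of [F] along the direction of [r]. *)
pose F (y : VV) := f (y + P0) - f y.
pose x0 : VV := (((0, 0), 0), z); pose v : VV := (((0, 0), r), 0).
have vE : v = r *: e3.
  by rewrite /v /e3; apply: injective_projections => /=; [apply: injective_projections|] => /=;
    [apply: injective_projections| |] => /=; rewrite ?scaler0// -[RHS]/(_ * _) mulr1.
have P0E : P0 = p.1 *: e1 + p.2 *: e2.
  rewrite /P0 /e1 /e2; apply: injective_projections => /=; [apply: injective_projections|] => /=;
    [apply: injective_projections| |] => /=; rewrite ?scaler0 ?addr0 ?add0r//;
    by rewrite -[RHS]/(_ * _) mulr1.
have xE a b : x0 + b *: v + a *: P0 = ((a *: p, b *: r), z).
  rewrite /x0 /v /P0; apply: injective_projections => /=; [apply: injective_projections|] => /=;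
    by rewrite ?scaler0 ?addr0 ?add0r.
have U1 a b : 0 <= a <= 1 -> 0 <= b <= 1 -> U (x0 + b *: v + a *: P0).
  by move=> a01 b01; rewrite xE; case: (small a b a01 b01).
have i0 : 0 <= (0 : R) <= 1 by rewrite lexx ler01.
have i1 : 0 <= (1 : R) <= 1 by rewrite lexx ler01.
have U0 b : 0 <= b <= 1 -> U (x0 + b *: v) by move=> b01; have := U1 0 b i0 b01; rewrite scale0r addr0.
have U01 b : 0 <= b <= 1 -> U (x0 + b *: v + P0) by move=> b01; have := U1 1 b i1 b01; rewrite scale1r.
have dsh (y : VV) : U (y + P0) -> differentiable (fun y => f (y + P0)) y.
  move=> Uy; apply: (@differentiable_comp _ _ _ _ (fun y => y + P0) f); last exact: dU.
  by apply: differentiableD; [exact: ((@Cr_id R 1 VV setT).1 y I)|exact: differentiable_cst].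
have [|b b01 bE] := @mvt_dir _ F x0 v.
  by move=> b b01; apply: differentiableB; [apply: dsh; exact: U01|apply: dU; exact: U0].
have [|a a01 aE] := @mvt_dir _ fr (x0 + b *: v) P0.
  by move=> a a01; apply: drU; exact: U1.
have FE : 'D_v F (x0 + b *: v) = r * (fr (x0 + b *: v + P0) - fr (x0 + b *: v)).
  rewrite /F deriveB; [|apply: diff_derivable; apply: dsh; exact: U01|apply: diff_derivable; apply: dU; exact: U0].
  have -> : 'D_v (fun y => f (y + P0)) (x0 + b *: v) = 'D_v f (x0 + b *: v + P0).
    by apply: (@derive_affine _ _ _ _ f (fun y => y + P0)) => h; rewrite -[LHS]addrA.
  have Ev y : U y -> 'D_v f y = r * fr y.
    by move=> Uy; rewrite vE derive_dirZ//; exact: dU.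
  by rewrite !Ev ?mulrBr//; [exact: U0|exact: U01].
have -> : f (p, r, z) - f (p, 0, z) - f (0, 0, r, z) + f (0, 0, 0, z) =
    F (x0 + v) - F x0.
  have := xE 1 1; have := xE 0 1; have := xE 1 0; have := xE 0 0.
  rewrite !scale0r !scale1r !addr0 /F => -> -> -> ->; ring.
rewrite bE FE aE P0E derive_dirD ?derive_dirZ -?P0E; try by apply: drU; exact: U1.
set y := _ + _ + _.
have [_] := small a b a01 b01; rewrite -xE -/y -/(g1 y) -/(g2 y) => q1 q2.
have -> : r * (p.1 *: 'D_e1 fr y + p.2 *: 'D_e2 fr y) - r * (p.1 * 'D_e1 fr (0, 0, 0, z) + p.2 * 'D_e2 fr (0, 0, 0, z))
  = r * (p.1 * (g1 y - g1 (0, 0, 0, z)) + p.2 * (g2 y - g2 (0, 0, 0, z))).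
  exact: scale_comb_sub.
exact: comb_bound q1 q2.
Qed.

End Pointwise.

Definition mixed (F : R * R -> R -> R) (p : R * R) (r : R) : R :=
  F p r - F p 0 - F (0, 0) r + F (0, 0) 0.

(* The error is bilinear in the increments of [p] and [r], so that it can be used both
   on the diagonal [p = O(r)] (second variations) and for [r] tending to 0 first
   (first variations). *)
Definition mixed_differentiable (F : R * R -> R -> R) (l1 l2 : R) : Prop :=
  forall e, 0 < e -> exists2 d, 0 < d & forall p r, `|p| < d -> `|r| < d ->
    `|mixed F p r - r * (p.1 * l1 + p.2 * l2)| <= e * `|r| * (`|p.1| + `|p.2|).

Lemma mixed_differentiable_comb a F G l1 l2 m1 m2 :
  mixed_differentiable F l1 l2 -> mixed_differentiable G m1 m2 ->
  mixed_differentiable (fun p r => a * F p r + G p r) (a * l1 + m1) (a * l2 + m2).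
Proof.
move=> hF hG e e0.
have a0 : 0 < `|a| + 1 by rewrite ltr_wpDl.
have [d1 d10 h1] := hF (e / (2 * (`|a| + 1))) (divr_gt0 e0 (mulr_gt0 (ltr0Sn R 1) a0)).
have [d2 d20 h2] := hG (e / 2) (divr_gt0 e0 (ltr0Sn R 1)).
exists (Num.min d1 d2) => [|p r]; first by rewrite lt_min d10.
rewrite !lt_min => /andP[p1 p2] /andP[r1 r2].
have {}h1 := h1 p r p1 r1; have {}h2 := h2 p r p2 r2.
rewrite (_ : _ - _ = a * (mixed F p r - r * (p.1 * l1 + p.2 * l2)) +
   (mixed G p r - r * (p.1 * m1 + p.2 * m2))); last by rewrite /mixed; ring.
apply: le_trans (ler_normD _ _) _; rewrite normrM.
set S := `|r| * (`|p.1| + `|p.2|).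
have S0 : 0 <= S by rewrite mulr_ge0// addr_ge0.
have hh1 : `|a| * `|mixed F p r - r * (p.1 * l1 + p.2 * l2)| <= e / 2 * S.
  apply: le_trans (ler_wpM2l (normr_ge0 a) h1) _.
  rewrite -[e / _ * _ * _]mulrA -/S mulrA ler_wpM2r// mulrCA ler_wpM2l ?ltW//.
  by rewrite ltr_pdivrMr ?mulr_gt0// mulrA mulVf// mul1r ltrDl.
have hh2 : `|mixed G p r - r * (p.1 * m1 + p.2 * m2)| <= e / 2 * S by rewrite /S mulrA.
by rewrite -mulrA -/S; lra.
Qed.

Lemma mixed_differentiable_eq F G l1 l2 d0 : 0 < d0 ->
  (forall p r, `|p| < d0 -> `|r| < d0 -> F p r = G p r) ->
  mixed_differentiable F l1 l2 -> mixed_differentiable G l1 l2.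
Proof.
move=> d00 FG h e /h[d dp hd]; exists (Num.min d d0) => [|p r]; first by rewrite lt_min dp.
rewrite !lt_min => /andP[p1 p2] /andP[r1 r2].
have z0 : `|(0 : R)| < d0 by rewrite normr0.
have zz0 : `|((0, 0) : R * R)| < d0 by rewrite -[(0, 0)]/(0 : R * R) normr0.
by rewrite /mixed -!FG//; exact: hd.
Qed.

Lemma integrable_cst_fin d (T : measurableType d) (nu : {measure set T -> \bar R})
    (D : set T) (c : R) : measurable D -> (nu D < +oo)%E ->
  nu.-integrable D (EFin \o cst c).
Proof.
move=> mD fD; apply/integrableP; split; first exact/measurable_EFinP/measurable_cst.
rewrite (eq_integral (cst (`|c|%:E)))// integral_cst//=.
by rewrite lte_mul_pinfty.
Qed.

Lemma mixed_integral_bound d (T : measurableType d) (nu : {measure set T -> \bar R})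
    (D : set T) (f1 f2 f3 f4 g1 g2 : T -> R) (r p1 p2 c : R) : measurable D ->
  (nu D < +oo)%E ->
  nu.-integrable D (EFin \o f1) -> nu.-integrable D (EFin \o f2) ->
  nu.-integrable D (EFin \o f3) -> nu.-integrable D (EFin \o f4) ->
  nu.-integrable D (EFin \o g1) -> nu.-integrable D (EFin \o g2) ->
  (forall t, D t -> `|f1 t - f2 t - f3 t + f4 t - r * (p1 * g1 t + p2 * g2 t)| <= c) ->
  `|\int[nu]_(t in D) f1 t - \int[nu]_(t in D) f2 t - \int[nu]_(t in D) f3 t +
    \int[nu]_(t in D) f4 t - r * (p1 * \int[nu]_(t in D) g1 t + p2 * \int[nu]_(t in D) g2 t)|
  <= c * fine (nu D).
Proof.
move=> mD fD h1 h2 h3 h4 i1 i2 hc.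
have iG1 := integrable_scale p1 mD i1; have iG2 := integrable_scale p2 mD i2.
have iL := integrable_scale r mD (integrable_addr mD iG1 iG2).
have i12 := integrable_subr mD h1 h2.
have i123 := integrable_subr mD i12 h3.
have i1234 := integrable_addr mD i123 h4.
have ih := integrable_subr mD i1234 iL.
rewrite -(RintegralZl p1 mD i1) -(RintegralZl p2 mD i2) -(RintegralD mD iG1 iG2).
rewrite -(RintegralZl r mD (integrable_addr mD iG1 iG2)) -(RintegralB mD h1 h2).
rewrite -(RintegralB mD i12 h3) -(RintegralD mD i123 h4) -(RintegralB mD i1234 iL).
apply: le_trans (le_normr_Rintegral mD ih) _.
have ic := integrable_cst_fin c mD fD.
rewrite -(Rintegral_cst _ mD); apply: le_Rintegral => //.
exact: integrable_norm.
Qed.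

Section Integral.

Context (Z : normedModType R) (U : set ((((R * R) * R) * Z)%type : normedModType R))
  (f : ((((R * R) * R) * Z)%type : normedModType R) -> R).
Context d (T : measurableType d) (nu : {measure set T -> \bar R}) (D : set T) (j : T -> Z) (K : set Z).
Hypotheses (oU : open U) (f2 : Cr 2 U f) (cK : compact K) (mD : measurable D).
Hypothesis DK : forall t, D t -> K (j t).
Hypothesis KU : forall z, K z -> U (((0, 0), 0), z).
Hypothesis finD : (nu D < +oo)%E.
Hypothesis intD : forall (g : Z -> R) (O : set Z), open O -> K `<=` O ->
  (forall z, O z -> {for z, continuous g}) -> nu.-integrable D (EFin \o (g \o j)).

(** The pointwise error is uniform in [z] and can be integrated over a set of finite measure. The
    hypothesis [intD] lets one statement serve both the interval of the energy term and the
    half-open rectangle of the flux term. *)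
Lemma mixed_differentiable_integral :
  exists l1 l2, mixed_differentiable (fun p r => \int[nu]_(t in D) f ((p, r), j t)) l1 l2.
Proof.
pose e3 := (((0, 0), 1), 0) : ((((R * R) * R) * Z)%type : normedModType R).
pose e1 := (((1, 0), 0), 0) : ((((R * R) * R) * Z)%type : normedModType R).
pose e2 := (((0, 1), 0), 0) : ((((R * R) * R) * Z)%type : normedModType R).
pose G1 z := 'D_e1 ('D_e3 f) (((0, 0), 0), z).
pose G2 z := 'D_e2 ('D_e3 f) (((0, 0), 0), z).
have cslice x (z : Z) : {for z, continuous (fun z : Z => (x, z) : ((((R * R) * R) * Z)%type : normedModType R))}.
  apply: (@Cr_continuous _ 0 _ _ setT) => //.
  by apply: Cr_pair; [exact: openT|exact: Cr_cst|exact: Cr_id].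
pose O x := (fun z : Z => (x, z) : ((((R * R) * R) * Z)%type : normedModType R)) @^-1` U.
have oO x : open (O x) by apply: open_comp => // z _; exact: cslice.
have iG (g : ((((R * R) * R) * Z)%type : normedModType R) -> R) x : Cr 0 U g -> K `<=` O x ->
    nu.-integrable D (EFin \o (fun t => g (x, j t))).
  move=> cg KO; apply: (intD (g := fun z => g (x, z)) (oO x) KO) => z Oz.
  by apply: (@continuous_comp _ _ _ (fun z : Z => (x, z)) g); [exact: cslice|exact: (cg _ Oz)].
have i1 : nu.-integrable D (EFin \o (G1 \o j)) by apply: (iG _ _ ((f2.2 e3).2 e1)) => z; exact: KU.
have i2 : nu.-integrable D (EFin \o (G2 \o j)) by apply: (iG _ _ ((f2.2 e3).2 e2)) => z; exact: KU.
exists (\int[nu]_(t in D) G1 (j t)), (\int[nu]_(t in D) G2 (j t)) => e e0.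
pose m := fine (nu D); have m0 : 0 <= m by rewrite fine_ge0.
(* The [+ 1] allows for a set of measure 0. *)
have e'0 : 0 < e / (m + 1) by rewrite divr_gt0// ltr_wpDl.
have [dd dd0 hd] := mixed_pointwise oU f2 cK KU e'0.
exists dd => // p r pd rd.
have z0 : `|(0 : R)| < dd by rewrite normr0.
have zz0 : `|((0, 0) : R * R)| < dd by rewrite -[(0, 0)]/(0 : R * R) normr0.
have fi p' r' : `|p'| < dd -> `|r'| < dd -> nu.-integrable D (EFin \o (fun t => f ((p', r'), j t))).
  move=> pd' rd'; apply: iG; first exact: CrW (CrW f2).
  by move=> z Kz; case: (hd p' r' z pd' rd' Kz).
have h1 := fi _ _ pd rd; have h2 := fi _ _ pd z0; have h3 := fi _ _ zz0 rd; have h4 := fi _ _ zz0 z0.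
pose c := e / (m + 1) * `|r| * (`|p.1| + `|p.2|).
have hc t : D t -> `|f ((p, r), j t) - f ((p, 0), j t) - f (((0, 0), r), j t) + f (((0, 0), 0), j t) -
    r * (p.1 * G1 (j t) + p.2 * G2 (j t))| <= c.
  by move=> Dt; have [_] := hd p r (j t) pd rd (DK Dt).
apply: (le_trans (mixed_integral_bound mD finD h1 h2 h3 h4 i1 i2 hc)).
rewrite -/m /c (_ : _ * m = (m / (m + 1)) * (e * `|r| * (`|p.1| + `|p.2|))); last by ring.
rewrite ler_piMl//; first by rewrite !mulr_ge0// ?addr_ge0// ltW.
by rewrite ler_pdivrMr ?mul1r ?lerDl// ltr_wpDl.
Qed.

End Integral.

End MixedDifferences.

(** * Sobolev functions on rectangles and gluing of cylinders *)

Section Planar.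

Context {R : realType}.
Local Notation mu := (@lebesgue_measure R).
Local Notation RR := (measurableTypeR R).
Local Notation mu2 := (mu \x mu)%E.

(** An open set is the countable union of the rational boxes that it contains, and boxes generate
    the product sigma-algebra. *)
Lemma open_measurable2 (U : set (R * R)) : open U -> measurable (U : set (RR * RR)).
Proof.
move=> oU.
pose B (a b e : rat) : set (R * R) :=
  if `[< [set z : R * R | `|z.1 - ratr a| < ratr e /\ `|z.2 - ratr b| < ratr e] `<=` U >] then
   [set z : R * R | `|z.1 - ratr a| < ratr e /\ `|z.2 - ratr b| < ratr e] else set0.
have -> : U = \bigcup_a \bigcup_b \bigcup_e B a b e.
  apply/seteqP; split => [[x y] Uxy|z [a _ [b _ [e _]]]]; last first.
    by rewrite /B; case: asboolP => // /[apply].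
  have /nbhs_ballP[d /= d0 hd] : nbhs (x, y) U by exact: nbhs_open.
  have [e e1 e2] : exists2 e : rat, 0 < (ratr e : R) & ratr e < d / 2.
    have [|e] := @rat_in_itvoo R 0 (d / 2); first by rewrite divr_gt0.
    by rewrite in_itv /= => /andP[? ?]; exists e.
  have [a ae] : exists a : rat, `|x - ratr a| < (ratr e : R).
    have [|a] := @rat_in_itvoo R (x - ratr e) x; first by lra.
    rewrite in_itv /= => /andP[? ?]; exists a.
    by rewrite ltr_norml; apply/andP; split; lra.
  have [b be] : exists b : rat, `|y - ratr b| < (ratr e : R).
    have [|b] := @rat_in_itvoo R (y - ratr e) y; first by lra.
    rewrite in_itv /= => /andP[? ?]; exists b.
    by rewrite ltr_norml; apply/andP; split; lra.
  exists a => //; exists b => //; exists e => //.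
  rewrite /B; case: asboolP => //; apply => -[x' y'] /= [h1 h2].
  apply: hd; split; rewrite /ball /=.
    rewrite -(subrKA (ratr a)); apply: le_lt_trans (ler_normD _ _) _.
    by rewrite distrC in h1; lra.
  rewrite -(subrKA (ratr b)); apply: le_lt_trans (ler_normD _ _) _.
  by rewrite distrC in h2; lra.
apply: bigcupT_measurable_rat => a; apply: bigcupT_measurable_rat => b.
apply: bigcupT_measurable_rat => e; rewrite /B; case: ifP => // _.
have mb (x r : R) : measurable ([set y | `|y - x| < r] : set RR).
  apply: open_measurable; apply: (@open_comp _ _ (fun y => `|y - x|) [set y | y < r]); last exact: open_lt.
  move=> y _; apply: (@continuous_comp _ _ _ (fun y => y - x) (fun y => `|y|)); last exact: norm_continuous.
  by apply: cvgB; [exact: cvg_id|exact: cvg_cst].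
rewrite (_ : [set z | _] = [set y | `|y - ratr a| < ratr e] `*` [set y | `|y - ratr b| < ratr e])//.
exact: measurableX.
Qed.

Lemma continuous_measurable2 (O : set (R * R)) (g : R * R -> R) (D : set (RR * RR)) :
  open O -> (forall z, O z -> {for z, continuous g}) -> measurable D -> D `<=` O ->
  measurable_fun D g.
Proof.
move=> oO cg mD DO.
have mO : measurable_fun (O : set (RR * RR)) g.
  apply: (measurability _ (RGenOpens.measurableE R)).
  move=> _ [_ [a [b ->] <-]]; apply: open_measurable2.
  rewrite openE => z [Oz gz]; apply: filterI; first exact: nbhs_open.
  by apply: (cg z Oz); apply: nbhs_open => //; exact: interval_open.
exact: (measurable_funS (open_measurable2 oO) DO mO).
Qed.

Lemma bounded_integrable d (T : measurableType d) (nu : {measure set T -> \bar R})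
    (D : set T) (g : T -> R) C : measurable D -> (nu D < +oo)%E ->
  measurable_fun D g -> (forall t, D t -> `|g t| <= C) ->
  nu.-integrable D (EFin \o g).
Proof.
move=> mD fD mg gC.
exact: (le_integrable_real mD mg gC (integrable_cst_fin C mD fD)).
Qed.

Lemma compact_bound_on (Z : topologicalType) (K : set Z) (g : Z -> R) : compact K ->
  (forall x, K x -> {for x, continuous g}) ->
  exists2 C, 0 < C & forall x, K x -> `|g x| <= C.
Proof.
move=> cK cg; have cgK : {within K, continuous g}.
  by apply: continuous_in_subspaceT => x; rewrite inE; exact: cg.
have /compact_bounded/pinfty_ex_gt0[C C0 gC] := continuous_compact cgK cK.
by exists C => // x Kx; apply: gC; exists x.
Qed.

Definition rect (a b c d : R) : set (R * R) := `[a, b] `*` `[c, d].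

Lemma measurable_rect a b c d : measurable (rect a b c d : set (RR * RR)).
Proof. by apply: measurableX; exact: measurable_itv. Qed.

Lemma compact_rect a b c d : compact (rect a b c d).
Proof. by apply: compact_setX; exact: segment_compact. Qed.

Lemma mu2_rect_fin a b c d : (mu2 (rect a b c d) < +oo)%E.
Proof.
rewrite product_measure1E//.
by rewrite lte_mul_pinfty// ?mu_itv_fin// ge0_fin_numE// mu_itv_fin.
Qed.

Lemma continuous_integrable_rect a b c d (g : R * R -> R) (O : set (R * R)) : open O ->
  rect a b c d `<=` O -> (forall z, O z -> {for z, continuous g}) ->
  mu2.-integrable (rect a b c d) (EFin \o g).
Proof.
move=> oO KO cg; have mr := measurable_rect a b c d.
have [C C0 gC] := compact_bound_on (@compact_rect a b c d) (fun x Kx => cg x (KO x Kx)).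
apply: (@bounded_integrable _ _ mu2 _ _ C) => //; first exact: mu2_rect_fin.
exact: (continuous_measurable2 oO).
Qed.

Lemma continuous_integrable_itv a b (g : R -> R) (O : set R) : open O ->
  `[a, b] `<=` O -> (forall z, O z -> {for z, continuous g}) ->
  mu.-integrable `[a, b] (EFin \o g).
Proof.
move=> oO KO cg; apply: continuous_integrable_cc.
by apply: continuous_in_subspaceT => x; rewrite inE => /KO; exact: cg.
Qed.

End Planar.

(** * Stretching and gluing W^{1,2} functions on rectangles *)

Section PlanarSobolev.

Context {R : realType}.
Local Notation mu := (@lebesgue_measure R).
Local Notation RR := (measurableTypeR R).
Local Notation mu2 := (mu \x mu)%E.

Definition w12_rect (a b a' b' : R) (f : R * R -> R) : Prop :=
  {ae mu, forall s, a' <= s <= b' -> ac_on a b (fun t => f (t, s))} /\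
  {ae mu, forall t, a <= t <= b -> ac_on a' b' (fun s => f (t, s))} /\
  mu2.-integrable (rect a b a' b') (EFin \o (fun z => ('D_(1, 0) f z) ^+ 2)) /\
  mu2.-integrable (rect a b a' b') (EFin \o (fun z => ('D_(0, 1) f z) ^+ 2)).

Lemma Cr_slice1 r (O : set (R * R)) (f : R * R -> R) s : open O -> Cr r O f ->
  open [set t | O (t, s)] /\ Cr r [set t | O (t, s)] (fun t => f (t, s)).
Proof.
move=> oO cf.
have o1 : open [set t | O (t, s)].
  apply: (@open_comp _ _ (fun t => (t, s)) O) => // t _.
  apply: (@Cr_continuous _ 0 _ _ setT) => //.
  by apply: Cr_pair; [exact: openT|exact: Cr_id|exact: Cr_cst].
split=> //; apply: (@Cr_comp R r R _ R _ O (fun t => (t, s)) f) => //.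
- exact: finite_basis_prod finite_basis_R finite_basis_R.
- by apply: Cr_pair => //; [exact: Cr_id|exact: Cr_cst].
Qed.

Lemma Cr_slice2 r (O : set (R * R)) (f : R * R -> R) t : open O -> Cr r O f ->
  open [set s | O (t, s)] /\ Cr r [set s | O (t, s)] (fun s => f (t, s)).
Proof.
move=> oO cf.
have o1 : open [set s | O (t, s)].
  apply: (@open_comp _ _ (fun s => (t, s)) O) => // s _.
  apply: (@Cr_continuous _ 0 _ _ setT) => //.
  by apply: Cr_pair; [exact: openT|exact: Cr_cst|exact: Cr_id].
split=> //; apply: (@Cr_comp R r R _ R _ O (fun s => (t, s)) f) => //.
- exact: finite_basis_prod finite_basis_R finite_basis_R.
- by apply: Cr_pair => //; [exact: Cr_cst|exact: Cr_id].
Qed.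

Lemma C1_ac_on1 a b c d (O : set (R * R)) (f : R * R -> R) s : a <= b ->
  open O -> Cr 1 O f -> rect a b c d `<=` O -> c <= s <= d ->
  ac_on a b (fun t => f (t, s)).
Proof.
move=> ab oO cf rO cd; have [_ c1] := Cr_slice1 s oO cf.
apply: (Cr1_w12 ab _ c1).1 => t tab; exact: rO.
Qed.

Lemma C1_ac_on2 a b c d (O : set (R * R)) (f : R * R -> R) t : c <= d ->
  open O -> Cr 1 O f -> rect a b c d `<=` O -> a <= t <= b ->
  ac_on c d (fun s => f (t, s)).
Proof.
move=> cd oO cf rO ab; have [_ c1] := Cr_slice2 t oO cf.
apply: (Cr1_w12 cd _ c1).1 => s scd; exact: rO.
Qed.

Lemma C1_derive_sqr_integrable a b c d (O : set (R * R)) (f : R * R -> R) v :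
  open O -> Cr 1 O f -> rect a b c d `<=` O ->
  mu2.-integrable (rect a b c d) (EFin \o (fun z => ('D_v f z) ^+ 2)).
Proof.
move=> oO cf rO; apply: (continuous_integrable_rect oO rO) => z Oz.
have cv := cf.2 v z Oz; rewrite (_ : (fun z => _) = (fun z => 'D_v f z * 'D_v f z)); last first.
  by apply/funext => y; rewrite expr2.
exact: cvgM.
Qed.

Lemma C1_w12_rect a b c d (O : set (R * R)) (f : R * R -> R) : a <= b -> c <= d ->
  open O -> Cr 1 O f -> rect a b c d `<=` O -> w12_rect a b c d f.
Proof.
move=> ab cd oO cf rO; split; last split; last split.
- by apply: aeW => s; exact: C1_ac_on1 rO.
- by apply: aeW => t; exact: C1_ac_on2 rO.
- exact: C1_derive_sqr_integrable rO.
- exact: C1_derive_sqr_integrable rO.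
Qed.

Lemma ac_eq a b (f g : R -> R) : a <= b -> (forall x, a <= x <= b -> f x = g x) ->
  ac_on a b f -> ac_on a b g.
Proof. by move=> ab fg /ac_onP h; apply: primitive_ac ab _; exact: primitive_eq h. Qed.

Lemma ac_glue a m b (f : R -> R) : a <= m -> m <= b -> ac_on a m f -> ac_on m b f ->
  ac_on a b f.
Proof. by move=> am mb /ac_onP h1 /ac_onP h2; apply/ac_onP; exact: primitive_glue h2. Qed.

Lemma ac_affine (k l a b : R) (f : R -> R) : 0 < k -> a <= b ->
  ac_on (k * a + l) (k * b + l) f -> ac_on a b (fun x => f (k * x + l)).
Proof.
move=> k0 ab /ac_onP [fi fE].
have preE (x y : R) : (fun t => k * t + l) @^-1` `[k * x + l, k * y + l]%classic = `[x, y]%classic.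
  by apply/seteqP; split => t; rewrite /= !in_itv /= !lerD2r !ler_pM2l.
have sc (X : set RR) : measurable X -> (mu X = k%:E * mu ((fun t => (k * t + l)%R) @^-1` X))%E.
  exact: lebesgue_affine.
apply: (@primitive_ac _ _ _ _ (fun x => k * derive1 f (k * x + l)) ab); split.
  have mi : measurable (`[k * a + l, k * b + l]%classic : set RR) by exact: measurable_itv.
  have := @integrable_map R _ RR mu k _ k0 (measurable_affine k l) sc _ _ mi fi.
  rewrite preE => h; apply: integrable_scale h; exact: measurable_itv.
move=> x /andP[ax xb]; rewrite fE; last by rewrite !lerD2r !ler_pM2l// ax xb.
congr (_ + _).
have mx : measurable (`[k * a + l, k * x + l]%classic : set RR) by exact: measurable_itv.
have fix_ : mu.-integrable `[k * a + l, k * x + l] (EFin \o derive1 f).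
  by apply: integrable_itvS fi; rewrite // lerD2r ler_pM2l.
rewrite (@Rintegral_map R _ RR mu k _ k0 (measurable_affine k l) sc _ _ mx fix_) preE.
rewrite RintegralZl//.
have := @integrable_map R _ RR mu k _ k0 (measurable_affine k l) sc _ _ mx fix_.
by rewrite preE.
Qed.

Lemma point_real : (point : R) = 0.
Proof. by []. Qed.

Lemma affine_dnbhs (k : R) : 0 < k -> (fun h : R => k * h) @ (0 : R)^' = (0 : R)^'.
Proof.
move=> k0; apply/seteqP; split => A [/= e e0 hA].
  exists (k * e) => [|h /= he hn0]; first exact: mulr_gt0.
  have := hA (k^-1 * h); rewrite /= (mulVKf (lt0r_neq0 k0)); apply.
    move: he; rewrite !sub0r !normrN normrM gtr0_norm ?invr_gt0// => he.
    by rewrite mulrC ltr_pdivrMr// mulrC.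
  by rewrite mulf_neq0// invr_eq0 gt_eqF.
exists (k^-1 * e) => [|h /= he hn0]; first by apply: mulr_gt0 => //; rewrite invr_gt0.
apply: hA; last by rewrite mulf_neq0// gt_eqF.
move: he; rewrite /= !sub0r !normrN normrM gtr0_norm// => he.
by rewrite -ltr_pdivlMl.
Qed.

(** Where the derivative does not exist, both limits are the default value of [R], which is 0, so
    the identity persists. This matters because the stretched function is only of class W^{1,2}. *)
Lemma derive_scale_dir (V : normedModType R) (f : V -> R) (k : R) x v : 0 < k ->
  'D_(k *: v) f x = k * 'D_v f x.
Proof.
move=> k0; rewrite /derive.
pose Q (h : R) := h^-1 *: (f (h *: v + x) - f x).
rewrite -/(Q) [X in lim X](_ : _ = (fun h => k * Q h) @ (0 : R)^'); last first.
  have -> : (fun h => k * Q h) @ (0 : R)^' = (fun h => k * Q (k * h)) @ (0 : R)^'.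
    by rewrite -{1}(affine_dnbhs k0).
  apply: (congr1 (fun g => g @ (0 : R)^')); apply/funext => h.
  rewrite /= /Q scalerA [h * k]mulrC -![_ *: (_ - _)]/(_ * _) mulrA invfM mulrA mulfV ?gt_eqF//.
  by rewrite mul1r.
have [cQ|dQ] := pselect (cvg (Q @ (0 : R)^')).
  by apply: cvg_lim => //; apply: cvgM => //; exact: cvg_cst.
rewrite (dvgP dQ) dvgP ?point_real ?mulr0// => ck; apply: dQ.
have -> : Q = (fun h => k^-1 * (k * Q h)).
  by apply/funext => h; rewrite mulrA mulVf ?mul1r// gt_eqF.
by apply: is_cvgM => //; exact: is_cvg_cst.
Qed.

Definition stretch (k l : R) (z : R * R) : R * R := (z.1, k * z.2 + l).

Lemma measurable_stretch (k l : R) : @measurable_fun _ _ (RR * RR)%type (RR * RR)%type setT (stretch k l).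
Proof.
apply/measurable_fun_pairP; split.
  exact: measurable_fst.
have -> : snd \o stretch k l = (fun t : RR => k * t + l) \o snd by apply/funext.
by apply: measurableT_comp; [exact: measurable_affine|exact: measurable_snd].
Qed.

Lemma stretch_measure (k l : R) (X : set (RR * RR)) : 0 < k -> measurable X ->
  (mu2 X = k%:E * mu2 (stretch k l @^-1` X))%E.
Proof.
move=> k0 mX.
have [m mE] := @scaled_image_measure R _ (RR * RR)%type mu2 (stretch k l) (measurable_stretch k l) _ k0.
rewrite -mE; apply: product_measure_unique mX => A B mA mB; rewrite mE.
have -> : stretch k l @^-1` (A `*` B) = A `*` ((fun t => k * t + l) @^-1` B) by [].
have mB' : measurable ((fun t => k * t + l) @^-1` B : set RR).
  exact: (measurable_preimage_map (measurable_affine k l)).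
transitivity (k%:E * (mu A * mu ((fun t => (k * t + l)%R) @^-1` B)))%E.
  by congr (_ * _)%E; exact: product_measure1E.
by rewrite muleCA; congr (_ * _)%E; rewrite -(lebesgue_affine l k0 mB).
Qed.

Lemma derive_stretch1 (k l : R) (f : R * R -> R) z :
  'D_(1, 0) (f \o stretch k l) z = 'D_(1, 0) f (stretch k l z).
Proof.
apply: derive_affine => h; apply: injective_projections => //=.
by rewrite scaler0 !add0r.
Qed.

Lemma derive_stretch2 (k l : R) (f : R * R -> R) z : 0 < k ->
  'D_(0, 1) (f \o stretch k l) z = k * 'D_(0, 1) f (stretch k l z).
Proof.
move=> k0; rewrite -derive_scale_dir//.
apply: derive_affine => h; apply: injective_projections => /=; first by rewrite !scaler0.
by rewrite -![_ *: _]/(_ * _) mulr1; ring.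
Qed.

Lemma w12_rect_stretch (k l a b c d : R) (f : R * R -> R) : 0 < k -> c <= d ->
  w12_rect a b (k * c + l) (k * d + l) f -> w12_rect a b c d (f \o stretch k l).
Proof.
move=> k0 cd [h1 [h2 [h3 h4]]].
have preE : stretch k l @^-1` rect a b (k * c + l) (k * d + l) = rect a b c d.
  by apply/seteqP; split => z; rewrite /rect /= !in_itv /= !lerD2r !ler_pM2l.
have mr := measurable_rect a b (k * c + l) (k * d + l).
have sc (X : set (RR * RR)) : measurable X -> (mu2 X = k%:E * mu2 (stretch k l @^-1` X))%E.
  exact: stretch_measure.
split; last split; last split.
- have := @ae_map R _ RR mu k _ k0 (measurable_affine k l)
    (fun X mX => @lebesgue_affine R k l X k0 mX) _ h1.
  by apply: filterS => s hs scd; apply: hs; rewrite !lerD2r !ler_pM2l.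
- by apply: filterS h2 => t ht tab; apply: (ac_affine k0 cd (f := fun s => f (t, s))); exact: ht.
- have := @integrable_map R _ (RR * RR)%type mu2 k _ k0 (measurable_stretch k l) sc _ _ mr h3.
  rewrite preE; apply: eq_integrable; first exact: measurable_rect.
  by move=> z _; rewrite /= derive_stretch1.
- have := @integrable_map R _ (RR * RR)%type mu2 k _ k0 (measurable_stretch k l) sc _ _ mr h4.
  rewrite preE => /(integrable_scale (k ^+ 2) (measurable_rect a b c d)).
  apply: eq_integrable; first exact: measurable_rect.
  by move=> z _; rewrite /= derive_stretch2// exprMn.
Qed.

(** The seam [s = m] is a null set, but integrability over it still asks for a measurable integrand.
    The horizontal derivative depends on values along the seam only, where [f] agrees with a C^1
    function. *)
Lemma line_measurable1 a b m (f : R * R -> R) (O : set (R * R)) (fl : R * R -> R) :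
  open O -> Cr 1 O fl -> rect a b m m `<=` O -> (forall t, f (t, m) = fl (t, m)) ->
  measurable_fun (rect a b m m : set (RR * RR)) ('D_(1, 0) f).
Proof.
move=> oO cf rO e; apply: (@eq_measurable_fun _ _ _ _ _ ('D_(1, 0) fl)) => [[t s]|]; last first.
  apply: (continuous_measurable2 oO) => //; [exact: (cf.2 (1, 0))|exact: measurable_rect].
rewrite inE /rect /= !in_itv /= => -[_ /andP[sm ms]].
have -> : s = m by apply/eqP; rewrite eq_le ms sm.
have sl (g : R * R -> R) : 'D_(1, 0) g (t, m) = 'D_1 (g \o (fun t => (t, m))) t.
  rewrite (@derive_affine _ _ _ _ g (fun t => (t, m)) t 1 (1, 0))// => h.
  by apply: injective_projections; rewrite //= scaler0 add0r.
by rewrite !sl; congr ('D_1 _ t); apply/funext => x /=; rewrite e.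
Qed.

(** The vertical derivative on the seam mixes both halves and may fail to exist; it is a limit of
    difference quotients that are continuous in [t], and [measurable_punctured_lim] covers both
    cases. The quotients are set to 0 for [|h| >= e], which does not affect the limit. *)
Lemma line_measurable2 a b m e (f : R * R -> R) : a <= b -> 0 < e ->
  (forall h, `|h| < e -> {within `[a, b], continuous (fun t => f (t, m + h))}) ->
  measurable_fun (rect a b m m : set (RR * RR)) ('D_(0, 1) f).
Proof.
move=> ab e0 cf; pose cl t := Num.max a (Num.min b t).
have e0' : `|(0 : R)| < e by rewrite normr0.
have cf0 := cf 0 e0'; rewrite addr0 in cf0.
pose Q h t := if `|h| < e then h^-1 * (f (cl t, m + h) - f (cl t, m)) else 0.
have cQ h : continuous (Q h).
  move=> t; rewrite /Q; case he : (`|h| < e); last exact: cvg_cst.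
  apply: cvgM; first exact: cvg_cst.
  by apply: cvgB; [exact: (clamp_continuous ab (cf h he))|exact: (clamp_continuous ab cf0)].
have mQ := measurable_punctured_lim cQ.
apply: (@eq_measurable_fun _ _ _ _ _ ((fun t => lim (Q h t @[h --> 0^'])) \o fst)) => [[t s]|]; last first.
  by apply: measurable_funTS; apply: measurableT_comp => //; exact: measurable_fst.
rewrite inE /rect /= !in_itv /= => -[tab /andP[sm ms]].
have -> : s = m by apply/eqP; rewrite eq_le ms sm.
have clt : cl t = t.
  by rewrite /cl min_r ?max_r//; case/andP: tab.
have -> : 'D_(0, 1) f (t, m) = 'D_1 (f \o (fun s => (t, s))) m.
  rewrite (@derive_affine _ _ _ _ f (fun s => (t, s)) m 1 (0, 1))// => h.
  by apply: injective_projections; rewrite //= scaler0 add0r.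
rewrite /derive; apply: congr1.
have nQ : \forall h \near (0 : R)^', Q h t = h^-1 *: ((f \o (fun s => (t, s)) \o shift m) (h *: 1) - (f \o (fun s => (t, s))) m).
  exists e => //= h; rewrite /= sub0r normrN => he _.
  by rewrite /Q he clt -[h%:A]/(h * 1) mulr1 [h + m]addrC.
by apply/seteqP; split; apply: near_eq_cvg; apply: filterS nQ => h ->.
Qed.

Lemma null_integrable d (T : measurableType d) (nu : {measure set T -> \bar R})
    (N : set T) (g : T -> R) : measurable N -> measurable_fun N g -> nu N = 0 ->
  nu.-integrable N (EFin \o g).
Proof.
move=> mN mg N0; apply/integrableP; split; first exact/measurable_EFinP.
by rewrite integral_abs_eq0//; exact/measurable_EFinP.
Qed.

Lemma mu2_line a b m : (mu2 (rect a b m m) = 0)%E.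
Proof.
transitivity (mu `[a, b]%classic * mu `[m, m]%classic)%E; first exact: product_measure1E.
by rewrite set_itv1 lebesgue_measure_set1 mule0.
Qed.

Lemma integrable_rect_split a b c m d (g gl gu : R * R -> R) : c <= m -> m <= d ->
  measurable_fun (rect a b m m : set (RR * RR)) g ->
  mu2.-integrable (rect a b c m) (EFin \o gl) -> mu2.-integrable (rect a b m d) (EFin \o gu) ->
  (forall z, z.2 < m -> g z = gl z) -> (forall z, m < z.2 -> g z = gu z) ->
  mu2.-integrable (rect a b c d) (EFin \o g).
Proof.
move=> cm md mg il iu el eu.
pose A : set (RR * RR) := `[a, b]%classic `*` `[c, m[%classic.
pose B : set (RR * RR) := `[a, b]%classic `*` `]m, d]%classic.
have mA : measurable A by apply: measurableX; exact: measurable_itv.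
have mB : measurable B by apply: measurableX; exact: measurable_itv.
have -> : rect a b c d = (A `|` B) `|` rect a b m m.
  apply/seteqP; split => [[t s]|[t s]]; rewrite /A /B /rect /= !in_itv /=.
    move=> [-> /andP[cs sd]]; have [sm|ms|->] := ltgtP s m; [left; left|left; right|right]; split=> //; apply/andP; split => //.
  by move=> [[[-> ?]|[-> ?]]|[-> ?]]; split => //; lra.
apply: integrable_setU; [exact: measurableU|exact: measurable_rect| |].
  apply: integrable_setU => //.
    apply: (@eq_integrable _ _ _ mu2 A mA (EFin \o gl)) => [z|].
      by rewrite inE => -[_] /=; rewrite in_itv /= => /andP[_ zm]; rewrite el.
    apply: (integrableS _ mA _ il); first exact: measurable_rect.
    by move=> z [? h]; split => //; move: h; rewrite /= !in_itv /= => /andP[-> /ltW ->].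
  apply: (@eq_integrable _ _ _ mu2 B mB (EFin \o gu)) => [z|].
    by rewrite inE => -[_] /=; rewrite in_itv /= => /andP[zm _]; rewrite eu.
  apply: (integrableS _ mB _ iu); first exact: measurable_rect.
  by move=> z [? h]; split => //; move: h; rewrite /= !in_itv /= => /andP[/ltW -> ->].
apply: null_integrable => //; first exact: measurable_rect.
exact: mu2_line.
Qed.

(** Vertical lines cross the seam, and absolute continuity is glued there; horizontal lines other
    than the seam itself stay in one half. The squared derivatives are integrated over the two open
    halves and the null seam separately. *)
Lemma w12_rect_glue a b c m d e (O : set (R * R)) (f fl fu : R * R -> R) :
  a <= b -> c <= m -> m <= d -> open O -> Cr 1 O fl -> rect a b c m `<=` O ->
  w12_rect a b m d fu ->
  (forall z, z.2 <= m -> f z = fl z) -> (forall z, m <= z.2 -> f z = fu z) ->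
  0 < e ->
  (forall h, `|h| < e -> {within `[a, b], continuous (fun t => f (t, m + h))}) ->
  w12_rect a b c d f.
Proof.
move=> ab cm md oO cf rO [u1 [u2 [u3 u4]]] el eu e0 cont.
have mO : rect a b m m `<=` O.
  move=> [t s] [h1]; rewrite /= in_itv /= => h2; apply: rO; split=> //=.
  by rewrite in_itv /=; move: h2 => /andP[? ?]; apply/andP; split=> //; lra.
have dl v z : z.2 < m -> 'D_v f z = 'D_v fl z.
  move=> zm; apply: near_eq_derive.
  have : nbhs z [set y : R * R | y.2 < m].
    apply: nbhs_open => //; apply: (@open_comp _ _ snd [set y | y < m]); last exact: open_lt.
    by move=> y _; exact: cvg_snd.
  by apply: filterS => y /ltW; exact: el.
have du v z : m < z.2 -> 'D_v f z = 'D_v fu z.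
  move=> zm; apply: near_eq_derive.
  have : nbhs z [set y : R * R | m < y.2].
    apply: nbhs_open => //; apply: (@open_comp _ _ snd [set y | m < y]); last exact: open_gt.
    by move=> y _; exact: cvg_snd.
  by apply: filterS => y /ltW; exact: eu.
split; last split; last split.
- apply: filterS2 u1 (ae_not1 m) => s hs sm /andP[cs sd].
  have [sm'|ms] := ltP s m.
    apply: (ac_eq ab (f := fun t => fl (t, s))) => [t _|]; first by rewrite el//= ltW.
    by apply: (C1_ac_on1 ab oO cf rO); rewrite cs ltW.
  apply: (ac_eq ab (f := fun t => fu (t, s))) => [t _|]; first by rewrite eu.
  by apply: hs; rewrite ms.
- apply: filterS u2 => t ht tab; apply: (ac_glue cm md).
    apply: (ac_eq cm (f := fun s => fl (t, s))) => [s /andP[_ sm]|]; first by rewrite el.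
    exact: (C1_ac_on2 cm oO cf rO).
  apply: (ac_eq md (f := fun s => fu (t, s))) => [s /andP[sm _]|]; first by rewrite eu.
  exact: ht.
- apply: (integrable_rect_split cm md _ (C1_derive_sqr_integrable (1, 0) oO cf rO) u3) => [|z zm|z zm].
  + by apply: measurable_funX; apply: (line_measurable1 oO cf mO) => t; rewrite el.
  + by rewrite /= dl.
  + by rewrite /= du.
- apply: (integrable_rect_split cm md _ (C1_derive_sqr_integrable (0, 1) oO cf rO) u4) => [|z zm|z zm].
  + by apply: measurable_funX; exact: (line_measurable2 ab e0 cont).
  + by rewrite /= dl.
  + by rewrite /= du.
Qed.

End PlanarSobolev.

(** * Gluing a smooth and a W^{1,2} cylinder *)

Section Cylinders.

Context {R : realType} {n : nat} {M : manifold R n}.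
Local Notation mu := (@lebesgue_measure R).

Lemma smooth_loop_W12 (q : loop M) : smooth_loop q -> W12_loop q.
Proof.
move=> [sq pq]; have cq : continuous q by move=> t; exact: sq.1.
split=> //; split=> // c a b ab cab i.
have oO : open (setT `&` q @^-1` dom c) by apply: open_preim; [exact: openT|exact: sq.1].
apply: (@Cr1_w12 _ _ _ (setT `&` q @^-1` dom c)) => //.
  by move=> t; rewrite /= in_itv /= => tab; split=> //; exact: cab.
by apply: Cr_coord => //; exact: (sq.2 c 1).
Qed.

Lemma w12_rect_near a b c d (O : set (R * R)) (f g : R * R -> R) : a <= b -> c <= d ->
  open O -> rect a b c d `<=` O -> (forall z, O z -> f z = g z) ->
  w12_rect a b c d f -> w12_rect a b c d g.
Proof.
move=> ab cd oO rO fg [h1 [h2 [h3 h4]]].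
have rOP t s : a <= t <= b -> c <= s <= d -> O (t, s).
  by move=> h h'; apply: rO; split; rewrite /= in_itv.
have de v z : rect a b c d z -> 'D_v f z = 'D_v g z.
  move=> /rO Oz; apply: near_eq_derive.
  by have : nbhs z O by [exact: nbhs_open]; apply: filterS => y; exact: fg.
split; last split; last split.
- apply: filterS h1 => s hs scd; apply: (ac_eq ab _ (hs scd)) => t tab.
  by apply: fg; exact: rOP.
- apply: filterS h2 => t ht tab; apply: (ac_eq cd _ (ht tab)) => s scd.
  by apply: fg; exact: rOP.
- apply: eq_integrable h3; first exact: measurable_rect.
  by move=> z; rewrite inE => rz /=; rewrite de.
- apply: eq_integrable h4; first exact: measurable_rect.
  by move=> z; rewrite inE => rz /=; rewrite de.
Qed.

Lemma within_eq (T U : topologicalType) (A : set T) (f g : T -> U) :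
  (forall x, A x -> g x = f x) -> {within A, continuous f} -> {within A, continuous g}.
Proof.
move=> fg /subspace_continuousP cf; apply/subspace_continuousP => x Ax B.
rewrite -[from_subspace A g x]/(g x) fg// => nB.
have h : nbhs x (fun y => A y -> B (f y)) := cf x Ax B nB.
change (nbhs x (fun y => A y -> B (g y))).
by apply: filterS h => y By Ay; rewrite fg//; exact: By.
Qed.

Lemma within_continuous_interior (T U : topologicalType) (A : set T) (f : T -> U) x :
  {within A, continuous f} -> nbhs x A -> {for x, continuous f}.
Proof.
move=> /subspace_continuousP cf nA B nB.
have Ax := nbhs_singleton nA.
by have := cf x Ax B nB; apply: filterS2 nA => y Ay; exact.
Qed.

Lemma smooth_cylinder (O : set (R * R)) (f : R * R -> M) : open O -> strip `<=` O ->
  smooth_to O f -> (forall t s, 0 <= s <= 1 -> f (t + 1, s) = f (t, s)) ->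
  W12_cylinder (fun t => f (t, 0)) (fun t => f (t, 1)) f.
Proof.
move=> oO sO sf pf; split.
  by apply: continuous_in_subspaceT => z; rewrite inE => /sO; exact: sf.1.
do 3 split=> //; move=> c a b a' b' ab a'0 a'b' b'1 dc i.
have oO' : open (O `&` f @^-1` dom c) by apply: open_preim => //; exact: sf.1.
apply: (C1_w12_rect ab a'b' oO'); first by apply: Cr_coord => //; exact: (sf.2 c 1).
move=> [t s] [/= h1 h2]; rewrite !in_itv /= in h1 h2.
split; last exact: dc.
by apply: sO; rewrite /strip /=; move: h2 => /andP[? ?]; apply/andP; split; lra.
Qed.

Definition glue_cyl (f h : R * R -> M) (z : R * R) : M :=
  if z.2 <= 2^-1 then f z else h (stretch 2 (-1) z).

Section Glue.

Variables (q q' : loop M) (f h : R * R -> M) (O : set (R * R)).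
Hypotheses (oO : open O) (sf : smooth_to O f) (hO : forall t s, 0 <= s <= 2^-1 -> O (t, s)).
Hypothesis pf : forall t s, 0 <= s <= 2^-1 -> f (t + 1, s) = f (t, s).
Hypotheses (fq : forall t, f (t, 2^-1) = q t) (hh : W12_cylinder q q' h).

Local Notation H := (glue_cyl f h).

Lemma glue_low z : z.2 <= 2^-1 -> H z = f z.
Proof. by rewrite /glue_cyl => ->. Qed.

Lemma glue_up z : 2^-1 <= z.2 -> H z = h (stretch 2 (-1) z).
Proof.
rewrite /glue_cyl => z1; case: ifP => // z2; case: z z1 z2 => t s /= z1 z2.
have -> : s = 2^-1 by apply/eqP; rewrite eq_le z1 z2.
rewrite fq /stretch /= (_ : 2 * 2^-1 + -1 = 0); last by field.
by case: hh => _ [_ [-> _]].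
Qed.

Lemma glue_within : {within strip, continuous H}.
Proof.
pose S1 := [set z : R * R | 0 <= z.2 <= 2^-1]; pose S2 := [set z : R * R | 2^-1 <= z.2 <= 1].
have cS x y : closed [set z : R * R | x <= z.2 <= y].
  apply: (@closed_comp _ _ snd [set s | x <= s <= y]).
    by move=> z _; exact: cvg_snd.
  have -> : [set s | x <= s <= y] = `[x, y]%classic by apply/seteqP; split => s; rewrite /= in_itv.
  exact: interval_closed.
have -> : strip = S1 `|` S2.
  apply/seteqP; split => z; rewrite /strip /S1 /S2 /=.
    by have [|] := leP z.2 2^-1; [left|right]; lra.
  by move=> [|]; lra.
apply: withinU_continuous; [exact: cS|exact: cS| |].
  apply: (@within_eq _ _ S1 f).
    by move=> z /andP[_ /glue_low].
  by apply: continuous_in_subspaceT => -[t s]; rewrite inE => h1; exact: (sf.1 _ (hO t h1)).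
apply: (@within_eq _ _ S2 (h \o stretch 2 (-1))).
  by move=> z /andP[/glue_up].
have [/subspace_continuousP ch _] := hh.
apply/subspace_continuousP => z Sz B nB.
have sz y : S2 y -> strip (stretch 2 (-1) y) by rewrite /S2 /strip /stretch /=; lra.
have hB : nbhs (stretch 2 (-1) z) (fun y => strip y -> B (h y)) := ch _ (sz z Sz) B nB.
have cs : {for z, continuous (stretch 2 (-1))}.
  apply: (@Cr_continuous _ 0 _ _ setT) => //.
  apply: Cr_pair; [exact: openT|by apply: Cr_fst; [exact: openT|exact: Cr_id]|].
  apply: CrD; [exact: openT| |exact: Cr_cst].
  apply: CrM; [exact: openT|exact: Cr_cst|].
  by apply: Cr_snd; [exact: openT|exact: Cr_id].
have hB' : nbhs z (fun y => strip (stretch 2 (-1) y) -> B (h (stretch 2 (-1) y))) := cs _ hB.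
change (nbhs z (fun y => S2 y -> B (h (stretch 2 (-1) y)))).
by apply: filterS hB' => y hy Sy; exact: hy (sz y Sy).
Qed.

Lemma glue_interior t s : 0 < s < 1 -> {for (t, s), continuous H}.
Proof.
move=> /andP[s0 s1]; apply: (within_continuous_interior glue_within).
have osnd (A : set R) : open A -> open [set z : R * R | A z.2].
  by move=> oA; apply: (@open_comp _ _ snd A) => // y _; exact: cvg_snd.
have n0 : nbhs (t, s) [set z : R * R | 0 < z.2].
  by apply: nbhs_open => //; apply: (osnd [set s | 0 < s]); exact: open_gt.
have n1 : nbhs (t, s) [set z : R * R | z.2 < 1].
  by apply: nbhs_open => //; apply: (osnd [set s | s < 1]); exact: open_lt.
apply: filterS2 n0 n1 => z /= z0 z1.
by rewrite /strip /= (ltW z0) (ltW z1).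
Qed.

(** Provides the continuity near the seam on which [line_measurable2] rests: the seam lies in the
    interior of the strip, and a segment of it is compact, so nearby horizontal slices stay in the
    chart. *)
Lemma glue_near_line (c : chart M) a b i : (forall t, a <= t <= b -> dom c (H (t, 2^-1))) ->
  exists2 e, 0 < e & forall k, `|k| < e ->
    {within `[a, b], continuous (fun t => coord c (H (t, 2^-1 + k)) 0 i)}.
Proof.
move=> dc; pose P (k t : R) := {for t, continuous (fun t => coord c (H (t, 2^-1 + k)) 0 i)}.
have /compact_near_coveringP ncov := @segment_compact R a b.
have : \forall k \near (0 : R), `[a, b]%classic `<=` P k.
  apply: (ncov _ (nbhs (0 : R)) P) => t; rewrite /= in_itv /= => tab.
  have cH s : 0 < s < 1 -> {for (t, s), continuous H}.
    exact: glue_interior.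
  have half01 : 0 < (2^-1 : R) < 1 by apply/andP; split; lra.
  have : nbhs ((t : R), (2^-1 : R)) (H @^-1` dom c).
    by apply: (cH _ half01); apply: near_dom; exact: dc.
  case=> -[A B] /= [nA nB] AB.
  have nB' : nbhs (0 : R) [set k | B (2^-1 + k)].
    have : {for (0 : R), continuous (fun k : R => 2^-1 + k)}.
      by apply: cvgD; [exact: cvg_cst|exact: cvg_id].
    by apply; rewrite addr0.
  have nk : nbhs (0 : R) [set k | `|k| < 2^-1].
    by exists 2^-1 => //= k; rewrite /= sub0r normrN.
  exists (A, [set k | B (2^-1 + k)] `&` [set k | `|k| < 2^-1]) => /=.
    by split=> //; exact: filterI.
  move=> [t' k] /= [At [Bk]]; rewrite ltr_norml => /andP[k1 k2].
  have dt : dom c (H (t', 2^-1 + k)) by exact: (AB (t', 2^-1 + k)).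
  apply: (@continuous_comp _ _ _ (fun t => coord c (H (t, 2^-1 + k))) (fun v => v 0 i)); last first.
    apply: (@Cr_continuous _ 0 _ _ setT) => //.
    by apply: Cr_coord; [exact: openT|exact: Cr_id].
  apply: (@continuous_comp _ _ _ (fun t => H (t, 2^-1 + k)) (coord c)); last exact: coord_cont.
  apply: (@continuous_comp _ _ _ (fun t => (t, 2^-1 + k)) H); last first.
    by apply: glue_interior; apply/andP; split; lra.
  apply: (@Cr_continuous _ 0 _ _ setT) => //.
  by apply: Cr_pair; [exact: openT|exact: Cr_id|exact: Cr_cst].
move=> /nbhs_ballP[e /= e0 he]; exists e => // k ke.
apply: continuous_in_subspaceT => t; rewrite inE => tab.
by apply: (he k) => //; rewrite /ball /= sub0r normrN.
Qed.

Lemma glue_cylinder : W12_cylinder (fun t => f (t, 0)) q' H.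
Proof.
have [ch [ph [h0 [h1 wh]]]] := hh.
split; first exact: glue_within.
split.
  move=> t s s01; have [sl|sl] := leP s 2^-1.
    by rewrite !glue_low//= pf//; lra.
  rewrite !glue_up /=; [|lra|lra].
  by rewrite /stretch /= ph//; lra.
split; first by move=> t; rewrite glue_low//= invr_ge0.
split.
  move=> t; rewrite glue_up /=; last by lra.
  by rewrite /stretch /= -h1; congr (h (_, _)); lra.
move=> c a b a' b' ab a'0 a'b' b'1 dc i.
pose fi z := coord c (H z) 0 i; pose fl z := coord c (f z) 0 i; pose fh z := coord c (h z) 0 i.
have el z : z.2 <= 2^-1 -> fi z = fl z by move=> zl; rewrite /fi glue_low.
have eu z : 2^-1 <= z.2 -> fi z = (fh \o stretch 2 (-1)) z by move=> zl; rewrite /fi glue_up.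
have osnd (A : set R) : open A -> open [set z : R * R | A z.2].
  by move=> oA; apply: (@open_comp _ _ snd A) => // y _; exact: cvg_snd.
have oO' : open (O `&` f @^-1` dom c) by apply: open_preim => //; exact: sf.1.
have cfl : Cr 1 (O `&` f @^-1` dom c) fl by apply: Cr_coord => //; exact: (sf.2 c 1).
have low t s : a <= t <= b -> a' <= s <= b' -> s <= 2^-1 -> (O `&` f @^-1` dom c) (t, s).
  move=> tab sab sl; split; first by apply: hO; lra.
  by have := dc t s tab sab; rewrite glue_low.
have up l r : a' <= l -> l <= r -> r <= b' -> 2^-1 <= l -> w12_rect a b l r (fh \o stretch 2 (-1)).
  move=> al lr rb ll; apply: w12_rect_stretch => //.
  apply: (wh c a b) => //; [lra|lra|lra|].
  move=> t s tab slr; have := dc t ((s + 1) / 2) tab; rewrite glue_up /=; last by lra.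
  rewrite /stretch /= (_ : 2 * _ + _ = s); last by field.
  by apply; apply/andP; split; lra.
(* Strictly on one side of the seam, the glued map coincides with one half in a neighbourhood of the
   rectangle. A rectangle that merely touches the seam counts as crossing it, because derivatives on
   the seam see both halves. *)
have [b'l|b'l] := ltP b' 2^-1.
  pose O1 := [set z : R * R | z.2 < 2^-1].
  apply: (@w12_rect_near a b a' b' O1 fl) => //.
  - by apply: (osnd [set s | s < 2^-1]); exact: open_lt.
  - by move=> z [_] /=; rewrite in_itv /O1 /= => /andP[_ ?]; lra.
  - by move=> z /ltW /el.
  - apply: (C1_w12_rect ab a'b' oO' cfl) => -[t s] [/=]; rewrite !in_itv /= => h2 h3.
    by apply: low => //; lra.
have [a'l|a'l] := ltP 2^-1 a'.
  apply: (@w12_rect_near a b a' b' [set z | 2^-1 < z.2] (fh \o stretch 2 (-1))) => //.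
  - by apply: (osnd [set s | 2^-1 < s]); exact: open_gt.
  - by move=> z [_] /=; rewrite in_itv /= => /andP[? _]; lra.
  - by move=> z /ltW /eu.
  - by apply: up => //; exact: ltW.
have [e e0 he] : exists2 e, 0 < e & forall k, `|k| < e ->
    {within `[a, b], continuous (fun t => coord c (H (t, 2^-1 + k)) 0 i)}.
  by apply: glue_near_line => t tab; apply: dc => //; rewrite a'l.
apply: (@w12_rect_glue _ a b a' 2^-1 b' e (O `&` f @^-1` dom c) fi fl (fh \o stretch 2 (-1))) => //.
- by move=> [t s] [/=]; rewrite !in_itv /= => h2 h3; apply: low => //; lra.
- exact: up.
Qed.

End Glue.

End Cylinders.

(** * Integrals of functions of unknown measurability *)

Section LowerIntegral.

Context {R : realType} d (T : measurableType d) (nu : {measure set T -> \bar R}).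
Local Open Scope ereal_scope.
Import HBNNSimple.

Lemma ereal_sup_add (P Q : set (\bar R)) (S : \bar R) : P 0 -> Q 0 ->
  (forall x, P x -> 0 <= x) -> (forall y, Q y -> 0 <= y) ->
  (forall x y, P x -> Q y -> x + y <= S) -> ereal_sup P + ereal_sup Q <= S.
Proof.
move=> P0 Q0 Pp Qp PQ.
have S0 : 0 <= S by have := PQ _ _ P0 Q0; rewrite adde0.
case: S S0 PQ => [s||//] S0 PQ; last by rewrite leey.
have fQ y : Q y -> y \is a fin_num.
  move=> Qy; rewrite ge0_fin_numE; last exact: Qp.
  have := PQ _ _ P0 Qy; rewrite add0e => /le_lt_trans; apply; exact: ltry.
have h y : Q y -> ereal_sup P <= s%:E - y.
  by move=> Qy; apply: ge_ereal_sup => x Px; rewrite leeBrDr; [exact: PQ|exact: fQ].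
have sP0 : 0 <= ereal_sup P by exact: ereal_sup_ubound.
have fP : ereal_sup P \is a fin_num.
  rewrite ge0_fin_numE//; have := h _ Q0; rewrite sube0 => /le_lt_trans; apply; exact: ltry.
rewrite -leeBrDl//; apply: ge_ereal_sup => y Qy.
by rewrite leeBrDl// -leeBrDr; [exact: h|exact: fQ].
Qed.

(** The integral of a nonnegative function is a supremum over simple functions below it. A simple
    function below [f] on the union splits along the measurable sets [A] and [B], and two simple
    functions below the restrictions add up to one below [f]. *)
Lemma lower_integral_setU (A B : set T) (f : T -> \bar R) : measurable A ->
  measurable B -> A `&` B = set0 -> (forall x, 0 <= f x) ->
  \int[nu]_(x in A `|` B) f x = \int[nu]_(x in A) f x + \int[nu]_(x in B) f x.
Proof.
move=> mA mB AB f0.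
have pA x : A x -> ~ B x by move=> Ax Bx; have : (A `&` B) x by []; rewrite AB.
have nn0 (D : set T) x : 0 <= (f \_ D) x by rewrite /patch; case: ifP.
rewrite !ge0_integralE//.
apply/eqP; rewrite eq_le; apply/andP; split.
  apply: ge_ereal_sup => _ [h /= hf <-].
  have hz x : ~ (A `|` B) x -> h x = 0%R.
    move=> nD; have := hf x; rewrite /patch memNset// lee_fin => h0.
    by apply/eqP; rewrite eq_le h0/=.
  have -> : (h : T -> R) = (proj_nnsfun h mA \+ proj_nnsfun h mB)%R.
    apply/funext => x /=; rewrite /mindic !indicE.
    have [Ax|nA] := pselect (A x).
      by rewrite mem_set// memNset ?mulr1 ?mulr0 ?addr0//; exact: pA.
    have [Bx|nB] := pselect (B x); first by rewrite memNset// mem_set// mulr1 mulr0 add0r.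
    by rewrite !memNset// !mulr0 addr0 hz// => -[].
  rewrite sintegralD; apply: leeD; apply: ereal_sup_ubound.
    exists (proj_nnsfun h mA) => //= x; rewrite /mindic indicE.
    have [Ax|nA] := pselect (A x).
      have := hf x; rewrite /patch !mem_set ?mulr1//; by left.
    by rewrite memNset// mulr0.
  exists (proj_nnsfun h mB) => //= x; rewrite /mindic indicE.
  have [Bx|nB] := pselect (B x).
    have := hf x; rewrite /patch !mem_set ?mulr1//; by right.
  by rewrite memNset// mulr0.
have z0 (D : set T) : [set sintegral nu h | h in [set h : {nnsfun T >-> R} | forall x, (h x)%:E <= (f \_ D) x]] 0.
  by exists nnsfun0 => //=; rewrite ?sintegral0//.
apply: ereal_sup_add => //.
- by move=> _ [h _ <-]; exact: sintegral_ge0.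
- by move=> _ [h _ <-]; exact: sintegral_ge0.
move=> _ _ [h1 /= h1f <-] [h2 /= h2f <-]; rewrite -sintegralD.
apply: ereal_sup_ubound; exists (add_nnsfun h1 h2) => //= x.
have := h1f x; have := h2f x; rewrite /patch.
have [Ax|nA] := pselect (A x).
  rewrite (mem_set Ax) (memNset (pA x Ax)) mem_set; last by left.
  move=> a b; rewrite EFinD -[leRHS]adde0; exact: leeD.
rewrite (memNset nA); have [Bx|nB] := pselect (B x).
  rewrite (mem_set Bx) mem_set; last by right.
  move=> a b; rewrite EFinD -[leRHS]add0e; exact: leeD.
rewrite (memNset nB) memNset => [|[]//] a b.
by rewrite EFinD -[leRHS]adde0; exact: leeD.
Qed.

Lemma lower_integral_null (N : set T) (f : T -> \bar R) : measurable N ->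
  nu N = 0 -> (forall x, 0 <= f x) -> \int[nu]_(x in N) f x = 0.
Proof.
move=> mN N0 f0; apply/eqP; rewrite eq_le; apply/andP; split; last first.
  by apply: integral_ge0.
rewrite ge0_integralE//; apply: ge_ereal_sup => _ [h /= hf <-].
have -> : (h : T -> R) = proj_nnsfun h mN.
  apply/funext => x /=; rewrite /mindic indicE.
  have [Nx|nN] := pselect (N x); first by rewrite mem_set// mulr1.
  rewrite memNset// mulr0; have := hf x; rewrite /patch memNset// lee_fin => h0.
  by apply/eqP; rewrite eq_le h0/=.
rewrite -integralT_nnsfun.
have -> : \int[nu]_x (proj_nnsfun h mN x)%:E = \int[nu]_(x in N) (h x)%:E.
  rewrite [RHS]integral_mkcond; apply: eq_integral => x _ /=; rewrite /mindic indicE /patch.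
  by case: ifPn => xN; rewrite ?mulr1 ?mulr0.
rewrite null_set_integral//; apply/measurable_EFinP; exact: measurable_funTS.
Qed.

Lemma eq_on_integral (D : set T) (f g : T -> \bar R) : (forall x, D x -> f x = g x) ->
  \int[nu]_(x in D) f x = \int[nu]_(x in D) g x.
Proof. by move=> fg; apply: eq_integral => x; rewrite inE; exact: fg. Qed.

(* No measurability of [gu] is assumed: if its positive or negative part has
   infinite integral, then the integral of [g] has the junk value 0 and [kappa] is 0. *)
Lemma Rintegral_paste (A N B : set T) (gu : T -> R) : measurable A -> measurable N ->
  measurable B -> A `&` N = set0 -> (A `|` N) `&` B = set0 -> nu N = 0 ->
  exists kappa c : R, forall g gl : T -> R, nu.-integrable A (EFin \o gl) ->
    (forall x, A x -> g x = gl x) -> (forall x, B x -> g x = gu x) ->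
    (\int[nu]_(x in (A `|` N) `|` B) g x = kappa * \int[nu]_(x in A) gl x + c)%R.
Proof.
move=> mA mN mB AN ANB N0.
pose cp := \int[nu]_(x in B) ((EFin \o gu)^\+ x).
pose cn := \int[nu]_(x in B) ((EFin \o gu)^\- x).
have cp0 : 0 <= cp by exact: integral_ge0.
have cn0 : 0 <= cn by exact: integral_ge0.
pose fin := ((cp < +oo) && (cn < +oo))%E.
exists (if fin then 1%R else 0%R), (if fin then fine cp - fine cn else 0)%R => g gl il eA eB.
have sp (f : T -> \bar R) : (forall x, 0 <= f x) ->
    \int[nu]_(x in (A `|` N) `|` B) f x = \int[nu]_(x in A) f x + \int[nu]_(x in B) f x.
  move=> f0; rewrite lower_integral_setU//; last exact: measurableU.
  by rewrite lower_integral_setU// (lower_integral_null mN N0)// adde0.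
rewrite /Rintegral integralE !sp//.
have eAp : \int[nu]_(x in A) ((EFin \o g)^\+ x) = \int[nu]_(x in A) ((EFin \o gl)^\+ x).
  by apply: eq_on_integral => x Ax; rewrite !funeposE /= eA.
have eAn : \int[nu]_(x in A) ((EFin \o g)^\- x) = \int[nu]_(x in A) ((EFin \o gl)^\- x).
  by apply: eq_on_integral => x Ax; rewrite !funenegE /= eA.
have eBp : \int[nu]_(x in B) ((EFin \o g)^\+ x) = cp.
  by apply: eq_on_integral => x Bx; rewrite !funeposE /= eB.
have eBn : \int[nu]_(x in B) ((EFin \o g)^\- x) = cn.
  by apply: eq_on_integral => x Bx; rewrite !funenegE /= eB.
rewrite [X in fine X = _](_ : _ = (\int[nu]_(x in A) ((EFin \o gl)^\+ x) + cp) -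
   (\int[nu]_(x in A) ((EFin \o gl)^\- x) + cn)); last by rewrite -eAp -eAn -eBp -eBn.
rewrite [X in (_ * fine X + _)%R]integralE.
have fp : \int[nu]_(x in A) ((EFin \o gl)^\+ x) \is a fin_num.
  by apply: integrable_fin_num => //; exact: integrable_funepos.
have fn : \int[nu]_(x in A) ((EFin \o gl)^\- x) \is a fin_num.
  by apply: integrable_fin_num => //; exact: integrable_funeneg.
rewrite -[fun x => (gl x)%:E]/(EFin \o gl).
move: (\int[nu]_(x in A) _) (\int[nu]_(x in A) _) fp fn => [p||] [m||]//= _ _.
rewrite {}/fin; move: cp cn cp0 cn0 {eBp eBn} => [p'||] [m'||]//= _ _; rewrite ?ltry ?ltxx //= ?mul0r ?addr0//.
by rewrite mul1r; ring.
Qed.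

End LowerIntegral.

(** * Mixed differences of the action *)

Section ActionMixed.

Context {R : realType} {n : nat} {M : manifold R n}.
Local Notation mu := (@lebesgue_measure R).
Local Notation RR := (measurableTypeR R).
Local Notation mu2 := (mu \x mu)%E.

Variables (q : loop M) (eps : R) (w : (R * R) * R -> M).
Hypothesis fw : smooth_family eps q w.

Lemma pair_norm_lt (p : R * R) (r e : R) : `|p| < e -> `|r| < e -> `|(p.1, r)| < e.
Proof. by rewrite !prod_normE /= !gt_max => /andP[-> _] ->. Qed.

Lemma near_snd_lt (z : R * R) m : z.2 < m -> \forall y \near z, y.2 < m.
Proof.
move=> zm; apply: (@nbhs_open _ [set y : R * R | y.2 < m]) => //.
apply: (@open_comp _ _ snd [set y | y < m]); last exact: open_lt.
by move=> y _; exact: cvg_snd.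
Qed.

Lemma near_snd_gt (z : R * R) m : m < z.2 -> \forall y \near z, m < y.2.
Proof.
move=> zm; apply: (@nbhs_open _ [set y : R * R | m < y.2]) => //.
apply: (@open_comp _ _ snd [set y | m < y]); last exact: open_gt.
by move=> y _; exact: cvg_snd.
Qed.

Lemma family_loop v : `|v| < eps -> smooth_loop (fun t => w (v, t)).
Proof.
move=> ve; have [e0 sw pw _] := fw; split; last by move=> t; exact: pw.
apply: (@smooth_to_comp _ _ _ _ _ setT (cyl_set eps) (fun t : R => (v, t)) w) => //.
- exact: finite_basis_prod (finite_basis_prod finite_basis_R finite_basis_R) finite_basis_R.
- exact: openT.
- by move=> r; apply: Cr_pair; [exact: openT|exact: Cr_cst|exact: Cr_id].
Qed.

(** With [l = 1], the value [k = 1] contracts the loop of parameter [v] to [q] over the whole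
    height, and [k = 2] over the lower half. *)
Lemma family_cylinder (k l : R) v : 0 < k -> `|v| < eps ->
  let O := [set z : R * R | `|(l - k * z.2) *: v| < eps] in
  open O /\ smooth_to O (fun z : R * R => w ((l - k * z.2) *: v, z.1)).
Proof.
move=> k0 ve O; have [e0 sw pw _] := fw.
have sc r : Cr r setT (fun z : R * R => (l - k * z.2) *: v).
  apply: CrZ; [exact: openT| |exact: Cr_cst].
  apply: CrB; [exact: openT|exact: Cr_cst|].
  apply: CrM; [exact: openT|exact: Cr_cst|].
  by apply: Cr_snd; [exact: openT|exact: Cr_id].
have oO : open O.
  apply: (@open_comp _ _ (fun z : R * R => `|(l - k * z.2) *: v|) [set y | y < eps]); last exact: open_lt.
  move=> z _; apply: (@continuous_comp _ _ _ (fun z : R * R => (l - k * z.2) *: v) (fun y => `|y|)); last exact: norm_continuous.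
  exact: (sc 0).
split=> //.
apply: (@smooth_to_comp _ _ _ _ _ O (cyl_set eps) (fun z : R * R => ((l - k * z.2) *: v, z.1)) w) => //.
- exact: finite_basis_prod (finite_basis_prod finite_basis_R finite_basis_R) finite_basis_R.
- move=> r; apply: Cr_pair => //; first exact: Cr_sub (sc r).
  by apply: Cr_fst => //; exact: Cr_id.
Qed.

Lemma family_scale_small (x : R) (v : R * R) : `|v| < eps -> 0 <= x <= 1 -> `|x *: v| < eps.
Proof.
move=> ve /andP[x0 x1]; rewrite normrZ ger0_norm//; apply: le_lt_trans ve.
by rewrite ler_piMl.
Qed.

Lemma family_same_class v : `|v| < eps -> same_class (fun t => w (v, t)) q.
Proof.
move=> ve; have [e0 sw pw w0] := fw.
have [oO sO] := family_cylinder 1 ltr01 ve.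
exists (fun z : R * R => w ((1 - 1 * z.2) *: v, z.1)).
have h := @smooth_cylinder _ _ _ _ _ oO _ sO _.
have -> : q = (fun t => w ((1 - 1 * 1) *: v, t)).
  by apply/funext => t; rewrite mulr1 subrr scale0r w0.
have -> : (fun t => w (v, t)) = (fun t => w ((1 - 1 * 0) *: v, t)).
  by apply/funext => t; rewrite mulr0 subr0 scale1r.
apply: h => [z|t s] s01; first by apply: family_scale_small; rewrite // mul1r; move: s01; rewrite /strip /=; lra.
by rewrite /= pw//; apply: family_scale_small => //; lra.
Qed.

(* The lower half of a cylinder from the loop of parameters [x.1.1.1] and [x.1.2] to [ref q]:
   it contracts this loop to [q] at height 1/2.  The upper half does not depend on [x.1]. *)
Definition family_half (x : ((R * R) * R) * (R * R)) : M :=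
  w (((1 - 2 * x.2.2) * x.1.1.1, (1 - 2 * x.2.2) * x.1.2), x.2.1).

Definition half_dom : set (((R * R) * R) * (R * R)) :=
  [set x | `|((1 - 2 * x.2.2) * x.1.1.1, (1 - 2 * x.2.2) * x.1.2)| < eps].

Lemma smooth_family_half : open half_dom /\ smooth_to half_dom family_half.
Proof.
have [e0 sw pw _] := fw.
have oT : open [set: ((R * R) * R) * (R * R)] by exact: openT.
have s2 r : Cr r setT (fun x : ((R * R) * R) * (R * R) => x.2) by apply: Cr_snd => //; exact: Cr_id.
have s1 r : Cr r setT (fun x : ((R * R) * R) * (R * R) => x.1) by apply: Cr_fst => //; exact: Cr_id.
have sf r : Cr r setT (fun x : ((R * R) * R) * (R * R) => 1 - 2 * x.2.2).
  apply: CrB => //; first exact: Cr_cst.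
  by apply: CrM => //; [exact: Cr_cst|apply: Cr_snd].
have sc r : Cr r setT (fun x : ((R * R) * R) * (R * R) => ((1 - 2 * x.2.2) * x.1.1.1, (1 - 2 * x.2.2) * x.1.2)).
  apply: Cr_pair => //; apply: CrM => //; last exact: Cr_snd.
  by apply: Cr_fst => //; exact: Cr_fst.
have oO : open half_dom.
  apply: (@open_comp _ _ (fun x : ((R * R) * R) * (R * R) => `|((1 - 2 * x.2.2) * x.1.1.1, (1 - 2 * x.2.2) * x.1.2)|) [set y | y < eps]); last exact: open_lt.
  move=> z _; apply: continuous_comp (@norm_continuous _ _ _).
  exact: (sc 0).
split=> //.
apply: (@smooth_to_comp _ _ _ _ _ half_dom (cyl_set eps) (fun x : ((R * R) * R) * (R * R) => (((1 - 2 * x.2.2) * x.1.1.1, (1 - 2 * x.2.2) * x.1.2), x.2.1)) w) => //.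
- exact: finite_basis_prod (finite_basis_prod finite_basis_R finite_basis_R) finite_basis_R.
- move=> r; apply: Cr_pair => //; first exact: Cr_sub (sc r).
  by apply: Cr_fst => //; exact: Cr_sub (s2 r).
Qed.

Definition half_flux (sigma : two_tensor M) (x : ((R * R) * R) * (R * R)) : R :=
  sigma (family_half x) (tderiv family_half x (0, (1, 0))) (tderiv family_half x (0, (0, 1))).

(** The period shift [p.2] does not affect the flux; it is kept as a parameter so that both summands
    of the action are functions of the same variables. Up to the constants of [Rintegral_paste], the
    flux is the integral of the smooth function [half_flux]. *)
Lemma flux_mixed (sigma : two_tensor M) (ref : loop M -> loop M) (A : loop M -> R) :
  is_two_tensor sigma -> reference_loops ref -> flux_functional sigma ref A ->
  exists l1 l2, mixed_differentiable (fun p r => A (fun t => w ((p.1, r), t))) l1 l2.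
Proof.
move=> ts [ref1 ref2] fA; have [e0 sw pw w0] := fw.
have e00 : `|(0 : R * R)| < eps by rewrite normr0.
have sq : smooth_loop q.
  by have := family_loop e00; rewrite (_ : (fun t => w (0, t)) = q)//; exact/funext.
have wq := smooth_loop_W12 sq.
have [_ [h hh]] := ref1 q wq.
have [oU sU] := smooth_family_half.
have sG : smooth_on half_dom (half_flux sigma) := smooth_two_tensor _ _ ts oU sU.
(* The height 1/2 is excluded from both halves: only off the seam are the derivatives of the glued
   cylinder those of one half. *)
pose A0 : set (RR * RR) := `[0, 1]%classic `*` `[0, 2^-1[%classic.
pose N : set (RR * RR) := rect 0 1 2^-1 2^-1.
pose B0 : set (RR * RR) := `[0, 1]%classic `*` `]2^-1, 1]%classic.
have mA0 : measurable A0 by apply: measurableX; exact: measurable_itv.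
have mB0 : measurable B0 by apply: measurableX; exact: measurable_itv.
have mN : measurable N by exact: measurable_rect.
have AN : A0 `&` N = set0.
  by rewrite -subset0 => -[t s] [[_ /=]]; rewrite in_itv /= => s1 [_ /=]; rewrite in_itv /= => s2; lra.
have ANB : (A0 `|` N) `&` B0 = set0.
  by rewrite -subset0 => -[t s] [[[_ /=]|[_ /=]]]; rewrite in_itv /= => s1 [_ /=]; rewrite in_itv /= => s2; lra.
have ANBE : `[0, 1]%classic `*` `[0, 1]%classic = (A0 `|` N) `|` B0.
  apply/seteqP; split => [[t s]|[t s]]; rewrite /A0 /N /B0 /rect /= !in_itv /=.
    move=> [-> s01]; have [sm|sm] := ltP s 2^-1; first by left; left; split=> //; lra.
    by have [ms|ms] := ltP 2^-1 s; [right|left; right]; split=> //; lra.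
  by move=> [[[-> ?]|[-> ?]]|[-> ?]]; split => //; lra.
have A0r : A0 `<=` rect 0 1 0 2^-1.
  by move=> [t s] [t1 /=]; rewrite in_itv /= => s1; split=> //=; rewrite in_itv /=; lra.
pose hs := h \o stretch 2 (-1).
pose gu z := sigma (hs z) (tderiv hs z (1, 0)) (tderiv hs z (0, 1)).
(* The constants depend on the fixed upper half alone and are chosen before the parameters [p] and
   [r]. *)
have [kap [c hkc]] := Rintegral_paste (nu := mu2) gu mA0 mN mB0 AN ANB (mu2_line 0 1 2^-1).
have KU x z : `|(x.1.1, x.2)| < eps -> rect 0 1 0 2^-1 z -> half_dom (x, z).
  move=> xe [_ /=]; rewrite in_itv /= => z2; rewrite /half_dom /=.
  have := @family_scale_small (1 - 2 * z.2) _ xe; apply; lra.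
have AE p r : `|p| < eps -> `|r| < eps ->
    A (fun t => w ((p.1, r), t)) = kap * \int[mu2]_(z in A0) half_flux sigma ((p, r), z) + c.
  move=> pe re; pose v := (p.1, r).
  have ve : `|v| < eps by exact: pair_norm_lt.
  have [oO sO] := family_cylinder 1 (ltr0Sn R 1) ve.
  set fv := (fun z => w _) in sO.
  have half s : 0 <= s <= 2^-1 -> `|(1 - 2 * s) *: v| < eps.
    by move=> s01; apply: family_scale_small => //; lra.
  have pfv t s : 0 <= s <= 2^-1 -> fv (t + 1, s) = fv (t, s) by move=> /half; exact: pw.
  have fq t : fv (t, 2^-1) = q t.
    by rewrite /fv /= mulfV// subrr scale0r w0.
  have gc := glue_cylinder oO sO (fun t s s01 => half s s01) pfv fq hh.
  have wl : (fun t => fv (t, 0)) = (fun t => w (v, t)).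
    by apply/funext => t; rewrite /fv /= mulr0 subr0 scale1r.
  rewrite wl in gc.
  have wv := smooth_loop_W12 (family_loop ve).
  (* All loops of the family are in the class of [q], hence have the same reference loop, at which
     the fixed upper half ends. *)
  rewrite -(ref2 _ _ wv wq (family_same_class ve)) in gc.
  have lowE (z : R * R) : z.2 < 2^-1 -> sigma (glue_cyl fv h z) (tderiv (glue_cyl fv h) z (1, 0))
      (tderiv (glue_cyl fv h) z (0, 1)) = half_flux sigma ((p, r), z).
    move=> z2; have He : \forall y \near z, glue_cyl fv h y = (family_half \o (fun z => ((p, r), z))) y.
      by apply: filterS (near_snd_lt z2) => y /ltW yl; rewrite /glue_cyl yl.
    rewrite !(tderiv_near _ He) (nbhs_singleton He) /half_flux.
    by rewrite (@tderiv_affine _ _ _ _ _ family_half (fun z => ((p, r), z)) z (1, 0) (0, (1, 0)))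
      ?(@tderiv_affine _ _ _ _ _ family_half (fun z => ((p, r), z)) z (0, 1) (0, (0, 1)))// => k;
      apply: injective_projections => //=; rewrite scaler0 add0r.
  have upE (z : R * R) : 2^-1 < z.2 -> sigma (glue_cyl fv h z) (tderiv (glue_cyl fv h) z (1, 0))
      (tderiv (glue_cyl fv h) z (0, 1)) = gu z.
    move=> z2; have He : \forall y \near z, glue_cyl fv h y = hs y.
      by apply: filterS (near_snd_gt z2) => y yl; rewrite (glue_up fq hh)//= ltW.
    by rewrite !(tderiv_near _ He) (nbhs_singleton He).
  rewrite (fA _ _ wv gc) /cylinder_integral ANBE; apply: hkc.
  - apply: (integrableS _ mA0 A0r); first exact: measurable_rect.
    have cs (z : R * R) : {for z, continuous (fun z : R * R => ((p, r), z))}.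
      apply: (@Cr_continuous _ 0 _ _ setT) => //.
      by apply: Cr_pair; [exact: openT|exact: Cr_cst|exact: Cr_id].
    apply: (@continuous_integrable_rect _ _ _ _ _ _ ((fun z : R * R => ((p, r), z)) @^-1` half_dom)) => //.
    + by move=> z; apply: KU.
    + move=> z hz; apply: (@continuous_comp _ _ _ (fun z : R * R => ((p, r), z)) (half_flux sigma)); first exact: cs.
      exact: (sG 0%N).
  - move=> z [_ /=]; rewrite in_itv /= => /andP[_ z2]; exact: lowE.
  - move=> z [_ /=]; rewrite in_itv /= => /andP[z2 _]; exact: upE.
have [l1 [l2 hl]] : exists l1 l2, mixed_differentiable (fun p r => \int[mu2]_(z in A0) half_flux sigma ((p, r), z)) l1 l2.
  apply: (@mixed_differentiable_integral _ _ half_dom (half_flux sigma) _ _ mu2 A0 idfun (rect 0 1 0 2^-1)) => //.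
  - exact: compact_rect.
  - by move=> z; apply: KU; rewrite -[(0, 0)]/(0 : R * R).
  - apply: le_lt_trans (mu2_rect_fin 0 1 0 2^-1).
    by apply: le_measure => //; rewrite inE//; exact: measurable_rect.
  - move=> g O oO KO cg; apply: (integrableS _ mA0 A0r); first exact: measurable_rect.
    exact: (continuous_integrable_rect oO).
exists (kap * l1 + 0), (kap * l2 + 0).
apply: (@mixed_differentiable_eq _ (fun p r => kap * \int[mu2]_(z in A0) half_flux sigma ((p, r), z) + c) _ _ _ eps) => //.
  by move=> p r pe re; rewrite AE.
apply: (mixed_differentiable_comb kap hl (G := fun _ _ => c)) => e ep.
exists 1 => // p r _ _; rewrite /mixed subrr sub0r addNr !mulr0 addr0 mulr0 subrr normr0.
by rewrite !mulr_ge0// ?ltW// addr_ge0.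
Qed.

Definition family_time (x : ((R * R) * R) * R) : M := w ((x.1.1.1, x.1.2), x.2).

Definition time_dom (T b : R) : set (((R * R) * R) * R) :=
  [set x | `|(x.1.1.1, x.1.2)| < eps /\ 0 < T + x.1.1.2 + x.1.2 * b].

(** The period stands inside the integral, so that the whole energy term is the integral of one
    smooth function of the parameters and of time. *)
Definition time_energy (L : tangent_fun M) (k T b : R) (x : ((R * R) * R) * R) : R :=
  (T + x.1.1.2 + x.1.2 * b) *
  (L (family_time x) ((T + x.1.1.2 + x.1.2 * b)^-1 *: tderiv family_time x (0, 1)) + k).

Lemma smooth_time_energy (L : tangent_fun M) (k T b : R) :
  (forall c : chart M, smooth_on (im c `*` setT) (tangent_in L c)) ->
  open (time_dom T b) /\ smooth_on (time_dom T b) (time_energy L k T b).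
Proof.
move=> sL; have [e0 sw pw _] := fw.
have oT : open [set: ((R * R) * R) * R] by exact: openT.
have s1 r : Cr r setT (fun x : ((R * R) * R) * R => x.1) by apply: Cr_fst => //; exact: Cr_id.
have s11 r : Cr r setT (fun x : ((R * R) * R) * R => x.1.1) by exact: Cr_fst.
have s12 r : Cr r setT (fun x : ((R * R) * R) * R => x.1.2) by exact: Cr_snd.
have sv r : Cr r setT (fun x : ((R * R) * R) * R => (x.1.1.1, x.1.2)).
  by apply: Cr_pair => //; exact: Cr_fst.
have st r : Cr r setT (fun x : ((R * R) * R) * R => T + x.1.1.2 + x.1.2 * b).
  apply: CrD => //; last by apply: CrM => //; exact: Cr_cst.
  by apply: CrD => //; [exact: Cr_cst|exact: Cr_snd].
have oU : open (time_dom T b).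
  have -> : time_dom T b = [set x : ((R * R) * R) * R | `|(x.1.1.1, x.1.2)| < eps] `&`
     [set x : ((R * R) * R) * R | 0 < T + x.1.1.2 + x.1.2 * b] by [].
  apply: openI.
    apply: (@open_comp _ _ (fun x : ((R * R) * R) * R => `|(x.1.1.1, x.1.2)|) [set y | y < eps]); last exact: open_lt.
    move=> z _; apply: (@continuous_comp _ _ _ (fun x : ((R * R) * R) * R => (x.1.1.1, x.1.2)) (fun y => `|y|)); last exact: norm_continuous.
    exact: (sv 0).
  apply: (@open_comp _ _ (fun x : ((R * R) * R) * R => T + x.1.1.2 + x.1.2 * b) [set y | 0 < y]); last exact: open_gt.
  by move=> z _; exact: (st 0).
split=> // r.
have sU : smooth_to (time_dom T b) family_time.
  apply: (@smooth_to_comp _ _ _ _ _ (time_dom T b) (cyl_set eps) (fun x : ((R * R) * R) * R => ((x.1.1.1, x.1.2), x.2)) w) => //.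
  - exact: finite_basis_prod (finite_basis_prod finite_basis_R finite_basis_R) finite_basis_R.
  - by move=> x [].
  - move=> m; apply: Cr_pair => //; first exact: Cr_sub (sv m).
    by apply: Cr_snd => //; exact: Cr_id.
have sinv : smooth_on (time_dom T b) (fun x : ((R * R) * R) * R => (T + x.1.1.2 + x.1.2 * b)^-1).
  by move=> m; apply: Cr_inv => // [x [_ x0]|]; [rewrite gt_eqF|exact: Cr_sub (st m)].
apply: CrM => //; first exact: Cr_sub (st r).
apply: CrD => //; last exact: Cr_cst.
exact: (@smooth_tangent_fun _ _ _ _ L (time_dom T b) family_time _ (0, 1) sL oU sU sinv r).
Qed.

Lemma energy_mixed (L : tangent_fun M) (k T b : R) : 0 < T ->
  (forall c : chart M, smooth_on (im c `*` setT) (tangent_in L c)) ->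
  exists l1 l2, mixed_differentiable (fun p r => (T + p.2 + r * b) *
    \int[mu]_(t in `[0, 1]) (L (w ((p.1, r), t))
       ((T + p.2 + r * b)^-1 *: velocity (fun t => w ((p.1, r), t)) t) + k)) l1 l2.
Proof.
move=> T0 sL; have [e0 sw pw _] := fw.
have [oU sf] := smooth_time_energy k T b sL.
have m01 : measurable (`[0, 1]%classic : set RR) by exact: measurable_itv.
(* Within this radius the period changes by less than [T / 2] and stays positive. *)
pose d0 := Num.min eps (T / (2 * (1 + `|b|))).
have b0 : 0 < 1 + `|b| by rewrite ltr_pwDl.
have d00 : 0 < d0 by rewrite lt_min e0 divr_gt0// mulr_gt0.
have U0 p r t : `|p| < d0 -> `|r| < d0 -> time_dom T b ((p, r), t).
  rewrite !lt_min => /andP[pe pt] /andP[re rt]; split=> /=; first exact: pair_norm_lt.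
  have p2 : `|p.2| < T / (2 * (1 + `|b|)).
    by move: pt; rewrite prod_normE gt_max => /andP[].
  have rb : `|r * b| <= T / (2 * (1 + `|b|)) * `|b|.
    by rewrite normrM ler_wpM2r// ltW.
  have e1 : T / (2 * (1 + `|b|)) * (1 + `|b|) = T / 2 by field; rewrite gt_eqF.
  move: p2 rb; rewrite mulrDr mulr1 in e1; rewrite ltr_norml ler_norml => /andP[? ?] /andP[? ?].
  by lra.
have [l1 [l2 hl]] : exists l1 l2, mixed_differentiable (fun p r => \int[mu]_(t in `[0, 1]) time_energy L k T b ((p, r), t)) l1 l2.
  apply: (@mixed_differentiable_integral _ _ (time_dom T b) (time_energy L k T b) _ _ mu `[0, 1]%classic idfun `[0, 1]%classic) => //.
  - exact: segment_compact.
  - by move=> t _; apply: U0; rewrite ?normr0// -[(0, 0)]/(0 : R * R) normr0.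
  - exact: mu_itv_fin.
  - by move=> g O oO KO cg; exact: (continuous_integrable_itv oO).
exists l1, l2.
apply: (mixed_differentiable_eq d00 _ hl) => p r pd rd.
have vE t : velocity (fun t => w ((p.1, r), t)) t = tderiv family_time ((p, r), t) (0, 1).
  rewrite /velocity -[fun t => w _]/(family_time \o (fun t => ((p, r), t))).
  by apply: tderiv_affine => h; apply: injective_projections => //=; rewrite scaler0 add0r.
pose tau := T + p.2 + r * b.
pose g t := L (w ((p.1, r), t)) (tau^-1 *: velocity (fun t => w ((p.1, r), t)) t) + k.
have gE t : time_energy L k T b ((p, r), t) = tau * g t by rewrite /g vE.
have tau0 : tau != 0 by have [_ /= h] := U0 p r 0 pd rd; rewrite gt_eqF.
have ie : mu.-integrable `[0, 1] (EFin \o (fun t => time_energy L k T b ((p, r), t))).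
  have cs (t : R) : {for t, continuous (fun t : R => ((p, r), t))}.
    apply: (@Cr_continuous _ 0 _ _ setT) => //.
    by apply: Cr_pair; [exact: openT|exact: Cr_cst|exact: Cr_id].
  apply: continuous_integrable_cc; apply: continuous_in_subspaceT => t _.
  apply: (@continuous_comp _ _ _ (fun t : R => ((p, r), t)) (time_energy L k T b)); first exact: cs.
  by apply: (sf 0%N); exact: U0.
have ig : mu.-integrable `[0, 1] (EFin \o g).
  have := integrable_scale tau^-1 m01 ie; apply: eq_integrable => // t _.
  by rewrite /= gE mulKf.
rewrite -[RHS]/(tau * \int[mu]_(t in `[0, 1]) g t) -(RintegralZl tau m01 ig).
by apply: eq_Rintegral => t _; rewrite gE.
Qed.

End ActionMixed.

(** * First and second variations read off the mixed coefficients *)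

Section Calculus.

Context {R : realType}.

Lemma is_derive_estimate (f : R -> R) d e : is_derive (0 : R) (1 : R) f d -> 0 < e ->
  exists2 delta, 0 < delta & forall r, `|r| < delta -> `|f r - f 0 - d * r| <= e * `|r|.
Proof.
move=> df e0; have [/derivable1P] := df; move=> _ _.
have : h^-1 *: (f (h *: 1 + 0) - f 0) @[h --> (0 : R)^'] --> d.
  by have [c <-] := df; exact: c.
move=> /cvgrPdist_le /(_ e e0) [delta /= d0 hd]; exists delta => // r rd.
have [->|r0] := eqVneq r 0; first by rewrite subrr mulr0 subr0 normr0 mulr0.
have := hd r; rewrite /= sub0r normrN => /(_ rd r0).
rewrite addr0 -[r *: 1]/(r * 1) mulr1 -[_ *: (_ - _)]/(_ * _) => h.
have -> : f r - f 0 - d * r = - (r * (d - r^-1 * (f r - f 0))) by field.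
by rewrite normrN normrM mulrC ler_wpM2r.
Qed.

(** The second derivative exists at 0 only, so the remainder is estimated by the mean value theorem
    for [f] minus its quadratic part, using differentiability of [derive1 f] at 0. *)
Lemma second_order_taylor (f : R -> R) d e : second_derivative_at0 f d ->
  is_derive (0 : R) (1 : R) f 0 -> 0 < e ->
  exists2 delta, 0 < delta & forall r, `|r| < delta -> `|f r - f 0 - d / 2 * r ^+ 2| <= e * r ^+ 2.
Proof.
move=> [/nbhs_ballP[d1 /= d10 nd] d2] d3 e0.
have [d4 d40 h] := is_derive_estimate d2 e0.
have f'0 : derive1 f 0 = 0 by rewrite derive1E; case: d3.
exists (Num.min d1 d4) => [|r]; first by rewrite lt_min d10.
rewrite lt_min => /andP[r1 r2].
pose g x := f (x * r) - d / 2 * (x * r) ^+ 2.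
have dg (x : R) : 0 <= x <= 1 -> is_derive (x : R) (1 : R) g (r * (derive1 f (x * r) - d * (x * r))).
  move=> /andP[x0 x1].
  have dm : is_derive (x : R) (1 : R) (fun x : R => x * r) r.
    have := is_deriveM (is_derive_id (x : R) (1 : R)) (is_derive_cst r x 1).
    by rewrite scaler0 add0r -[r *: 1]/(r * 1) mulr1.
  have xr : `|x * r| < d1.
    by rewrite normrM (ger0_norm x0); apply: le_lt_trans r1; rewrite ler_piMl.
  have df : is_derive (x * r : R) (1 : R) f (derive1 f (x * r)).
    by rewrite derive1E; apply/derivableP; apply: nd; rewrite /ball /= sub0r normrN.
  have d5 := @is_derive1_comp _ f (fun x : R => x * r) x _ _ df dm.
  have d6 := is_deriveM (is_derive_cst (d / 2) x 1) (is_deriveM dm dm).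
  have := is_deriveB d5 d6.
  rewrite scaler0 addr0 -![_ *: _]/(_ * _) (_ : _ - _ = r * (derive1 f (x * r) - d * (x * r))).
    rewrite (_ : _ - _ = g)//.
  by rewrite /cst; field.
have [|| c c01 ce] := @MVT_segment R g (fun x => r * (derive1 f (x * r) - d * (x * r))) 0 1 ler01.
- by move=> x; rewrite in_itv /= => /andP[x0 x1]; apply: dg; rewrite !ltW.
- apply: derivable_within_continuous => x; rewrite in_itv /= => x01.
  by have := dg x x01; case.
move: c01; rewrite in_itv /= => /andP[c0 c1].
have -> : f r - f 0 - d / 2 * r ^+ 2 = g 1 - g 0 by rewrite /g !mul1r !mul0r expr0n /= mulr0 subr0 addrAC.
rewrite ce subr0 mulr1 normrM.
have cr : `|c * r| <= `|r| by rewrite normrM (ger0_norm c0) ler_piMl.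
have := h (c * r) (le_lt_trans cr r2); rewrite f'0 subr0 => h1.
apply: le_trans (ler_wpM2l (normr_ge0 r) h1) _.
rewrite mulrCA -[r ^+ 2]real_normK ?num_real// expr2.
by apply: (ler_wpM2l (ltW e0)); exact: ler_wpM2l.
Qed.

Lemma second_derivative_unique (f : R -> R) d d' :
  second_derivative_at0 f d -> second_derivative_at0 f d' -> d = d'.
Proof. by move=> [_ [_ <-]] [_ [_ <-]]. Qed.

Lemma le_eps_eq0 (x K : R) : 0 <= K -> (forall e, 0 < e -> `|x| <= e * K) -> x = 0.
Proof.
move=> K0 h; apply/eqP; rewrite -normr_le0 leNgt; apply/negP => x0.
have := h (`|x| / (2 * (K + 1))); rewrite divr_gt0 ?mulr_gt0 ?ltr_wpDl// => /(_ isT).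
rewrite leNgt => /negP; apply; rewrite -mulrA gtr_pMr// mulrC ltr_pdivrMr ?mulr_gt0 ?ltr_wpDl//.
by rewrite mul1r; lra.
Qed.

(** On the diagonal the mixed error is at most [e * x ^+ 2 * (1 + |T'|)], of the same order as the
    error of the second-order expansion. *)
Lemma mixed_second (Phi : R * R -> R -> R) l1 l2 T' c : mixed_differentiable Phi l1 l2 ->
  (forall e, 0 < e -> exists2 d, 0 < d & forall x, `|x| < d ->
     `|mixed Phi (x, x * T') x - c * x ^+ 2| <= e * x ^+ 2) ->
  c = l1 + T' * l2.
Proof.
move=> hm hc; apply/eqP; rewrite -subr_eq0; apply/eqP.
apply: (@le_eps_eq0 _ (1 + (1 + `|T'|))) => [|e e0]; first by rewrite !addr_ge0.
have [d1 d10 h1] := hm e e0; have [d2 d20 h2] := hc e e0.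
pose x := Num.min (Num.min (d1 / 2) (d1 / (2 * (1 + `|T'|)))) (d2 / 2).
have t0 : 0 < 1 + `|T'| by rewrite ltr_pwDl.
have x0 : 0 < x by rewrite !lt_min !divr_gt0// mulr_gt0.
have xd1 : x <= d1 / 2 by rewrite /x !ge_min lexx.
have xd1' : x <= d1 / (2 * (1 + `|T'|)) by rewrite /x !ge_min lexx orbT.
have xd2 : x <= d2 / 2 by rewrite /x !ge_min lexx !orbT.
have xT : `|x * T'| < d1.
  rewrite normrM gtr0_norm//; have := ler_wpM2r (ltW t0) xd1'.
  rewrite (_ : d1 / _ * _ = d1 / 2); last by field; rewrite gt_eqF.
  by rewrite mulrDr mulr1; lra.
have {}h1 := h1 (x, x * T') x; rewrite prod_normE /= gt_max gtr0_norm// xT in h1.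
have {}h1 := h1 ltac:(by rewrite andbT; lra) ltac:(lra).
have {}h2 := h2 x; rewrite gtr0_norm// in h2; have {}h2 := h2 ltac:(lra).
have x2 : 0 < x ^+ 2 by rewrite exprn_gt0.
rewrite -(ler_pM2r x2) -[X in _ * X <= _]gtr0_norm// -normrM.
rewrite (_ : _ * x ^+ 2 = (mixed Phi (x, x * T') x - x * (x * l1 + x * T' * l2)) -
  (mixed Phi (x, x * T') x - c * x ^+ 2)); last by ring.
apply: le_trans (ler_normB _ _) _.
rewrite normrM (gtr0_norm x0) in h1.
rewrite [leRHS](_ : _ = e * x * (x + x * `|T'|) + e * x ^+ 2); last by ring.
exact: lerD.
Qed.

(** Here [r] tends to 0 before [s] does. For fixed [s], division by [r] compares [- (s * b)] with
    [s * l1 + P s * l2] up to [e * (|s| + |P s|)]; division by [s] then turns [P s] into [T']. *)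
Lemma mixed_first (Phi : R * R -> R -> R) l1 l2 T' b (P : R -> R) :
  mixed_differentiable Phi l1 l2 -> P 0 = 0 -> is_derive (0 : R) (1 : R) P T' ->
  (\forall s \near (0 : R), is_derive (0 : R) (1 : R) (Phi (s, P s)) (- (s * b))) ->
  - b = l1 + T' * l2.
Proof.
move=> hm P0 dP hd; apply/eqP; rewrite -subr_eq0; apply/eqP.
apply: (@le_eps_eq0 _ (1 + (1 + `|T'|) + `|l2|)) => [|e0 e00]; first by rewrite !addr_ge0.
(* The cap 1 gives the linear bound [|P s| <= (|T'| + 1) * s], which does not depend on [e]. *)
pose e := Num.min e0 1.
have e_0 : 0 < e by rewrite lt_min e00 ltr01.
have ee0 : e <= e0 by rewrite ge_min lexx.
have e1 : e <= 1 by rewrite ge_min lexx orbT.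
have [d1 d10 h1] := hm e e_0; have [d2 d20 h2] := is_derive_estimate dP e_0.
have /nbhs_ballP[d3 /= d30 h3] := hd.
have t0 : 0 < 2 + `|T'| by rewrite ltr_pwDl.
pose s := Num.min (Num.min (d1 / 2) (d1 / (2 * (2 + `|T'|)))) (Num.min (d2 / 2) (d3 / 2)).
have s0 : 0 < s by rewrite !lt_min !divr_gt0// mulr_gt0.
have sd1 : s <= d1 / 2 by rewrite /s !ge_min lexx.
have sd1' : s <= d1 / (2 * (2 + `|T'|)) by rewrite /s !ge_min lexx orbT.
have sd2 : s <= d2 / 2 by rewrite /s !ge_min lexx !orbT.
have sd3 : s <= d3 / 2 by rewrite /s !ge_min lexx !orbT.
have sd2' : `|s| < d2 by rewrite gtr0_norm//; lra.
have Ps := h2 s sd2'; rewrite P0 subr0 (gtr0_norm s0) in Ps.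
have Ps' : `|P s| <= (`|T'| + 1) * s.
  rewrite -(subrK (T' * s) (P s)); apply: le_trans (ler_normD _ _) _.
  rewrite normrM (gtr0_norm s0) mulrDl mul1r addrC lerD2l.
  by apply: le_trans Ps _; rewrite ler_piMl// ltW.
have Psd : `|P s| < d1.
  apply: le_lt_trans Ps' _; have := ler_wpM2r (ltW t0) sd1'.
  rewrite (_ : d1 / _ * _ = d1 / 2); last by field; rewrite gt_eqF.
  by nra.
have pd : `|(s, P s)| < d1.
  by rewrite prod_normE /= gt_max Psd andbT gtr0_norm//; lra.
have D1 : is_derive (0 : R) (1 : R) (Phi (s, P s)) (- (s * b)).
  by apply: h3; rewrite /ball /= sub0r normrN gtr0_norm//; lra.
have D0 : is_derive (0 : R) (1 : R) (Phi (0, 0)) 0.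
  have := h3 0; rewrite P0 mul0r oppr0; apply.
  by rewrite /ball /= subrr normr0.
pose S := `|s| + `|P s|.
have S0 : 0 <= S by rewrite addr_ge0.
(* Proved up to an arbitrary [e'], the error of the first-order expansion in [r], by choosing [r]
   after [s] and dividing by [r]. *)
have key : `|- (s * b) - (s * l1 + P s * l2)| <= e * S.
  apply/ler_addgt0Pr => e' e'0.
  have [d4 d40 h4] := is_derive_estimate (is_deriveB D1 D0) e'0.
  pose r := Num.min (d1 / 2) (d4 / 2).
  have r0 : 0 < r by rewrite lt_min !divr_gt0.
  have rd1 : r <= d1 / 2 by rewrite /r !ge_min lexx.
  have rd4 : r <= d4 / 2 by rewrite /r !ge_min lexx orbT.
  have {}h4 := h4 r; rewrite gtr0_norm// in h4; have {}h4 := h4 ltac:(lra).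
  have {}h1 := h1 (s, P s) r pd; rewrite (gtr0_norm r0) in h1; have {}h1 := h1 ltac:(lra).
  rewrite -(ler_pM2r r0) -[X in _ * X <= _](gtr0_norm r0) -normrM.
  have -> : (- (s * b) - (s * l1 + P s * l2)) * r =
     (mixed Phi (s, P s) r - r * (s * l1 + P s * l2)) -
     ((Phi (s, P s) - Phi (0, 0)) r - (Phi (s, P s) - Phi (0, 0)) 0 - (- (s * b) - 0) * r).
    rewrite /mixed -![(Phi (s, P s) - Phi (0, 0)) _]/(Phi (s, P s) _ - Phi (0, 0) _); ring.
  apply: le_trans (ler_normB _ _) _; rewrite [leRHS]mulrDl; apply: lerD => //.
  by rewrite mulrAC.
rewrite -(ler_pM2r s0) -[X in _ * X <= _](gtr0_norm s0) -normrM.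
have -> : (- b - (l1 + T' * l2)) * s = (- (s * b) - (s * l1 + P s * l2)) + (P s - T' * s) * l2 by ring.
apply: le_trans (ler_normD _ _) _; rewrite normrM.
have k1 : `|P s - T' * s| * `|l2| <= e * s * `|l2| by rewrite ler_wpM2r.
have k2 : e * S <= e * (s + (`|T'| + 1) * s) by apply: (ler_wpM2l (ltW e_0)); rewrite /S (gtr0_norm s0) lerD2l.
have k3 : e * (s * (1 + (1 + `|T'|) + `|l2|)) <= e0 * (s * (1 + (1 + `|T'|) + `|l2|)).
  by rewrite ler_wpM2r// mulr_ge0 ?ltW// ltr_wpDr ?addr_gt0// ltr_pwDl.
have k4 : e * (s + (`|T'| + 1) * s) + e * s * `|l2| = e * (s * (1 + (1 + `|T'|) + `|l2|)) by ring.
have k5 : e0 * (1 + (1 + `|T'|) + `|l2|) * s = e0 * (s * (1 + (1 + `|T'|) + `|l2|)) by ring.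
rewrite k5; lra.
Qed.

End Calculus.

(** * The index of a form with a distinguished orthogonal vector *)

Section Index.

Context {R : realType} {X : lmodType R} (E : set X).
Variables (B : X * R -> X * R -> R) (C : X -> X -> R) (zeta : X) (T' : R).
Hypothesis E_comb : forall a x y, E x -> E y -> E (a *: x + y).
Hypothesis E_zeta : E zeta.
Hypothesis B_sym : symmetric_bilinear_on [set x : X * R | E x.1] B.
Hypothesis BC : forall x, E x -> B (x, 0) (x, 0) = C x x.
Hypothesis B_cross : forall x b, E x -> B (zeta, T') (x, b) = - b.
Hypothesis T'0 : T' != 0.

Lemma E_zero : E 0.
Proof. by have := E_comb (-1) E_zeta E_zeta; rewrite scaleN1r addNr. Qed.

Lemma C_zero : C 0 0 = 0.
Proof.
have [_ lin] := B_sym; have E0 := E_zero; rewrite -BC//.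
have := lin (-1) (0, 0) (0, 0) (0, 0) E0 E0 E0.
have -> : -1 *: (0, 0) + (0, 0) = (0, 0) :> X * R.
  by rewrite -[(0, 0)]/(0 : X * R) scaleN1r addNr.
by rewrite mulN1r addNr.
Qed.

Lemma E_sum m (a : 'I_m -> R) (x : 'I_m -> X) : (forall i, E (x i)) ->
  E (\sum_i a i *: x i).
Proof.
move=> Ex; elim: (index_enum _) => [|i s IH]; first by rewrite big_nil; exact: E_zero.
by rewrite big_cons; exact: E_comb.
Qed.

Lemma square_expand (e f : X * R) a : E e.1 -> E f.1 ->
  B (a *: e + f) (a *: e + f) = a ^+ 2 * B e e + 2 * a * B e f + B f f.
Proof.
move=> Ee Ef; have [sym lin] := B_sym.
have Eef : E (a *: e + f).1 by exact: E_comb.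
have l1 z : E z.1 -> B (a *: e + f) z = a * B e z + B f z by move=> Ez; exact: (lin a e f z).
rewrite (l1 _ Eef) (sym e _ Ee Eef) (l1 _ Ee) (sym f _ Ef Eef) (l1 _ Ef) (sym f e Ef Ee); ring.
Qed.

(** Completion of the square along [(zeta, T')]: this vector is orthogonal to the vectors with
    [b = 0], and its own square is [- T']. *)
Lemma reduced_square x b : E x ->
  B (x, b) (x, b) = C (x - (b / T') *: zeta) (x - (b / T') *: zeta) - b ^+ 2 / T'.
Proof.
move=> Ex; set x' := x - _.
have Ex' : E x' by rewrite /x' addrC -scaleNr; exact: E_comb.
have -> : (x, b) = (b / T') *: (zeta, T') + (x', 0).
  apply: injective_projections => /=; first by rewrite /x' addrC subrK.
  by rewrite addr0 -[_ *: _]/(_ * _) divfK.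
rewrite square_expand// !B_cross// BC// -[C x' x']/(C x' x').
by field.
Qed.

Lemma sum_pair m (a : 'I_m -> R) (x : 'I_m -> X * R) :
  \sum_i a i *: x i = (\sum_i a i *: (x i).1, \sum_i a i * (x i).2).
Proof.
elim/big_rec3: _ => // i y1 y2 y3 _ ->.
by apply: injective_projections.
Qed.

(** If [T' > 0], the vector [(zeta, T')] has negative square and is adjoined to a negative subspace
    of [C], to which it is orthogonal. *)
Lemma index_lower i iT : negative_index [set x : X * R | E x.1] B i ->
  negative_subspace E C iT -> (iT + (0 < T')%R <= i)%N.
Proof.
move=> [_ imax] [e [Ee eneg]]; apply: imax.
have [T'p|] := ltP 0 T'; last first.
  move=> _; rewrite addn0; exists (fun j => (e j, 0)); split=> // a ane.
  have z : \sum_(i < iT) a i * 0 = 0 :> R by rewrite big1// => j _; rewrite mulr0.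
  by rewrite sum_pair /= z BC; [exact: eneg|exact: E_sum].
rewrite addn1.
exists (fun j => if unlift ord_max j is Some j' then (e j', 0) else (zeta, T')); split=> [j|a [j aj]].
  by case: unliftP => [j' _|_] /=.
rewrite big_ord_recr /= unlift_none addrC.
rewrite (eq_bigr (fun j : 'I_iT => a (widen_ord (leqnSn iT) j) *: (e j, 0))); last first.
  move=> j' _; have -> : widen_ord (leqnSn iT) j' = lift ord_max j'.
    by apply: val_inj; rewrite /= /bump leqNgt ltn_ord.
  by rewrite liftK.
have z : \sum_(i < iT) a (widen_ord (leqnSn iT) i) * 0 = 0 :> R by rewrite big1// => j' _; rewrite mulr0.
rewrite sum_pair /= z {z}.
set x := \sum_j _; have Ex : E x by exact: E_sum.
rewrite square_expand// !B_cross// oppr0 mulr0 addr0 BC//.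
have [am|am] := eqVneq (a ord_max) 0.
  rewrite am expr0n mul0r add0r; apply: eneg.
  have [j' jE] : exists j', j = lift ord_max j'.
    case: (unliftP ord_max j) => [j' ->|jE]; first by exists j'.
    by rewrite jE am eqxx in aj.
  exists j'; rewrite (_ : widen_ord _ _ = j)// jE.
  by apply: val_inj; rewrite /= /bump leqNgt ltn_ord.
have a2 : 0 < a ord_max ^+ 2 by rewrite exprn_even_gt0.
have h1 : a ord_max ^+ 2 * - T' < 0 by rewrite mulrN oppr_lt0 mulr_gt0.
rewrite -[ltRHS]addr0; apply: ltr_leD => //.
have [z|nz] := pselect (exists j', a (widen_ord (leqnSn iT) j') != 0); first exact/ltW/eneg.
rewrite /x big1 => [|j' _].
  by rewrite C_zero.
have [->|an] := eqVneq (a (widen_ord (leqnSn iT) j')) 0; first by rewrite scale0r.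
by case: nz; exists j'.
Qed.

(** If [T' < 0], the projection to [b = 0] along [(zeta, T')] preserves negativity, since it drops
    the nonnegative term [- b ^+ 2 / T']. If [T' > 0], the vectors with [b = 0] have codimension at
    most one in a negative subspace. *)
Lemma index_upper i iT : negative_subspace [set x : X * R | E x.1] B i ->
  negative_index E C iT -> (i <= iT + (0 < T')%R)%N.
Proof.
move=> [e [Ee eneg]] [_ imax].
pose x j := (e j).1; pose b j := (e j).2.
have Ex j : E (x j) by exact: Ee.
have [T'p|T'n] := ltP 0 T'; last first.
  have T'lt : T' < 0 by rewrite lt_neqAle T'0.
  rewrite addn0; apply: imax; exists (fun j => x j - (b j / T') *: zeta); split=> [j|a ane].
    by rewrite addrC -scaleNr; exact: E_comb.
  have := eneg a ane; rewrite sum_pair reduced_square; last exact: E_sum.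
  have -> : \sum_j a j *: (x j - (b j / T') *: zeta) =
     \sum_j a j *: x j - ((\sum_j a j * b j) / T') *: zeta.
    rewrite mulr_suml scaler_suml -sumrB; apply: eq_bigr => j _.
    by rewrite scalerBr scalerA mulrA.
  move: (\sum_j a j * b j) => bb; set z := C _ _ => h.
  have : bb ^+ 2 / T' <= 0 by rewrite mulr_ge0_le0 ?sqr_ge0// invr_le0 ltW.
  by move: h; rewrite -/z; lra.
rewrite addn1; case: i e Ee eneg @x @b Ex => [//|m] e Ee eneg x b Ex.
have [j0 j0P] : exists j0, b j0 = 0 -> forall j, b j = 0.
  have [[j bj]|nb] := pselect (exists j, b j != 0); first by exists j => z; rewrite z eqxx in bj.
  exists ord0 => _ j; apply/eqP/negPn/negP => bj; apply: nb; by exists j.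
(* Multiples of the vector [j0] remove the second component of the others. If all second components
   vanish, the division by zero gives [rho = 0] and one vector is simply dropped. *)
pose rho j := b (lift j0 j) / b j0.
apply: imax; exists (fun j => x (lift j0 j) - rho j *: x j0); split=> [j|a [j1 aj1]].
  by rewrite addrC -scaleNr; exact: E_comb.
pose a' j := if unlift j0 j is Some j' then a j' else - \sum_j a j * rho j.
have := eneg a'; have a'ne : exists j, a' j != 0 by exists (lift j0 j1); rewrite /a' liftK.
move=> /(_ a'ne); rewrite sum_pair.
have bE : \sum_j a' j * (e j).2 = 0.
  rewrite (bigD1_ord j0)//= /a' unlift_none.
  rewrite [X in _ + X](eq_bigr (fun j => a j * b (lift j0 j))); last by move=> j _; rewrite liftK.
  rewrite mulNr mulr_suml -/(b j0).
  have [b0|b0] := eqVneq (b j0) 0.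
    by rewrite b0 !big1 ?oppr0 ?add0r// => j _; rewrite ?mulr0// (j0P b0) mulr0.
  by rewrite addrC -sumrB big1// => j _; rewrite /rho -mulrA divfK// subrr.
have xE : \sum_j a' j *: (e j).1 = \sum_j a j *: (x (lift j0 j) - rho j *: x j0).
  rewrite (bigD1_ord j0)//= /a' unlift_none.
  rewrite [X in _ + X](eq_bigr (fun j => a j *: x (lift j0 j))); last by move=> j _; rewrite liftK.
  rewrite addrC scaleNr scaler_suml -sumrB; apply: eq_bigr => j _.
  by rewrite scalerBr scalerA.
rewrite bE xE reduced_square; last first.
  by apply: E_sum => j; rewrite addrC -scaleNr; exact: E_comb.
by rewrite mul0r scale0r subr0 expr0n mul0r subr0.
Qed.

Lemma index_formula i iT : negative_index [set x : X * R | E x.1] B i ->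
  negative_index E C iT -> i = (iT + (0 < T')%R)%N.
Proof.
move=> hi hT; apply/eqP; rewrite eqn_leq; apply/andP; split.
  exact: index_upper hi.1 hT.
exact: index_lower hi hT.1.
Qed.

End Index.

(** * Polarization of quadratic identities and limits *)

Section Polarization.

Context {R : realType} {X : lmodType R} (S : set X) (F : X -> X -> R).
Hypothesis S_comb : forall a x y, S x -> S y -> S (a *: x + y).
Hypothesis F_sym : symmetric_bilinear_on S F.

Lemma S_add x y : S x -> S y -> S (x + y).
Proof. by move=> Sx Sy; rewrite -[x]scale1r; exact: S_comb. Qed.

Lemma bilinear_add x y z : S x -> S y -> S z -> F (x + y) z = F x z + F y z.
Proof. by move=> Sx Sy Sz; have := F_sym.2 1 x y z Sx Sy Sz; rewrite scale1r mul1r. Qed.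

Lemma polar_expand x y : S x -> S y -> F (x + y) (x + y) = F x x + 2 * F x y + F y y.
Proof.
move=> Sx Sy; have Sxy := S_add Sx Sy.
rewrite bilinear_add// (F_sym.1 x _ Sx Sxy) (F_sym.1 y _ Sy Sxy) !bilinear_add//.
by rewrite (F_sym.1 y x Sy Sx); ring.
Qed.

Lemma polar_zero x y : S x -> S y -> F x x = 0 -> F y y = 0 -> F (x + y) (x + y) = 0 -> F x y = 0.
Proof. by move=> Sx Sy; rewrite polar_expand// => -> ->; move: (F x y) => f; lra. Qed.

(** Second variations are continuous as quadratic forms; continuity in one argument with the other
    one fixed follows by polarization. *)
Lemma polar_cvg (x_ : nat -> X) x y : (forall m, S (x_ m)) -> S x -> S y ->
  (fun m => F (x_ m) (x_ m)) @ \oo --> F x x ->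
  (fun m => F (x_ m + y) (x_ m + y)) @ \oo --> F (x + y) (x + y) ->
  (fun m => F (x_ m) y) @ \oo --> F x y.
Proof.
move=> Sx_ Sx Sy h1 h2.
have e z : S z -> F z y = 2^-1 * (F (z + y) (z + y) - F z z - F y y).
  by move=> Sz; rewrite polar_expand//; field.
rewrite e// (_ : (fun m => _) = (fun m => 2^-1 * (F (x_ m + y) (x_ m + y) - F (x_ m) (x_ m) - F y y))); last first.
  by apply/funext => m; rewrite e.
apply: cvgM; first exact: cvg_cst.
by apply: cvgB; [exact: cvgB|exact: cvg_cst].
Qed.

End Polarization.

(** * The Hessian along the orbit cylinder *)

Section Hessian.

Context {R : realType} {n : nat} {M : manifold R n}.
Variables (L : tangent_fun M) (A : loop M -> R).

Lemma W12_cvg_add (q : loop M) (x_ : nat -> field M) (x y : field M) :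
  W12_cvg q x_ x -> W12_cvg q (fun m => x_ m + y) (x + y).
Proof.
move=> h c a b ab dc i e; have := h c a b ab dc i.
have -> // : e = (fun m t => x_ m t c 0 i - x t c 0 i).
by apply/funext => m; apply/funext => t; rewrite /e !mxE; ring.
Qed.

(** Vanishing on sums of two pieces gives, by polarization, vanishing on pairs of pieces; density
    then removes the restriction to pieces in one argument at a time. *)
Lemma diagonal_vanishing (q : loop M) (D : field M -> field M -> R) : smooth_loop q ->
  symmetric_bilinear_on [set xi | W12_field q xi] D ->
  (forall (x_ : nat -> field M) x, (forall m, W12_field q (x_ m)) -> W12_field q x ->
     W12_cvg q x_ x -> (fun m => D (x_ m) (x_ m)) @ \oo --> D x x) ->
  (forall c eta c' eta', supported q c eta -> supported q c' eta' ->
     D (piece q c eta + piece q c' eta') (piece q c eta + piece q c' eta') = 0) ->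
  forall x, W12_field q x -> D x x = 0.
Proof.
move=> sq sD cD D0.
pose S := [set xi : field M | W12_field q xi].
have Sc a x y : S x -> S y -> S (a *: x + y) by exact: W12_field_comb.
have cross y : S y -> (forall c eta, supported q c eta -> D (piece q c eta) y = 0) ->
    forall x, S x -> D x y = 0.
  move=> Sy py; apply: (@vanishing_on_pieces _ _ _ q (fun x => D x y) sq) => //.
    by move=> a x z Sx Sz; exact: sD.2.
  move=> x_ x Sx_ Sx h; apply: (polar_cvg Sc sD) => //; first exact: cD.
  apply: cD; last exact: W12_cvg_add.
    by move=> m; exact: (S_add Sc (Sx_ m) Sy).
  exact: (S_add Sc Sx Sy).
have pp0 c eta : supported q c eta -> D (piece q c eta) (piece q c eta) = 0.
  move=> se; have Sp := piece_W12 sq se.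
  have := D0 c eta c eta se se; rewrite (polar_expand Sc sD)//.
  by move: (D _ _) => d; lra.
have pp c eta c' eta' : supported q c eta -> supported q c' eta' ->
    D (piece q c eta) (piece q c' eta') = 0.
  move=> se se'; have Sp := piece_W12 sq se; have Sp' := piece_W12 sq se'.
  exact: (polar_zero Sc sD Sp Sp' (pp0 _ _ se) (pp0 _ _ se') (D0 _ _ _ _ se se')).
have xp x c eta : S x -> supported q c eta -> D x (piece q c eta) = 0.
  move=> Sx se; apply: (cross _ (piece_W12 sq se)) => // c' eta' se'; exact: pp.
move=> x Sx; apply: cross => // c eta se.
by rewrite (sD.1 _ _ (piece_W12 sq se) Sx); exact: xp.
Qed.

(** Applied to the difference of the two forms: a variation with [b = 0] leaves the period fixed, so
    both forms are the second derivative of the same function. *)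
Lemma hessian_restriction (k T : R) (q : loop M) B C : smooth_loop q ->
  free_second_variation L A k q T B -> fixed_second_variation L A k T q C ->
  forall x, W12_field q x -> B (x, 0) (x, 0) = C x x.
Proof.
move=> sq [[Bs Bl] [Bc Bd]] [[Cs Cl] [Cc Cd]] x wx.
pose D (x y : field M) := B (x, 0) (y, 0) - C x y.
apply/eqP; rewrite -subr_eq0; apply/eqP; rewrite -/(D x x).
apply: (diagonal_vanishing sq _ _ _ wx).
- split=> [y z wy wz|a y z v wy wz wv]; first by rewrite /D Bs// Cs.
  rewrite /D Cl// (_ : (a *: y + z, 0) = a *: (y, 0) + (z, 0)) ?Bl//; first by ring.
  by apply: injective_projections; rewrite //= scaler0 addr0.
- move=> x_ y wx_ wy h; apply: cvgB; last exact: Cc.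
  by apply: (Bc (fun m => (x_ m, 0)) (y, 0)) => //; exact: cvg_cst.
- move=> c eta c' eta' se se'.
  have [eps [u [vu fu]]] := two_pieces_variation sq se se'.
  rewrite /D -fu; apply/eqP; rewrite subr_eq0; apply/eqP.
  apply: second_derivative_unique (Cd eps u vu).
  have := Bd eps u 0 vu.
  rewrite (_ : (fun r => _) = (fun r => fixed_action L A k T (fun t => u (r, t))))//.
  by apply/funext => r; rewrite mulr0 addr0.
Qed.

Lemma action_mixed (q : loop M) eps w k T b (sigma : two_tensor M) (ref : loop M -> loop M) :
  0 < T -> (forall c : chart M, smooth_on (im c `*` setT) (tangent_in L c)) ->
  is_two_tensor sigma -> reference_loops ref -> flux_functional sigma ref A ->
  smooth_family (V := (R * R)%type) eps q w ->
  exists l1 l2, mixed_differentiable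
    (fun p r => free_action L A k (fun t => w ((p.1, r), t)) (T + p.2 + r * b)) l1 l2.
Proof.
move=> T0 sL ts rl fA fw.
have [l1 [l2 hl]] := energy_mixed fw k b T0 sL.
have [m1 [m2 hm]] := flux_mixed fw ts rl fA.
exists (1 * l1 + m1), (1 * l2 + m2).
apply: (mixed_differentiable_eq ltr01 _ (mixed_differentiable_comb 1 hl hm)) => p r _ _.
by rewrite /free_action mul1r.
Qed.

Lemma free_action_shift (q : loop M) k s T : smooth_loop q ->
  (forall c : chart M, smooth_on (im c `*` setT) (tangent_in L c)) ->
  free_action L A (k + s) q T = free_action L A k q T + s * T.
Proof.
move=> sq sL.
have m01 : measurable (`[0, 1]%classic : set (measurableTypeR R)) by exact: measurable_itv.
have ig : (@lebesgue_measure R).-integrable `[0, 1] (EFin \o (fun t => L (q t) (T^-1 *: velocity q t) + k)).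
  apply: continuous_integrable_cc; apply: continuous_in_subspaceT => t _.
  apply: cvgD; last exact: cvg_cst.
  have := @smooth_tangent_fun _ _ R M L setT q (fun=> T^-1) 1 sL openT sq.1 _.
  by move=> /(_ (fun r => Cr_cst r setT T^-1) 0%N t I).
have ik : (@lebesgue_measure R).-integrable `[0, 1] (EFin \o (fun=> s)).
  exact: (integrable_cst_fin s m01 (mu_itv_fin 0 1)).
rewrite /free_action.
have -> : \int[@lebesgue_measure R]_(t in `[0, 1]) (L (q t) (T^-1 *: velocity q t) + (k + s)) =
  \int[@lebesgue_measure R]_(t in `[0, 1]) (L (q t) (T^-1 *: velocity q t) + k) + s.
  have es : \int[@lebesgue_measure R]_(t in `[0, 1]) s = s.
    by rewrite (Rintegral_cst _ m01) mu_itv// subr0 mulr1.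
  rewrite -[X in _ = _ + X]es -(RintegralD m01 ig ik).
  by apply: eq_Rintegral => t _; rewrite addrA.
by ring.
Qed.

Lemma is_derive_shear (f : R -> R) (s c b : R) : is_derive (0 : R) (1 : R) f 0 ->
  is_derive (0 : R) (1 : R) (fun r => f r - s * (c + r * b)) (- (s * b)).
Proof.
move=> df; apply: is_derive_eq.
by rewrite -![_ *: _]/(_ * _); ring.
Qed.

Section Cylinder.

Variables (sigma : two_tensor M) (ref : loop M -> loop M).
Variables (k : R) (q : loop M) (T eps : R) (qs : R -> loop M) (Ts : R -> R).
Hypothesis sL : forall c : chart M, smooth_on (im c `*` setT) (tangent_in L c).
Hypotheses (ts : is_two_tensor sigma) (rl : reference_loops ref) (fA : flux_functional sigma ref A).
Hypotheses (crit : critical L A k q T) (cyl : orbit_cylinder L A k q T eps qs Ts).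

(** The second parameter is idle at this stage; it is reserved for the displacement, which
    [family_add_piece] adds through [kap = snd]. *)
Definition cylinder_family (z : (R * R) * R) : M := qs (k + z.1.1) z.2.

Definition cylinder_field : field M := fun t => tderiv (fun z : R * R => qs z.1 z.2) (k, t) (1, 0).

Lemma cylinder_smooth_family : smooth_family eps q cylinder_family.
Proof.
have [e0 [sQ [sTs [cr [qk Tk]]]]] := cyl.
have small (v : R * R) : `|v| < eps -> `|k + v.1 - k| < eps.
  by rewrite addrC addrA addNr add0r prod_normE gt_max => /andP[].
split=> //.
- apply: (@smooth_to_comp _ _ _ _ _ (cyl_set eps) [set z : R * R | `|z.1 - k| < eps]
    (fun z : (R * R) * R => (k + z.1.1, z.2)) (fun z => qs z.1 z.2)) => //.
  + exact: finite_basis_prod finite_basis_R finite_basis_R.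
  + exact: open_cyl_set.
  + by move=> z; exact: small.
  + have oc : open (@cyl_set R (R * R)%type eps) by exact: open_cyl_set.
    move=> r; apply: Cr_pair => //; last by apply: Cr_snd => //; exact: Cr_id.
    apply: CrD => //; first exact: Cr_cst.
    by apply: Cr_fst => //; apply: Cr_fst => //; exact: Cr_id.
- by move=> v t ve; have [[_ pq] _] := cr _ (small v ve); exact: pq.
- by move=> t; rewrite /cylinder_family /= addr0 qk.
Qed.

Lemma cylinder_tderiv t (v : R * R) :
  tderiv cylinder_family (0, t) (v, 0) = v.1 *: cylinder_field t.
Proof.
have [e0 [sQ _]] := cyl.
have -> : cylinder_family = (fun z : R * R => qs z.1 z.2) \o (fun z : (R * R) * R => (k + z.1.1, z.2)) by [].
rewrite (@tderiv_affine _ _ _ _ _ (fun z : R * R => qs z.1 z.2) (fun z : (R * R) * R => (k + z.1.1, z.2)) _ _ (v.1, 0)) => [|h]; last first.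
  by apply: injective_projections => //=; rewrite !addr0 addrC.
rewrite /= addr0 /cylinder_field; apply/funext => d; rewrite /tderiv /=.
have -> : ((v.1, 0) : R * R) = v.1 *: (1, 0).
  by apply: injective_projections; rewrite /= ?scaler0// -[RHS]/(_ * _) mulr1.
rewrite -[RHS]/(v.1 *: (if `[< dom d (qs k t) >] then _ else _)).
case: ifPn => [/asboolP dq|_]; last by rewrite scaler0.
rewrite derive_dirZ//; apply: (smooth_to_differentiable sQ) => //.
by rewrite /= subrr normr0.
Qed.

Lemma cylinder_field_W12 : W12_field q cylinder_field.
Proof.
have [e0 _] := cyl; have e00 : `|(0 : R * R)| < eps by rewrite normr0.
have [e' _ [vu fu]] := line_variation (V := (R * R)%type) (1, 0) (finite_basis_prod finite_basis_R finite_basis_R)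
  cylinder_smooth_family e00.
have := variation_field_W12 vu; rewrite fu.
have -> : (fun t => cylinder_family (0, t)) = q.
  by have [_ _ _ fq] := cylinder_smooth_family; exact/funext.
by rewrite (_ : (fun t => _) = cylinder_field)//; apply/funext => t; rewrite cylinder_tderiv scale1r.
Qed.

Lemma hessian_cross_piece B c eta b : free_second_variation L A k q T B ->
  supported q c eta -> B (cylinder_field, derive1 Ts k) (piece q c eta, b) = - b.
Proof.
move=> fB se; have [Bsym [_ Bd]] := fB.
have [e0 [sQ [sTs [cr [qk Tk]]]]] := cyl.
have [sq [T0 crq]] := crit.
have fbP := finite_basis_prod (@finite_basis_R R) (@finite_basis_R R).
pose kap : {linear (R * R)%type -> R} := snd.
have ckap : continuous kap by move=> z; exact: cvg_snd.
have [eps1 [w [e1e fw wu dw]]] := family_add_piece fbP ckap cylinder_smooth_family se.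
have [e10 sw pw w0] := fw.
set zeta := cylinder_field; set T' := derive1 Ts k; set p := piece q c eta.
(* [x.1] moves along the orbit cylinder, [x.2] shifts the period independently of it, and [r]
   displaces by the piece and changes the period at rate [b]. *)
pose Phi (x : R * R) r := free_action L A k (fun t => w ((x.1, r), t)) (T + x.2 + r * b).
have [l1 [l2 hm]] : exists l1 l2, mixed_differentiable Phi l1 l2.
  exact: (action_mixed k b T0 sL ts rl fA fw).
(* The pair of energy [k + s] is critical for the action of that energy. The action of energy [k] is
   smaller by [s] times the period, so its derivative in [r] is [- (s * b)]; the period shift to
   insert is [Ts (k + s) - T]. *)
have first : - b = l1 + T' * l2.
  have dT : is_derive (0 : R) (1 : R) (fun s => Ts (k + s) - T) T'.
    have dk : derivable Ts k 1.
      by apply: diff_derivable; apply: (sTs 1%N).1; rewrite /= subrr normr0.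
    have dk' : is_derive (k + 0) (1 : R) Ts T' by rewrite addr0 /T' derive1E; apply: DeriveDef.
    have ds : is_derive (0 : R) (1 : R) (fun s : R => k + s) 1.
      by have := is_deriveD (is_derive_cst k (0 : R) 1) (is_derive_id (0 : R) 1); rewrite add0r.
    have := @is_derive1_comp _ Ts (fun s => k + s) 0 T' 1 dk' ds.
    rewrite mulr1 => h; have := is_deriveB h (is_derive_cst T (0 : R) 1).
    by rewrite subr0.
  apply: (mixed_first hm _ dT); first by rewrite addr0 Tk subrr.
  have /nbhs_ballP[d /= d0 hd] : \forall s \near (0 : R), `|s| < eps1.
    by apply/nbhs_ballP; exists eps1 => // s; rewrite /ball /= sub0r normrN.
  apply/nbhs_ballP; exists d => // s /hd /= se1.
  have sE : `|k + s - k| < eps by rewrite addrC addrA addNr add0r (lt_le_trans se1).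
  have s0 : `|((s, 0) : R * R)| < eps1 by rewrite prod_normE gt_max /= se1 normr0.
  have [e' _ [vu _]] := line_variation (V := (R * R)%type) (0, 1) fbP fw s0.
  rewrite (_ : (fun t => w ((s, 0), t)) = qs (k + s)) in vu; last first.
    by apply/funext => t; rewrite wu.
  have := (cr _ sE).2.2 _ _ b vu.
  move=> /(is_derive_shear s (Ts (k + s)) b); apply: near_eq_is_derive.
  apply/nbhs_ballP; exists d => // r /hd /= re1.
  have -> : (fun t => w ((s, 0) + r *: (0, 1), t)) = (fun t => w ((s, r), t)).
    apply/funext => t; congr (w (_, t)).
    by apply: injective_projections; rewrite /= ?scaler0 ?addr0// add0r -[LHS]/(_ * _) mulr1.
  rewrite free_action_shift; [|exact: (family_loop fw (pair_norm_lt (p := (s, 0)) s0 re1))|exact: sL].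
  by rewrite addrK /Phi /= [T + (_ - _)]addrC subrK.
(* The mixed difference on the diagonal combines second-order expansions along the directions (1,
   1), (1, 0) and (0, 1), each with error [e / 3]; polarizing their quadratic terms leaves the cross
   term [B (zeta, T') (p, b)]. *)
rewrite first; apply: (mixed_second hm) => e e_0.
pose BB (x y : R) := B (x *: zeta + y *: p, x * T' + y * b) (x *: zeta + y *: p, x * T' + y * b).
have quad x y : exists2 d, 0 < d & forall r, `|r| < d ->
    `|Phi (x * r, x * r * T') (y * r) - Phi (0, 0) 0 - BB x y / 2 * r ^+ 2| <= e / 3 * r ^+ 2.
  have v0 : `|(0 : R * R)| < eps1 by rewrite normr0.
  have [e' _ [vu vf]] := line_variation (V := (R * R)%type) (x, y) fbP fw v0.
  rewrite (_ : (fun t => w (0, t)) = q) in vu; last exact/funext.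
  have vfE : variation_field (fun z => w (0 + z.1 *: (x, y), z.2)) = x *: zeta + y *: p.
    by rewrite vf; apply/funext => t; rewrite dw cylinder_tderiv.
  have := Bd _ _ (x * T' + y * b) vu; rewrite vfE => h2.
  have [d d0 hd] := second_order_taylor h2 (crq _ _ (x * T' + y * b) vu) (divr_gt0 e_0 (ltr0Sn R 2)).
  have fE r : free_action L A k (fun t => w (0 + r *: (x, y), t)) (T + r * (x * T' + y * b)) =
      Phi (x * r, x * r * T') (y * r).
    have -> : T + r * (x * T' + y * b) = T + x * r * T' + y * r * b.
      by rewrite mulrDr addrA !mulrA ![r * _]mulrC.
    have -> // : (fun t => w (0 + r *: (x, y), t)) = (fun t => w ((x * r, y * r), t)).
    apply/funext => t; congr (w (_, t)).
    by apply: injective_projections; rewrite /= add0r -[LHS]/(_ * _) mulrC.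
  by exists d => // r /hd; rewrite !fE !mulr0 mul0r.
have BE : BB 1 1 = BB 1 0 + 2 * B (zeta, T') (p, b) + BB 0 1.
  have Sc (a : R) (z z' : field M * R) : W12_field q z.1 -> W12_field q z'.1 ->
    W12_field q (a *: z + z').1 by exact: W12_field_comb.
  have := @polar_expand R _ [set z : field M * R | W12_field q z.1] B Sc Bsym (zeta, T') (p, b)
    cylinder_field_W12 (piece_W12 sq se).
  rewrite /BB !scale1r !scale0r !mul1r !mul0r !addr0 !add0r => <-.
  by [].
have [d1 d10 h1] := quad 1 1; have [d2 d20 h2] := quad 1 0; have [d3 d30 h3] := quad 0 1.
exists (Num.min d1 (Num.min d2 d3)) => [|x]; first by rewrite !lt_min d10 d20.
rewrite !lt_min => /andP[/h1{}h1 /andP[/h2{}h2 /h3{}h3]].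
rewrite !mul1r !mul0r in h1 h2 h3.
rewrite /mixed (_ : _ - _ = (Phi (x, x * T') x - Phi (0, 0) 0 - BB 1 1 / 2 * x ^+ 2)
  - (Phi (x, x * T') 0 - Phi (0, 0) 0 - BB 1 0 / 2 * x ^+ 2)
  - (Phi (0, 0) x - Phi (0, 0) 0 - BB 0 1 / 2 * x ^+ 2)); last by rewrite BE; field.
apply: le_trans (ler_normB _ _) _.
have := ler_normB (Phi (x, x * T') x - Phi (0, 0) 0 - BB 1 1 / 2 * x ^+ 2)
  (Phi (x, x * T') 0 - Phi (0, 0) 0 - BB 1 0 / 2 * x ^+ 2).
by lra.
Qed.

Lemma hessian_cross B xi b : free_second_variation L A k q T B -> W12_field q xi ->
  B (cylinder_field, derive1 Ts k) (xi, b) = - b.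
Proof.
move=> fB wxi; have [Bsym [Bc Bd]] := fB; have sq := crit.1.
pose S := [set z : field M * R | W12_field q z.1].
have Sc (a : R) (z z' : field M * R) : S z -> S z' -> S (a *: z + z') by exact: W12_field_comb.
pose e : field M * R := (cylinder_field, derive1 Ts k).
have Se : S e := cylinder_field_W12.
have [c _] := dom_cover (q 0).
(* The zero field is a piece with empty support; it yields the value on the pure time direction
   [(0, b)]. *)
have s0 : supported q c (fun=> 0).
  by split=> // [r|]; [exact: Cr_cst|exists set0; split=> //; exact: closed0].
have p0 : piece q c (fun=> 0) = 0 by apply/funext => t; rewrite /piece eqxx.
have W0 : W12_field q 0 by rewrite -p0; exact: piece_W12.
have e0b : B e (0, b) = - b by have := hessian_cross_piece b fB s0; rewrite p0.
(* With [b = 0] the cross term vanishes on pieces, hence on all fields by density; the time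
   direction was treated separately. *)
have ex0 : B (xi, 0) e = 0.
  apply: (vanishing_on_pieces (l := fun x : field M => B (x, 0) e) sq) => //.
  - move=> a x y wx wy; rewrite -(Bsym.2 a (x, 0) (y, 0) e)//.
    by congr (B _ _); apply: injective_projections; rewrite //= scaler0 addr0.
  - move=> x_ x wx_ wx h.
    apply: (polar_cvg Sc Bsym (x_ := fun m => (x_ m, 0)) (x := (x, 0))) => //.
      by apply: (Bc (fun m => (x_ m, 0)) (x, 0)) => //; exact: cvg_cst.
    apply: (Bc (fun m => (x_ m, 0) + e) ((x, 0) + e)).
    + by move=> m; exact: (S_add Sc (x := (x_ m, 0)) (wx_ m) Se).
    + exact: (S_add Sc (x := (x, 0)) wx Se).
    + exact: W12_cvg_add.
    + exact: (cvg_cst (0 + derive1 Ts k)).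
  - move=> c' eta se; rewrite Bsym.1//; last exact: (piece_W12 sq se).
    by rewrite (hessian_cross_piece 0 fB se) oppr0.
rewrite -/e Bsym.1// (_ : (xi, b) = (xi, 0) + (0, b)); last first.
  by apply: injective_projections; rewrite /= ?addr0 ?add0r.
by rewrite (bilinear_add Bsym)// ex0 add0r Bsym.1.
Qed.

End Cylinder.

End Hessian.

Theorem theorem1p3 (R : realType) (n : nat) (M : manifold R n)
  (closedM : closed_manifold M) (connectedM : connected [set: M])
  (orientableM : orientable M)
  (g : two_tensor M) (g_metric : riemannian_metric g)
  (sigma : two_tensor M) (sigma_closed : closed_two_form sigma)
  (Mtilde : manifold R n) (pr : Mtilde -> M) (pr_cover : universal_cover pr)
  (theta : one_form Mtilde) (theta_form : is_one_form theta)
  (theta_primitive : primitive_of_lift pr sigma theta)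
  (theta_bounded : bounded_one_form pr g theta)
  (H : cotangent_fun M) (H_tonelli : tonelli g H)
  (L : tangent_fun M) (L_dual : fenchel_dual H L)
  (k : R) (k_regular : regular_value H k)
  (ref : loop M -> loop M) (ref_loops : reference_loops ref)
  (A : loop M -> R) (A_flux : flux_functional sigma ref A)
  (q : loop M) (T : R) (qT_critical : critical L A k q T)
  (eps : R) (qs : R -> loop M) (Ts : R -> R)
  (cylinder : nondegenerate_orbit_cylinder L A k q T eps qs Ts)
  (i iT : nat) (i_index : free_morse_index L A k q T i)
  (iT_index : fixed_morse_index L A k T q iT) :
  i%:R = iT%:R + 1 / 2 - 1 / 2 * correction_term k Ts :> R.
Proof.
have [cyl T'0] := cylinder.
have [B [fB Bi]] := i_index; have [C [fC Ci]] := iT_index.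
have sL := L_dual.1; have ts := sigma_closed.1.1.
have -> : i = (iT + (0 < derive1 Ts k)%R)%N.
  apply: (index_formula (E := [set xi | W12_field q xi]) (B := B) (C := C)
    (zeta := cylinder_field k qs) (T' := derive1 Ts k)) => //.
  - by move=> a x y; exact: W12_field_comb.
  - exact: (cylinder_field_W12 cyl).
  - exact: fB.1.
  - exact: (hessian_restriction qT_critical.1 fB fC).
  - by move=> x b wx; exact: (hessian_cross sL ts ref_loops A_flux qT_critical cyl).
rewrite /correction_term natrD; case: (ltrgtP (derive1 Ts k) 0) T'0 => // h _.
- by rewrite gtr0_sg ?oppr_gt0//=; field.
- by rewrite ltr0_sg ?oppr_lt0//=; field.
Qed.
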